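(* There exists an absolute constant $C>0$ such that, as $T\to\infty$, \[ \sum_{1\le n \leq T} \left|\zeta\!\left(\tfrac{1}{2} + in \right) \right|^2 = T\log \frac{T}{2\pi} + O \!\left(T \log T \exp \!\left(-C \frac{\log_2 T}{\log_3 T}\right) \right), \] where the sum runs over positive integers $n$.
   Context: $\zeta(s)$ denotes the Riemann zeta function. $\log_2 T=\log\log T$ and $\log_3 T=\log\log\log T$. *)

(* Defs.v *)
From Stdlib Require Import Reals.
From Coquelicot Require Import Coquelicot.
Open Scope R_scope.

Definition npow_neg (n : nat) (s : C) : C :=
  let L := ln (INR n) in
  let r := exp (- (Re s) * L) in
  (r * cos (- (Im s) * L), r * sin (- (Im s) * L)).

Fixpoint eta_partial (s : C) (N : nat) : C :=
  match N with
  | O => RtoC 0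
  | S m => Cplus (eta_partial s m) (Cmult (RtoC ((-1) ^ m)) (npow_neg (S m) s))
  end.

(* Dirichlet eta function (series converges for Re s > 0) *)
Definition eta (s : C) : C :=
  (real (Lim_seq (fun N => Re (eta_partial s N))),
   real (Lim_seq (fun N => Im (eta_partial s N)))).

Definition two_pow_one_minus (s : C) : C :=
  let L := ln 2 in
  let r := exp ((1 - Re s) * L) in
  (r * cos (- (Im s) * L), r * sin (- (Im s) * L)).

(* Riemann zeta via zeta(s) = eta(s) / (1 - 2^{1-s}); this is the analytic
   continuation of zeta on Re s > 0, s <> 1 (and in particular on the critical
   line, where 1 - 2^{1-s} <> 0). *)
Definition zeta (s : C) : C := Cdiv (eta s) (Cminus (RtoC 1) (two_pow_one_minus s)).

Fixpoint sum_1_to (f : nat -> R) (N : nat) : R :=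
  match N with
  | O => 0
  | S m => sum_1_to f m + f (S m)
  end.

(* floor of a real number, as a natural number (0 for negative input) *)
Definition floor_nat (T : R) : nat := Z.to_nat (Int_part T).

(* Main.v *)
(** For [1 <= t <= N], the Kusmin-Landau inequality applied to the alternating
    series of eta gives [zeta (1/2 + i t) = Z_N(t) + O (sqrt N / t)], where
    [Z_N(t)] is the Dirichlet polynomial [sum_(n <= N) n^(-1/2 - i t)]; the error
    contributes [O (N)] to the mean square over [t].  Put [U = ln N].  Averaging the
    range of [t] over [H ~ N / sqrt U] translates bounds the mean square of [Z_N]
    from both sides by [N ln N + O (N sqrt U)] plus the off-diagonal sum of
    [(m n)^(-1/2) min (N, 1 / (H sin^2 (ln (m / n) / 2)))].  Its large terms come from
    pairs with [m / n] close to [exp (2 PI k)], and they are harmless once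
    [|q exp (2 PI k) - p| >= exp (- sqrt U)] for [1 <= k <= ln U] and [1 <= q <= U]:
    the [n] for which [n exp (2 PI k)] is very close to an integer are then
    [U]-spaced.

    This lower bound is a weak quantitative form of Gelfond's theorem on [exp PI].
    The functions [exp (lambda x)], [lambda = a + i b] a Gaussian integer, take
    the value [exp (2 PI k a j)] at [x = 2 PI k j].  The determinant of their
    derivatives at [x = 2 PI k j], [j = 0, 1, 2], is tiny because its Taylor
    expansion at [0] only involves pairwise distinct exponents; were
    [exp (2 PI k)] too close to [p / q], it would be within a tiny distance of a
    nonzero Gaussian rational of controlled denominator.  The nonvanishing of
    a suitable minor is a zero estimate for [P_0 + P_1 Y + P_2 Y^2], obtained by
    eliminating against the shift [z -> z + i]. *)

(* Since [t] runs over integers only, a pair [m], [n] is seen through [ln (m / n)] modulo [2 PI]: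
   besides the diagonal, ratios near [exp (2 PI k)] resonate, and averaging over integer translates
   cannot make them cancel. They must be shown to be rare, and hence the transcendence argument.

   A polynomial as long as the range of [t], instead of the short sums of an approximate functional
   equation, makes the main term a single diagonal, [N * harmonic N].

   The error reached is [O (T sqrt (ln T))]. The term [T ln (2 PI)] is absorbed by it, and
   [sqrt (ln T) = ln T exp (- log_2 T / 2)] lies below the stated bound as soon as [log_3 T >= 1];
   hence [C = 1 / 2]. The distance [exp (- sqrt U)] enters only through its logarithm, which is
   again [sqrt U].

   In the determinant, each row is read as a function [z ^ s exp (2 PI k j z)] of the node
   [z = lambda], so that expanding it in powers of [z] leaves determinants of pure powers of the
   nodes. The zero estimate rests on the invariance of [exp (2 PI k z)] under [z -> z + i]. *)
From mathcomp Require all_boot all_order all_algebra fingroup perm complex Rstruct ring.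
From Stdlib Require Reals Lra Lia Factorial Classical_Prop.
From Coquelicot Require Coquelicot.

(** * Taylor expansion of [exp (a t) cos (b t)] and [exp (a t) sin (b t)] *)

Module ExpCos.
Import Reals Lra Lia Factorial Coquelicot.
Local Open Scope R_scope.

(* [(u + i v) * (a + i b) ^ n] as a pair *)
Fixpoint cpow (a b u v : R) (n : nat) : R * R :=
  match n with
  | O => (u, v)
  | S m => let z := cpow a b u v m in (a * fst z - b * snd z, b * fst z + a * snd z)
  end.

(** The real part of [(u + i v) exp ((a + i b) t)]. Differentiation multiplies [u + i v] by
    [a + i b], which is the recursion of [cpow]; [u + i v = - i] yields the imaginary part of
    [exp ((a + i b) t)]. *)
Definition expcos (a b u v t : R) := exp (a * t) * (u * cos (b * t) - v * sin (b * t)).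

Lemma is_derive_expcos a b u v t :
  is_derive (expcos a b u v) t (expcos a b (a * u - b * v) (b * u + a * v) t).
Proof. unfold expcos; auto_derive; [trivial | ring]. Qed.

Lemma Derive_n_expcos a b u v n t :
  Derive_n (expcos a b u v) n t =
  expcos a b (fst (cpow a b u v n)) (snd (cpow a b u v n)) t.
Proof.
revert t; induction n as [|n IH]; intros t; [reflexivity|].
simpl Derive_n; rewrite (Derive_ext _ _ _ IH).
now apply is_derive_unique, is_derive_expcos.
Qed.

Lemma ex_derive_n_expcos a b u v n t : ex_derive_n (expcos a b u v) n t.
Proof.
destruct n as [|n]; [exact I|]; simpl.
apply (ex_derive_ext (expcos a b (fst (cpow a b u v n)) (snd (cpow a b u v n)))).
  intros s; symmetry; apply Derive_n_expcos.
eexists; apply is_derive_expcos.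
Qed.

Lemma cpow_bound a b u v n :
  Rabs (fst (cpow a b u v n)) + Rabs (snd (cpow a b u v n))
  <= (Rabs a + Rabs b) ^ n * (Rabs u + Rabs v).
Proof.
induction n as [|n IH]; [simpl; lra|].
simpl cpow; set (z := cpow a b u v n) in *; simpl fst; simpl snd.
assert (H1 : Rabs (a * fst z - b * snd z) <= Rabs a * Rabs (fst z) + Rabs b * Rabs (snd z)).
  rewrite <- !Rabs_mult; apply Rle_trans with (1 := Rabs_triang _ _); rewrite Rabs_Ropp; lra.
assert (H2 : Rabs (b * fst z + a * snd z) <= Rabs b * Rabs (fst z) + Rabs a * Rabs (snd z)).
  rewrite <- !Rabs_mult; apply Rabs_triang.
assert (H0 : 0 <= Rabs a + Rabs b) by (pose proof (Rabs_pos a); pose proof (Rabs_pos b); lra).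
pose proof (Rmult_le_compat_l _ _ _ H0 IH) as H3.
simpl pow; nra.
Qed.

Lemma expcos_bound a b u v t : Rabs (expcos a b u v t) <= exp (a * t) * (Rabs u + Rabs v).
Proof.
unfold expcos; rewrite Rabs_mult, (Rabs_pos_eq (exp _)) by (left; apply exp_pos).
apply Rmult_le_compat_l; [left; apply exp_pos|].
apply Rle_trans with (1 := Rabs_triang _ _); rewrite Rabs_Ropp, !Rabs_mult.
assert (Rabs (cos (b * t)) <= 1) by (apply Rabs_le, COS_bound).
assert (Rabs (sin (b * t)) <= 1) by (apply Rabs_le, SIN_bound).
pose proof (Rabs_pos u); pose proof (Rabs_pos v); nra.
Qed.

(** Real and imaginary parts are treated separately because the Lagrange remainder is a real
    statement. It is at most [w n], a constant times [(y (|a| + |b|)) ^ (n + 1) / (n + 1)!], by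
    [cpow_bound]. *)
Lemma expcos_taylor a b u v y : 0 < y ->
  is_lim_seq (fun n => sum_f_R0 (fun m => y ^ m / INR (fact m) * fst (cpow a b u v m)) n)
    (expcos a b u v y).
Proof.
intros Hy.
set (K := exp (Rabs a * y) * (Rabs u + Rabs v)).
set (w := fun n => K * ((y * (Rabs a + Rabs b)) ^ S n / INR (fact (S n)))).
assert (Hw : is_lim_seq w 0).
  unfold w; replace (Finite 0) with (Rbar_mult K 0) by (simpl; f_equal; ring).
  apply is_lim_seq_scal_l.
  apply (is_lim_seq_incr_1 (fun n => (y * (Rabs a + Rabs b)) ^ n / INR (fact n))).
  apply is_lim_seq_Reals, cv_speed_pow_fact.
assert (Hn : is_lim_seq (fun n => - w n) 0).
  replace (Finite 0) with (Rbar_opp 0) by (simpl; f_equal; ring).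
  now apply is_lim_seq_opp in Hw.
apply (is_lim_seq_le_le (fun n => expcos a b u v y + - w n) _ (fun n => expcos a b u v y + w n)).
2: { replace (Finite (expcos a b u v y)) with (Finite (expcos a b u v y + 0)) by (f_equal; ring).
     apply is_lim_seq_plus'; [apply is_lim_seq_const | exact Hn]. }
2: { replace (Finite (expcos a b u v y)) with (Finite (expcos a b u v y + 0)) by (f_equal; ring).
     apply is_lim_seq_plus'; [apply is_lim_seq_const | exact Hw]. }
intros n.
destruct (Taylor_Lagrange (expcos a b u v) n 0 y Hy) as [z [Hz E]].
  intros; apply ex_derive_n_expcos.
assert (E2 : sum_f_R0 (fun m => (y - 0) ^ m / INR (fact m) * Derive_n (expcos a b u v) m 0) n =
  sum_f_R0 (fun m => y ^ m / INR (fact m) * fst (cpow a b u v m)) n).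
  apply sum_eq; intros i _; rewrite Derive_n_expcos, Rminus_0_r; unfold expcos.
  rewrite !Rmult_0_r, exp_0, cos_0, sin_0; ring.
rewrite E2, Rminus_0_r, Derive_n_expcos in E.
assert (Hr : Rabs (y ^ S n / INR (fact (S n)) *
   expcos a b (fst (cpow a b u v (S n))) (snd (cpow a b u v (S n))) z) <= w n).
  rewrite Rabs_mult; unfold w, K.
  assert (P : 0 <= y ^ S n / INR (fact (S n))).
    apply Rdiv_le_0_compat; [apply pow_le; lra | apply INR_fact_lt_0].
  rewrite (Rabs_pos_eq _ P).
  rewrite Rpow_mult_distr.
  apply Rle_trans with (y ^ S n / INR (fact (S n)) *
    (exp (Rabs a * y) * ((Rabs a + Rabs b) ^ S n * (Rabs u + Rabs v)))).
  2: { right; field; apply INR_fact_neq_0. }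
  apply Rmult_le_compat_l; [exact P|].
  apply Rle_trans with (1 := expcos_bound _ _ _ _ _).
  apply Rmult_le_compat.
  - left; apply exp_pos.
  - apply Rplus_le_le_0_compat; apply Rabs_pos.
  - assert (a * z <= Rabs a * y).
      apply Rle_trans with (Rabs a * z); [apply Rmult_le_compat_r; [lra | apply Rle_abs]|].
      apply Rmult_le_compat_l; [apply Rabs_pos | lra].
    destruct (Rle_lt_or_eq_dec _ _ H) as [H1|H1]; [left; now apply exp_increasing | rewrite H1; lra].
  - apply cpow_bound.
apply Rabs_le_between in Hr; lra.
Qed.

End ExpCos.

(** * Interpolation determinants at Gaussian integers *)

Module Determinant.
Import all_boot all_order all_algebra fingroup perm complex Rstruct ring.
Import Classical_Prop ExpCos Order.TTheory GRing.Theory Num.Theory.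
Set Implicit Arguments. Unset Strict Implicit. Unset Printing Implicit Defensive.
Local Open Scope ring_scope.
Local Open Scope complex_scope.
Local Notation R := Rdefinitions.R.

(** * Zero estimate on a grid of Gaussian integers *)

Section ZeroEstimate.
Variables (F : numFieldType) (im : F).
Hypothesis im2 : im ^+ 2 = -1.

Definition gpt (a b : nat) : F := a%:R + im * b%:R.
(** The shift raises [b] and keeps [a]. The quantity [X ^+ a], standing for the exponential at the
    node, is therefore unchanged, and two shifted relations can be combined to eliminate a term. *)
Definition pshift (p : {poly F}) : {poly F} := p \Po ('X + im%:P).

Lemma horner_pshift p a b : (pshift p).[gpt a b] = p.[gpt a b.+1].
Proof.
rewrite /pshift horner_comp !hornerE /gpt; congr (p.[_]).
by rewrite -natr1; ring.
Qed.

Lemma size_pshift p : size (pshift p) = size p.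
Proof. by rewrite /pshift size_comp_poly2 // size_XaddC. Qed.

(** A coincidence gives [a - a' = im * (b' - b)]; squaring makes a sum of two squares of real
    elements vanish. *)
Lemma gpt_inj a b a' b' : gpt a b = gpt a' b' -> (a = a') /\ (b = b').
Proof.
move=> h.
have e1 : (a%:R - a'%:R : F) = im * (b'%:R - b%:R).
  by move: h; rewrite /gpt => h; apply/eqP; rewrite mulrBr -subr_eq0; apply/eqP;
     rewrite -(subrr (a%:R + im * b%:R)) {2}h; ring.
have e2 : (a%:R - a'%:R : F) ^+ 2 + (b'%:R - b%:R) ^+ 2 = 0.
  by rewrite e1 exprMn im2; ring.
have r1 : (a%:R - a'%:R : F) \is Num.real by rewrite rpredB ?realn.
have r2 : (b'%:R - b%:R : F) \is Num.real by rewrite rpredB ?realn.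
move/eqP: e2; rewrite paddr_eq0 -?realEsqr // !expf_eq0 /= !subr_eq0.
by rewrite !eqr_nat => /andP[/eqP -> /eqP ->].
Qed.

Lemma eventually_nonroot p : p != 0 ->
  exists n0, forall n, (n0 <= n)%N -> p.[gpt 0 n] != 0.
Proof.
have [k] := ubnP (size p); elim: k p => // k IH p hs p0.
case: (classic (exists n, p.[gpt 0 n] = 0)) => [[n hn]|hn]; last first.
  by exists 0%N => n _; apply/eqP => e; apply: hn; exists n.
have /factor_theorem [q eq] : root p (gpt 0 n) by apply/eqP.
have q0 : q != 0 by apply: contra_neq p0 => q0; rewrite eq q0 mul0r.
have sq : (size q < k)%N.
  by move: hs; rewrite eq size_Mmonic ?monicXsubC // size_XsubC addn2 /= ltnS.
have [n0 h0] := IH q sq q0.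
exists (maxn n0 n.+1) => m; rewrite geq_max => /andP[h1 h2].
rewrite eq !hornerE mulf_neq0 ?h0 // subr_eq0; apply/eqP.
by case/gpt_inj => _ e; rewrite e ltnn in h2.
Qed.

(** The quotient [q / p] is invariant under the shift, hence constant along the nodes [gpt 0 n]
    beyond the last root of [p]; then [q - c p] vanishes at infinitely many nodes. *)
Lemma pshift_proportional p q : p != 0 ->
  p * pshift q = pshift p * q -> exists c, q = c *: p.
Proof.
move=> p0 h; have [n0 hn] := eventually_nonroot p0.
pose c := q.[gpt 0 n0] / p.[gpt 0 n0]; exists c.
have key n : (n0 <= n)%N -> q.[gpt 0 n] = c * p.[gpt 0 n].
  elim: n => [|n IH].
    by rewrite leqn0 => /eqP e; rewrite /c e divfK // hn // e.
  rewrite leq_eqVlt => /orP[/eqP <-|]; first by rewrite /c divfK ?hn.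
  rewrite ltnS => le; have := congr1 (fun r => r.[gpt 0 n]) h.
  rewrite !hornerM !horner_pshift (IH le) => e.
  by apply: (mulfI (hn _ le)); rewrite e; ring.
apply/eqP; rewrite -subr_eq0; apply/eqP; apply/eqP; apply/negPn/negP => d0.
have [n1 h1] := eventually_nonroot d0.
have := h1 _ (leq_maxr n0 n1).
by rewrite !hornerE (key _ (leq_maxl _ _)) subrr eqxx.
Qed.

Section Grid.
Variables (X : F).
Hypothesis Xinj : forall a b : nat, X ^+ a = X ^+ b -> a = b.

(** As the [X ^+ a] are distinct, [q] vanishes at no more of them than its degree. In each of the
    other columns [p] has [B] roots, which is too many for its size. *)
Lemma grid_zero (p q : {poly F}) (L B : nat) : q != 0 ->
  (forall a b, (a < L)%N -> (b < B)%N -> p.[gpt a b] * q.[X ^+ a] = 0) ->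
  (size p <= (L - (size q).-1) * B)%N -> p = 0.
Proof.
move=> q0 hz hs; apply/eqP/negPn/negP => p0.
pose As := [seq a <- iota 0 L | q.[X ^+ a] != 0].
have sAs : (L - (size q).-1 <= size As)%N.
  rewrite leq_subLR addnC -{1}(size_iota 0 L).
  rewrite -(count_predC (fun a => q.[X ^+ a] != 0)) -size_filter leq_add2l.
  have us : uniq [seq X ^+ a | a <- iota 0 L & q.[X ^+ a] == 0].
    by rewrite map_inj_uniq ?filter_uniq ?iota_uniq //; exact: Xinj.
  have as_ : all (root q) [seq X ^+ a | a <- iota 0 L & q.[X ^+ a] == 0].
    by apply/allP => x /mapP [a]; rewrite mem_filter => /andP[r _] ->.
  have := max_poly_roots q0 as_ us; rewrite size_map size_filter.
  under eq_count do rewrite -[_ == 0]negbK.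
  by case: (size q).
pose rs := [seq gpt a b | a <- As, b <- iota 0 B].
have us : uniq rs.
  apply: allpairs_uniq; rewrite ?filter_uniq ?iota_uniq //.
  by move=> [a b] [a' b'] _ _ /= /gpt_inj [-> ->].
have ar : all (root p) rs.
  apply/allP => x /allpairsP [[a b] /= [ha hb ->]].
  move: ha hb; rewrite mem_filter !mem_iota /= !add0n => /andP[h1 h2] h3.
  by apply/eqP/(mulIf h1); rewrite mul0r hz.
have := max_poly_roots p0 ar us; rewrite size_allpairs size_iota ltnNge.
by rewrite (leq_trans hs) // leq_mul2r sAs orbT.
Qed.

(** The polynomial is the Casorati determinant of [p] and [q], the analogue of a Wronskian for the
    shift by [im]. *)
Lemma size_casorati (p q : {poly F}) S : (size p <= S)%N -> (size q <= S)%N ->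
  (size (p * pshift q - pshift p * q)%R <= S + S)%N.
Proof.
move=> hp hq; rewrite (leq_trans (size_polyD _ _)) // size_polyN geq_max.
by apply/andP; split; rewrite (leq_trans (size_polyMleq _ _)) //
   (leq_trans (leq_pred _)) // leq_add // size_pshift.
Qed.

(** Combining the relations at [b] and [b + 1] makes the Casorati determinant vanish on the grid,
    hence identically, at the cost of one row. Then [q = c p], and [p * (1 + c Y)] vanishes at
    [Y = X ^+ a]; the linear factor costs one column. *)
Lemma two_term (p q : {poly F}) (S L B : nat) :
  (size p <= S)%N -> (size q <= S)%N ->
  (forall a b, (a < L)%N -> (b < B.+1)%N -> p.[gpt a b] + q.[gpt a b] * X ^+ a = 0) ->
  X != 0 ->
  (S + S <= L.-1 * B)%N -> p = 0 /\ q = 0.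
Proof.
move=> sp sq hz X0 hS.
have hL : (L.-1 * B <= L * B)%N by rewrite leq_mul2r leq_pred orbT.
have hB : (L.-1 * B <= L.-1 * B.+1)%N by rewrite leq_mul2l leqnSn orbT.
have hB' : (L.-1 * B.+1 <= L * B.+1)%N by rewrite leq_mul2r leq_pred orbT.
have hSS : (S <= S + S)%N by rewrite leq_addr.
have W0 : p * pshift q = pshift p * q.
  apply/eqP; rewrite -subr_eq0; apply/eqP.
  apply: (@grid_zero _ 1 L B (oner_neq0 _)).
    move=> a b ha hb; rewrite !(hornerE, horner_pshift).
    have h1 := hz a b ha (ltnW hb); have h2 := hz a b.+1 ha hb.
    have -> : p.[gpt a b] = - (q.[gpt a b] * X ^+ a) by apply/eqP; rewrite -addr_eq0 h1.
    have -> : p.[gpt a b.+1] = - (q.[gpt a b.+1] * X ^+ a) by apply/eqP; rewrite -addr_eq0 h2.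
    by ring.
  rewrite size_poly1 subn0 (leq_trans (size_casorati sp sq)) //.
  exact: leq_trans hL.
have [p0|p0] := eqVneq p 0.
  split=> //; apply: (@grid_zero _ 1 L B.+1 (oner_neq0 _)).
    move=> a b ha hb; have := hz a b ha hb.
    rewrite p0 !hornerE => /eqP; rewrite mulf_eq0 expf_eq0 (negPf X0) andbF orbF.
    by move/eqP => ->.
  rewrite size_poly1 subn0 (leq_trans sq) // (leq_trans hSS) // (leq_trans hS) //.
  exact: leq_trans hB _.
have [c ec] := pshift_proportional p0 W0.
suff p00 : p = 0 by rewrite p00 eqxx in p0.
apply: (@grid_zero _ (1 + c *: 'X) L B.+1).
- apply/negP => /eqP /(congr1 (fun r : {poly F} => r.[0])).
  by rewrite !hornerE /=; apply/eqP; rewrite ?mulr0 ?addr0 oner_neq0.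
- move=> a b ha hb; have := hz a b ha hb; rewrite ec !hornerE => e.
  by rewrite -[RHS]e; ring.
- have s2 : (size (1 + c *: 'X : {poly F})%R <= 2)%N.
    rewrite (leq_trans (size_polyD _ _)) // geq_max size_poly1 /=.
    by rewrite (leq_trans (size_scale_leq _ _)) // size_polyX.
  rewrite (leq_trans sp) // (leq_trans hSS) // (leq_trans hS) // (leq_trans hB) //.
  rewrite leq_mul2r -subn1 leq_sub2l ?orbT //.
  by case: (size _) s2.
Qed.

(** Eliminating [p0] between [b] and [b + 1] leaves a two-term relation between Casorati
    determinants, whose sizes have doubled; the second elimination doubles again, hence [4 * S]. If
    both determinants vanish, [p1] and [p2] are multiples of [p0], and a quadratic factor in
    [X ^+ a] costs two columns. *)
Lemma three_term (p0 p1 p2 : {poly F}) (S L B : nat) :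
  (size p0 <= S)%N -> (size p1 <= S)%N -> (size p2 <= S)%N ->
  (forall a b, (a < L)%N -> (b < B.+2)%N ->
     p0.[gpt a b] + p1.[gpt a b] * X ^+ a + p2.[gpt a b] * X ^+ a ^+ 2 = 0) ->
  X != 0 ->
  (4 * S <= (L - 2) * B)%N -> [/\ p0 = 0, p1 = 0 & p2 = 0].
Proof.
move=> s0 s1 s2 hz X0 hS.
have hL : ((L - 2) * B <= L.-1 * B)%N by rewrite leq_mul2r -subn1 leq_sub2l ?orbT.
have hB : ((L - 2) * B <= (L - 2) * B.+2)%N by rewrite leq_mul2l (leqW (leqnSn B)) orbT.
have hB1 : (L.-1 * B <= L.-1 * B.+1)%N by rewrite leq_mul2l leqnSn orbT.
have h4 : (4 * S = (S + S) + (S + S))%N by rewrite !mulSn mul0n addn0 !addnA.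
have h2 : (S + S <= 4 * S)%N by rewrite h4 leq_addr.
have h1 : (S <= 4 * S)%N by rewrite (leq_trans _ h2) ?leq_addr.
have Xa a : X ^+ a != 0 by rewrite expf_eq0 (negPf X0) andbF.
have [p00|p00] := eqVneq p0 0.
  have hz' a b : (a < L)%N -> (b < B.+2)%N -> p1.[gpt a b] + p2.[gpt a b] * X ^+ a = 0.
    move=> ha hb; apply: (mulfI (Xa a)); rewrite mulr0 -[RHS](hz a b ha hb).
    by rewrite p00 horner0; ring.
  have hS' : (S + S <= L.-1 * B.+1)%N.
    by rewrite (leq_trans h2) // (leq_trans hS) // (leq_trans hL).
  by have [-> ->] := two_term s1 s2 hz' X0 hS'.
pose c1 := p0 * pshift p1 - pshift p0 * p1.
pose c2 := p0 * pshift p2 - pshift p0 * p2.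
have hc a b : (a < L)%N -> (b < B.+1)%N -> c1.[gpt a b] + c2.[gpt a b] * X ^+ a = 0.
  move=> ha hb; apply: (mulfI (Xa a)); rewrite mulr0.
  have e1 := hz a b ha (ltnW hb); have e2 := hz a b.+1 ha hb.
  rewrite /c1 /c2 !(hornerE, horner_pshift).
  rewrite -[RHS](subrr 0) -{1}(mulr0 p0.[gpt a b]) -{1}e2.
  by rewrite -[X in _ = _ - X](mulr0 p0.[gpt a b.+1]) -{1}e1; ring.
have hS' : ((S + S) + (S + S) <= L.-1 * B)%N by rewrite -h4 (leq_trans hS).
have [] := two_term (size_casorati s0 s1) (size_casorati s0 s2) hc X0 hS'.
move=> /eqP; rewrite subr_eq0 => /eqP /(pshift_proportional p00) [d1 ed1].
move=> /eqP; rewrite subr_eq0 => /eqP /(pshift_proportional p00) [d2 ed2].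
suff e : p0 = 0 by rewrite e eqxx in p00.
apply: (@grid_zero _ (1 + d1 *: 'X + d2 *: 'X^2) L B.+2).
- apply/negP => /eqP /(congr1 (fun r : {poly F} => r.[0])).
  by rewrite !hornerE /= ?expr0n /= ?mulr0 ?addr0; apply/eqP; rewrite oner_neq0.
- move=> a b ha hb; rewrite -[RHS](hz a b ha hb) ed1 ed2 !hornerD !hornerZ hornerX hornerXn hornerC.
  by ring.
- have s3 : (size (1 + d1 *: 'X + d2 *: 'X^2 : {poly F})%R <= 3)%N.
    rewrite (leq_trans (size_polyD _ _)) // geq_max; apply/andP; split.
      rewrite (leq_trans (size_polyD _ _)) // geq_max size_poly1 /=.
      by rewrite (leq_trans (size_scale_leq _ _)) // size_polyX.
    by rewrite (leq_trans (size_scale_leq _ _)) // size_polyXn.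
  rewrite (leq_trans s0) // (leq_trans h1) // (leq_trans hS) // (leq_trans hB) //.
  rewrite leq_mul2r leq_sub2l ?orbT //.
  by case: (size _) s3 => [|[|[|[|]]]].
Qed.
End Grid.
End ZeroEstimate.

(** * Upper bounds for determinants *)

Lemma prod_perturb (F : numDomainType) (I : Type) (a b : I -> F) (c d : F) (s : seq I) :
  1 <= c -> (forall i, `|a i| <= c) -> (forall i, `|b i| <= c) ->
  (forall i, `|a i - b i| <= d) ->
  `|\prod_(i <- s) a i - \prod_(i <- s) b i| <= (size s)%:R * c ^+ size s * d.
Proof.
move=> c1 ha hb hd; have c0 : 0 <= c := le_trans ler01 c1.
elim: s => [|x s IH].
  by rewrite !big_nil subrr normr0 !mul0r.
have d0 : 0 <= d := le_trans (normr_ge0 _) (hd x).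
have hp : `|\prod_(i <- s) a i| <= c ^+ size s.
  rewrite normr_prod; elim: (s) => [|y t IHt]; first by rewrite big_nil.
  by rewrite big_cons exprS ler_pM // prodr_ge0.
rewrite !big_cons /=.
have -> : a x * \prod_(i <- s) a i - b x * \prod_(i <- s) b i =
  (a x - b x) * \prod_(i <- s) a i + b x * (\prod_(i <- s) a i - \prod_(i <- s) b i) by ring.
apply: le_trans (ler_normD _ _) _; rewrite !normrM.
have -> : (size s).+1%:R * c ^+ (size s).+1 * d =
  d * c ^+ (size s).+1 + c * ((size s)%:R * c ^+ size s * d) by rewrite -natr1 exprS; ring.
apply: lerD; last by rewrite ler_pM.
rewrite ler_pM // (le_trans hp) // exprS ler_peMl // exprn_ge0 //.
Qed.

Lemma det_perturb (F : numDomainType) n (A B : 'M[F]_n) (c d : F) :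
  1 <= c -> (forall i j, `|A i j| <= c) -> (forall i j, `|B i j| <= c) ->
  (forall i j, `|A i j - B i j| <= d) ->
  `|\det A - \det B| <= n`!%:R * (n%:R * c ^+ n * d).
Proof.
move=> c1 hA hB hd; rewrite /determinant -sumrB.
apply: le_trans (ler_norm_sum _ _ _) _.
rewrite mulr_natl -card_Sn -sumr_const; apply: ler_sum => s _.
rewrite -mulrBr normrM normrX normrN1 expr1n mul1r.
have := @prod_perturb F 'I_n (fun i => A i (s i)) (fun i => B i (s i)) c d (enum 'I_n).
by rewrite size_enum_ord !big_enum /=; apply.
Qed.

(** The maximum of [n] distinct naturals is at least [n - 1]; remove it and recurse. *)
Lemma sumn_uniq (s : seq nat) : uniq s -> ('C(size s, 2) <= sumn s)%N.
Proof.
have [k] := ubnP (size s); elim: k s => // k IH s hs us.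
case: (posnP (size s)) => [->//|s0].
pose m := \max_(x <- s) x.
have ms : m \in s.
  have s1 : (\sum_(x <- s) x <= sumn s)%N by rewrite sumnE.
  rewrite /m; case: (s) s0 => // x t _.
  elim: t x => [|y t IHt] x; first by rewrite big_seq1 mem_head.
  rewrite big_cons; case: (leqP x (\max_(z <- y :: t) z)) => h.
    by rewrite in_cons IHt orbT.
  by rewrite mem_head.
have le_m x : x \in s -> (x <= m)%N by move=> xs; exact: leq_bigmax_seq.
have h1 : ((size s).-1 <= m)%N.
  rewrite -ltnS prednK // -(size_iota 0 m.+1); apply: uniq_leq_size => // x /le_m.
  by rewrite mem_iota /= add0n ltnS.
have := perm_to_rem ms => pe.
have -> : sumn s = (m + sumn (rem m s))%N by rewrite (perm_sumn pe).
have := IH (rem m s); rewrite size_rem // => /(_ _ (rem_uniq _ us)) IH'.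
have := IH' _; rewrite -(prednK s0) binS bin1 /= addnC => h.
by rewrite leq_add // h // prednK.
Qed.

(* Expanding over all exponent maps, only those with distinct exponents survive, and
   these have exponent sum at least ['C(n, 2)]; weighting by [E] (Rankin's trick) does the rest. *)
Lemma det_rankin (F : numFieldType) n T (w : 'I_n -> 'I_T -> F) (lam : 'I_n -> F) (La E : F) :
  1 <= E -> (forall j, `|lam j| <= La) ->
  `|\det (\matrix_(i, j) \sum_(m < T) w i m * lam j ^+ m)| * E ^+ 'C(n, 2) <=
  n`!%:R * \prod_i \sum_(m < T) `|w i m| * (E * La) ^+ m.
Proof.
move=> E1 hl; have E0 : 0 <= E := le_trans ler01 E1.
have -> : \det (\matrix_(i, j) \sum_(m < T) w i m * lam j ^+ m) =
  \sum_(f : {ffun 'I_n -> 'I_T}) (\prod_i w i (f i)) * \det (\matrix_(i, j) lam j ^+ f i).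
  rewrite /determinant; under [RHS]eq_bigr do rewrite mulr_sumr.
  rewrite exchange_big /=; apply: eq_bigr => s _.
  under eq_bigr do rewrite mxE.
  rewrite bigA_distr_bigA mulr_sumr; apply: eq_bigr => f _.
  rewrite big_split /= [RHS]mulrCA; congr (_ * (_ * _)).
  by apply: eq_bigr => i _; rewrite mxE.
apply: (le_trans (ler_wpM2r (exprn_ge0 _ E0) (ler_norm_sum _ _ _))).
rewrite bigA_distr_bigA /= mulr_suml mulr_sumr; apply: ler_sum => f _.
rewrite normrM.
have [/injectiveP finj|/injectivePn [i [i' ii' ef]]] := boolP (injectiveb f); last first.
  rewrite (determinant_alternate ii') ?normr0 ?mulr0 ?mul0r.
    rewrite mulr_ge0 ?ler0n // prodr_ge0 // => k _.
    rewrite mulr_ge0 // exprn_ge0 // mulr_ge0 //.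
    by apply: le_trans (hl k); exact: normr_ge0.
  by move=> j; rewrite !mxE ef.
have cs : ('C(n, 2) <= \sum_i f i)%N.
  have := @sumn_uniq [seq (f i : nat) | i <- enum 'I_n].
  rewrite size_map size_enum_ord map_inj_uniq; last by move=> x y /val_inj /finj.
  by rewrite enum_uniq sumnE big_map big_enum /= => /(_ isT).
rewrite big_split /= normr_prod -mulrA [leRHS]mulrCA ler_wpM2l ?prodr_ge0 //.
have -> : \prod_i (E * La) ^+ f i = E ^+ (\sum_i f i) * \prod_(i < n) La ^+ f i.
  rewrite -prodrXr -big_split /=; apply: eq_bigr => i _; exact: exprMn.
rewrite [leRHS]mulrCA mulrC.
have La0 (i : 'I_n) : 0 <= La by apply: le_trans (hl i); exact: normr_ge0.
apply: ler_pM; rewrite ?exprn_ge0 //; first by rewrite ler_weXn2l.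
apply: le_trans (ler_norm_sum _ _ _) _.
rewrite mulr_natl -card_Sn -sumr_const; apply: ler_sum => s _.
rewrite normrM normrX normrN1 expr1n mul1r normr_prod.
apply: ler_prod => i _; rewrite normr_ge0 mxE normrX.
by rewrite lerXn2r // nnegrE ?(La0 i).
Qed.

(** * Gaussian integers and the arithmetic lower bound *)

Section Gauss.
Variable F : numClosedFieldType.
Definition gaussint (z : F) : Prop := exists a b : int, z = a%:~R + 'i * b%:~R.

Lemma gaussint_int (a : int) : gaussint a%:~R.
Proof. by exists a, 0; rewrite mulr0 addr0. Qed.
Lemma gaussint_add x y : gaussint x -> gaussint y -> gaussint (x + y).
Proof. by case=> a [b ->] [c [d ->]]; exists (a + c), (b + d); rewrite !intrD; ring. Qed.
Lemma gaussint_mul x y : gaussint x -> gaussint y -> gaussint (x * y).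
Proof.
case=> a [b ->] [c [d ->]]; exists (a * c - b * d), (a * d + b * c).
rewrite !(intrB, intrD, intrM).
have -> : (a%:~R + 'i * b%:~R) * (c%:~R + 'i * d%:~R) =
  a%:~R * c%:~R + ('i ^+ 2 : F) * b%:~R * d%:~R + 'i * (a%:~R * d%:~R + b%:~R * c%:~R) by ring.
by rewrite sqrCi; ring.
Qed.
Lemma gaussint_nat (n : nat) : gaussint n%:R.
Proof. by rewrite -[n%:R]/((n : int)%:~R); exact: gaussint_int. Qed.
Lemma gaussint_X x n : gaussint x -> gaussint (x ^+ n).
Proof.
move=> h; elim: n => [|n IH]; first by rewrite expr0 -[1]/(1%:R); exact: gaussint_nat.
by rewrite exprS; exact: gaussint_mul.
Qed.
Lemma gaussint_det n (A : 'M[F]_n) : (forall i j, gaussint (A i j)) -> gaussint (\det A).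
Proof.
move=> h; rewrite /determinant.
apply: (big_ind gaussint); [exact: (gaussint_nat 0)|exact: gaussint_add|move=> s _].
apply: gaussint_mul; first by apply: gaussint_X; exact: (gaussint_int (-1)).
by apply: (big_ind gaussint); [exact: (gaussint_nat 1)|exact: gaussint_mul|].
Qed.
Lemma gaussint_norm z : gaussint z -> z != 0 -> 1 <= `|z|.
Proof.
case=> a [b ->] nz; have := @normC2_rect F a%:~R b%:~R; rewrite !realz => /(_ isT isT) e.
have e' : `|a%:~R + 'i * b%:~R| ^+ 2 = (a ^+ 2 + b ^+ 2)%:~R :> F by rewrite e intrD !rmorphXn.
rewrite -(@ler_pXn2r _ 2) ?nnegrE ?ler01 // expr1n e' ler1z.
rewrite -gtz0_ge1 lt_neqAle addr_ge0 ?sqr_ge0 // andbT eq_sym.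
apply: contra_neq nz => h; apply/eqP; rewrite -normr_eq0 -[_ == 0](@expf_eq0 _ _ 2).
by rewrite e' h.
Qed.

(** Liouville's argument: clearing denominators turns the determinant into a nonzero Gaussian
    integer, whose norm is a positive integer. *)
Lemma det_lower n (A : 'M[F]_n) (D : nat) :
  (0 < D)%N -> (forall i j, gaussint (D%:R * A i j)) -> \det A != 0 -> 1 <= D%:R ^+ n * `|\det A|.
Proof.
move=> D0 h d0.
have e : \det (D%:R *: A) = D%:R ^+ n * \det A by rewrite detZ.
have -> : D%:R ^+ n * `|\det A| = `|\det (D%:R *: A)|.
  by rewrite e normrM normrX normr_nat.
apply: gaussint_norm; first by apply: gaussint_det => i j; rewrite mxE; exact: h.
by rewrite e mulf_neq0 // expf_neq0 // pnatr_eq0 -lt0n.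
Qed.
End Gauss.

(** * The interpolation matrix and its Taylor coefficients *)

Section Matrix.
Variable F : numClosedFieldType.
Variables (S L : nat).

(* A column index [c < L * L] encodes the node [a + i b], a row index [i < 3 * S] the pair [(j, s)]. *)
Definition lam (c : nat) : F := gpt 'i (c %/ L) (c %% L).

(** For [X = exp (2 PI k)] this is the derivative of order [i %% S] of [exp (lam c * z)] at
    [z = 2 PI k (i %/ S)]: the imaginary part of the node contributes a factor 1. The arithmetic
    side takes [X = p / q] instead, which is why [X] is a parameter. *)
Definition entry (X : F) (c i : nat) : F := lam c ^+ (i %% S) * X ^+ (c %/ L * (i %/ S)).

(** A linear relation [v] between the rows is a relation [P 0 + P 1 * X ^+ a + P 2 * X ^+ (2 * a) =
    0] at all [L * L] nodes, where [P j] has the coefficients of [v] in the block [j]. [three_term]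
    with [B = L - 2] forces [v = 0], so the rows are free and some choice of columns is
    invertible. *)
Lemma exists_minor (X : F) : (0 < S)%N -> (4 * S <= (L - 2) * (L - 2))%N -> X != 0 ->
  (forall a b : nat, X ^+ a = X ^+ b -> a = b) ->
  exists f : 'I_(3 * S) -> 'I_(L * L),
    \det (\matrix_(i, k) entry X (f k) i) != 0.
Proof.
move=> S0 hS X0 Xinj.
have L2 : (2 < L)%N.
  by rewrite ltnNge; apply/negP => h; move: hS; rewrite (eqP h) muln0 leqn0 muln_eq0 /= -[S ==
      _]negbK -lt0n S0.
have L0 : (0 < L)%N by exact: ltn_trans L2.
pose A := \matrix_(i < 3 * S, c < L * L) entry X c i.
have rfA : row_free A.
  apply: inj_row_free => v vA.
  pose v' k := oapp (v 0) 0 (insub k).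
  pose P j : {poly F} := \poly_(s < S) v' (j * S + s)%N.
  have sP j : (size (P j) <= S)%N by exact: size_poly.
  have hz a b : (a < L)%N -> (b < (L - 2).+2)%N -> (P 0%N).[gpt 'i a b] +
      (P 1%N).[gpt 'i a b] * X ^+ a + (P 2%N).[gpt 'i a b] * X ^+ a ^+ 2 = 0.
    move=> ha hb; have hb' : (b < L)%N by move: hb; rewrite -addn2 subnK ?(ltnW L2).
    have hc : (a * L + b < L * L)%N.
      by rewrite (@leq_trans (a.+1 * L)) ?leq_mul2r ?ha ?orbT // mulSn addnC ltn_add2r.
    have := congr1 (fun B : 'rV_(L * L) => B 0 (Ordinal hc)) vA; rewrite !mxE => e.
    rewrite -[RHS]e.
    pose g i := v' i * entry X (a * L + b) i.
    have -> : \sum_j v 0 j * A j (Ordinal hc) = \sum_(0 <= i < 3 * S) g i.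
      rewrite big_mkord; apply: eq_bigr => i _; rewrite mxE /g /v' /=.
      by rewrite valK.
    rewrite big_nat_mul [RHS]big_mkord !big_ord_recl big_ord0 Monoid.mulm1 Monoid.mulmA /= /bump /=.
    have key j : (P j).[gpt 'i a b] * X ^+ (a * j) = \sum_(j * S <= i < j.+1 * S) g i.
      rewrite horner_poly mulr_suml -{1}[(j * S)%N]add0n (big_addn 0).
      rewrite mulSn addnK big_mkord; apply: eq_bigr => s _.
      rewrite /g /entry /lam [(s + j * S)%N]addnC !divnMDl // [(s %/ S)%N]divn_small // addn0
          !modnMDl [(s %% S)%N]modn_small //.
      rewrite (divn_small hb') addn0 (modn_small hb').
      by rewrite mulrA.
    by rewrite -!key muln0 muln1 expr0 mulr1 exprM !addn0 addrA -[(1 + 1)%N]/2%N ?expr2 ?mulrA.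
  have [P0 P1 P2] := three_term (sqrCi F) Xinj (sP _) (sP _) (sP _) hz X0 hS.
  apply/rowP => k; rewrite mxE.
  have vk : v 0 k = v' k by rewrite /v' valK.
  have Pc j s : (s < S)%N -> P j = 0 -> v' (j * S + s)%N = 0.
    move=> hs Pj; have := congr1 (fun r : {poly F} => r`_s) Pj.
    by rewrite coef_poly hs coef0.
  rewrite vk (divn_eq k S); have hj : (k %/ S < 3)%N by rewrite ltn_divLR.
  have hs : (k %% S < S)%N by rewrite ltn_mod.
  by case: (k %/ S)%N hj => [|[|[|]]] // _; apply: Pc.
have rfull : row_full A^T by rewrite /row_full mxrank_tr.
exists (fullrankfun rfull).
have := fullrowsub_unit rfull; rewrite unitmxE unitfE -det_tr.
by congr (\det _ != 0); apply/matrixP => i k; rewrite !mxE.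
Qed.

Lemma gaussint_lam c : gaussint (lam c).
Proof. by exists (c %/ L)%:Z, (c %% L)%:Z. Qed.

(** The exponent of [X] is [a * j] with [a < L] and [j <= 2], so [q ^ (2 * L)] clears the
    denominator of every entry. *)
Lemma minor_lower (p q n : nat) (f : 'I_(3 * S) -> 'I_(L * L)) :
  (0 < S)%N -> (0 < q)%N ->
  \det (\matrix_(i, k) entry (p%:R / q%:R) (f k) i) != 0 ->
  1 <= (q ^ (2 * L))%:R ^+ (3 * S) * `|\det (\matrix_(i, k) entry (p%:R / q%:R) (f k) i)|.
Proof.
move=> S0 q0 d0; apply: det_lower => //; first by rewrite expn_gt0 q0.
move=> i j; rewrite mxE /entry.
set e := (_ %/ L * _)%N.
have he : (e <= 2 * L)%N.
  rewrite /e mulnC leq_mul //; first by rewrite -ltnS ltn_divLR // ltn_ord.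
  rewrite ltnW // ltn_divLR // ?ltn_ord //.
  by case: (L) (f j) => [[]|].
rewrite mulrCA; apply: gaussint_mul; first by apply: gaussint_X; exact: gaussint_lam.
rewrite natrX -(subnK he) exprD -mulrA -exprMn mulrCA divff ?mulr1 ?pnatr_eq0 -?lt0n //.
by rewrite -!natrX -natrM; exact: gaussint_nat.
Qed.

(* Taylor coefficient in [z ^ m] of row [i], i.e. of [z ^ s exp (x j z)] with [s = i %% S], [j = i
    %/ S]. *)
Definition tcoef (x : F) (i m : nat) : F :=
  if (i %% S <= m)%N then (x *+ (i %/ S)) ^+ (m - i %% S) / (m - i %% S)`!%:R else 0.

(** The coefficients are nonnegative, so the left side is the truncated series of
    [z ^ s exp (x j z)] at [z = E]. The first [s] coefficients vanish, and lengthening the inner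
    range to [T] adds nonnegative terms. *)
Lemma tcoef_sum (x E : F) T i : 0 <= E -> 0 <= x ->
  \sum_(m < T) `|tcoef x i m| * E ^+ m <=
  E ^+ (i %% S) * \sum_(m < T) (E * x *+ (i %/ S)) ^+ m / m`!%:R.
Proof.
move=> E0 x0; rewrite -(big_mkord xpredT (fun m => `|tcoef x i m| * E ^+ m)).
have y0 : 0 <= E * x *+ (i %/ S) by rewrite mulrn_wge0 // mulr_ge0.
set s := (i %% S)%N; case: (leqP T s) => h.
  rewrite big1_seq.
    by rewrite mulr_ge0 ?exprn_ge0 // sumr_ge0 // => m _; rewrite divr_ge0 // exprn_ge0.
  move=> m /=; rewrite mem_index_iota /= => hm.
  by rewrite /tcoef leqNgt (leq_trans hm h) normr0 mul0r.
rewrite (@big_cat_nat _ _ _ s) //=; last exact: ltnW.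
rewrite big1_seq ?add0r; last first.
  move=> m /=; rewrite mem_index_iota /= => hm.
  by rewrite /tcoef leqNgt hm normr0 mul0r.
rewrite -{1}[s]add0n big_addn mulr_sumr.
rewrite -(big_mkord xpredT (fun m => E ^+ s * ((E * x *+ (i %/ S)) ^+ m / m`!%:R))).
rewrite [leRHS](@big_cat_nat _ _ _ (T - s)) ?leq_subr //=.
rewrite -[leLHS]addr0; apply: lerD.
  apply: ler_sum => m _; rewrite /tcoef leq_addl addnK.
  rewrite ger0_norm ?divr_ge0 ?exprn_ge0 ?mulrn_wge0 //.
  rewrite exprD -mulrnAr exprMn le_eqVlt; apply/orP; left; apply/eqP; ring.
by apply: sumr_ge0 => m _; rewrite mulr_ge0 ?exprn_ge0 // divr_ge0 // exprn_ge0.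
Qed.

End Matrix.

Lemma cpow_gpt (a b n : nat) :
  (gpt 'i a b : R[i]) ^+ n =
  (cpow a%:R b%:R 1 0 n).1 +i* (cpow a%:R b%:R 1 0 n).2.
Proof.
elim: n => [|n IH]; first by rewrite expr0.
rewrite exprS IH /= /gpt -complexiE.
rewrite -![_%:R : R[i]](rmorph_nat (real_complex R)) /=.
set z := cpow _ _ _ _ _; apply/eqP; rewrite eq_complex /=.
rewrite !(RplusE, RminusE, RmultE); apply/andP; split; apply/eqP; ring.
Qed.

(** Multiplication by [- i] moves the imaginary part to the first coordinate, the only one that
    [expcos_taylor] speaks about. *)
Lemma cpow_im (a b : R) n :
  cpow a b 0 (-1) n = ((cpow a b 1 0 n).2, - (cpow a b 1 0 n).1).
Proof.
elim: n => [|n IH] /=; first by [].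
rewrite IH /= !(RplusE, RminusE, RmultE); congr (_, _); ring.
Qed.

Lemma norm_real_complex (r : R) : `|r%:C| = `|r|%:C :> R[i].
Proof. by rewrite normc_def /= expr0n /= addr0 sqrtr_sqr. Qed.

Lemma norm_le_ReIm (u v : R) : `|(u +i* v : R[i])| <= (`|u| + `|v|)%:C.
Proof.
rewrite [u +i* v]complexE /= (le_trans (ler_normD _ _)) // normrM !norm_real_complex.
by rewrite normc_def /= expr0n /= add0r expr1n sqrtr1 mul1r rmorphD.
Qed.

Lemma exp_mulrn (x : R) n : Rtrigo_def.exp x ^+ n = Rtrigo_def.exp (x *+ n).
Proof.
elim: n => [|n IH]; first by rewrite mulr0n Rtrigo_def.exp_0.
by rewrite exprS mulrS IH -RplusE Exp_prop.exp_plus.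
Qed.

Lemma cos_sin_2npi (n : nat) :
  Rtrigo_def.cos (2 * Rtrigo1.PI * n%:R) = 1 /\ Rtrigo_def.sin (2 * Rtrigo1.PI * n%:R) = 0.
Proof.
have e : 2 * Rtrigo1.PI * n%:R = (0 + 2 * Raxioms.INR n * Rtrigo1.PI)%R.
  by rewrite !RealsE add0r mulrAC.
by rewrite e Rtrigo1.cos_period Rtrigo1.sin_period Rtrigo_def.cos_0 Rtrigo_def.sin_0.
Qed.

Lemma sumC_split (T : nat) (z : nat -> R[i]) (y : R) :
  \sum_(m < T) z m * ((y%:C) ^+ m / m`!%:R) =
  (\sum_(0 <= m < T) y ^+ m / m`!%:R * complex.Re (z m)) +i* (\sum_(0 <= m < T) y ^+ m / m`!%:R *
      complex.Im (z m)).
Proof.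
rewrite !big_mkord; elim: T => [|T IH]; first by rewrite !big_ord0.
rewrite !big_ord_recr /= IH; case: (z T) => u v /=.
rewrite -[_%:R : R[i]](rmorph_nat (real_complex R)) -rmorphXn -fmorphV -rmorphM /=.
by apply/eqP; rewrite eq_complex /=; apply/andP; split; apply/eqP; ring.
Qed.

(** The exponent [(a + i b) * 2 PI k j] has imaginary part [2 PI (k j b)], a multiple of [2 PI]; the
    limit is therefore the real number [exp (2 PI k) ^ (a j)]. *)
Lemma taylor_conv (a b j k : nat) (e : R) : 0 < e ->
  exists T0 : nat, forall T, (T0 <= T)%N ->
  `|\sum_(m < T) (gpt 'i a b) ^+ m *
      (((2 * Rtrigo1.PI * k%:R)%:C *+ j) ^+ m / m`!%:R)
    - ((Rtrigo_def.exp (2 * Rtrigo1.PI * k%:R) ^+ (a * j))%:C : R[i])| <= e%:C.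
Proof.
move=> e0; set x := (2 * _ * _); rewrite -rmorphMn /=; set y := x *+ j.
have ey : Rtrigo_def.exp x ^+ (a * j) = Rtrigo_def.exp (a%:R * y).
  by rewrite exp_mulrn /y mulr_natl -mulrnA mulnC.
have x0 : 0 <= x.
  by rewrite /x mulr_ge0 // mulr_ge0 //; apply/RleP; left; exact: Rtrigo1.PI_RGT_0.
have y0 : 0 <= y by rewrite /y mulrn_wge0.
have [cb sb] := cos_sin_2npi (k * j * b).
have eb : 2 * Rtrigo1.PI * (k * j * b)%:R = b%:R * y.
  by rewrite /y /x !natrM -mulr_natr; ring.
rewrite eb in cb sb.
have split T := @sumC_split T (fun m => gpt 'i a b ^+ m) y.
rewrite ey.
(* [expcos_taylor] requires [y > 0]; the point [y = 0] does occur, for [j = 0]. *)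
have [y00|ny0] := eqVneq y 0.
  exists 1%N => -[//|T] _.
  rewrite y00 mulr0 Rtrigo_def.exp_0 big_ord_recl /= !expr0 divr1 mulr1 big1.
    by rewrite addr0 subrr normr0 lecR ltW.
  by move=> m _; rewrite /= rmorph0 expr0n /= mul0r mulr0.
have yp : Rdefinitions.Rlt 0 y by apply/RltP; rewrite lt_neqAle eq_sym ny0.
have e2 : Rdefinitions.Rgt (e / 2) 0 by apply/RltP; rewrite divr_gt0.
have [n1 H1] := (Lim_seq.is_lim_seq_Reals _ _).1 (expcos_taylor a%:R b%:R 1 0 y yp) _ e2.
have [n2 H2] := (Lim_seq.is_lim_seq_Reals _ _).1 (expcos_taylor a%:R b%:R 0 (-1) y yp) _ e2.
exists (maxn n1 n2).+1 => -[//|T]; rewrite ltnS geq_max => /andP[/ssrnat.leP h1 /ssrnat.leP h2].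
move: {H1 H2}(H1 T h1) (H2 T h2); rewrite !RdistE !sum_f_R0E => /RltP H1 /RltP H2.
rewrite split; move: H1 H2; rewrite /expcos !RealsE cb sb.
under eq_bigr do rewrite !RealsE.
under [X in _ -> `|X - _| < _ -> _]eq_bigr do rewrite !RealsE cpow_im.
rewrite !(mulr0, mul0r, subr0, mulr1) /=.
under [X in X +i* _]eq_bigr do rewrite cpow_gpt /=.
under [X in _ +i* X]eq_bigr do rewrite cpow_gpt /=.
set u := \sum_(0 <= i < T.+1) _; set v := \sum_(0 <= i < T.+1) _ => H1 H2.
have -> : (u +i* v : R[i]) - (Rtrigo_def.exp (a%:R * y))%:C = (u - Rtrigo_def.exp (a%:R * y)) +i* v.
  by apply/eqP; rewrite eq_complex /= subr0 !eqxx.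
by rewrite (le_trans (norm_le_ReIm _ _)) // lecR [leRHS](splitr e) ltW // ltrD.
Qed.

Lemma exp_partial_sum (y : R) T : 0 <= y ->
  \sum_(m < T) y ^+ m / m`!%:R <= Rtrigo_def.exp y.
Proof.
move=> y0; have [->|ny0] := eqVneq y 0.
  case: T => [|T]; rewrite ?big_ord0 Rtrigo_def.exp_0 ?ler01 //.
  rewrite big_ord_recl /= expr0 divr1 big1 ?addr0 // => m _.
  by rewrite expr0n /= mul0r.
have yp : Rdefinitions.Rlt 0 y by apply/RltP; rewrite lt_neqAle eq_sym ny0.
have H := expcos_taylor 1 0 1 0 y yp.
have c1 m : (cpow 1 0 1 0 m) = (1, 0).
  elim: m => //= m ->; rewrite /= !RealsE; congr (_, _); ring.
have inc n : Rdefinitions.Rle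
   (Rfunctions.sum_f_R0 (fun m => Rdefinitions.RbaseSymbolsImpl.Rmult (Rdefinitions.Rdiv
       (Rpow_def.pow y m) (Raxioms.INR (Factorial.fact m))) (fst (cpow 1 0 1 0 m))) n)
   (Rfunctions.sum_f_R0 (fun m => Rdefinitions.RbaseSymbolsImpl.Rmult (Rdefinitions.Rdiv
       (Rpow_def.pow y m) (Raxioms.INR (Factorial.fact m))) (fst (cpow 1 0 1 0 m))) n.+1).
  apply/RleP; rewrite !sum_f_R0E [leRHS]big_nat_recr // lerDl c1 !RealsE mulr1.
  by rewrite divr_ge0 ?exprn_ge0.
have := Lim_seq.is_lim_seq_incr_compare _ _ H inc T => /RleP.
rewrite sum_f_R0E /expcos !RealsE mul0r Rtrigo_def.cos_0 !mul1r mul0r subr0 mulr1.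
apply: le_trans; rewrite big_nat_recr // big_mkord c1.
rewrite -[leLHS]addr0 lerD //; last by rewrite !RealsE mulr1 divr_ge0 ?exprn_ge0.
by rewrite le_eqVlt; apply/orP; left; apply/eqP/eq_bigr => m _; rewrite !RealsE c1 mulr1.
Qed.

Lemma norm_lam L c : (0 < L)%N -> (c < L * L)%N -> `|lam R[i] L c| <= ((2 * L)%:R : R)%:C.
Proof.
move=> L0 hc; rewrite /lam /gpt (le_trans (ler_normD _ _)) // normrM normCi mul1r !normr_nat.
rewrite rmorph_nat -natrD ler_nat mul2n -addnn leq_add // ltnW ?ltn_mod //.
by rewrite ltn_divLR.
Qed.

Lemma sum_mod S : (0 < S)%N -> (\sum_(i < 3 * S) (i %% S) = 3 * 'C(S, 2))%N.
Proof.
move=> S0; rewrite -(big_mkord xpredT (fun i => i %% S)%N) big_nat_mul big_mkord.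
rewrite (eq_bigr (fun=> 'C(S, 2))) ?sum_nat_const ?card_ord // => j _.
rewrite -{1}[(j * S)%N]add0n (big_addn 0) mulSn addnK.
rewrite -bin2_sum; apply: eq_big_nat => i /= hi.
by rewrite addnC modnMDl modn_small.
Qed.

Lemma uniform_threshold (P : nat -> nat -> Prop) n :
  (forall i, (i < n)%N -> exists T0, forall T, (T0 <= T)%N -> P i T) ->
  exists T0, forall i, (i < n)%N -> forall T, (T0 <= T)%N -> P i T.
Proof.
elim: n => [|n IH] h; first by exists 0%N.
have [T1 h1] := IH (fun i hi => h i (ltnW hi)).
have [T2 h2] := h n (ltnSn n).
exists (maxn T1 T2) => i; rewrite ltnS leq_eqVlt => /orP[/eqP->|hi] T.
  by rewrite geq_max => /andP[_]; exact: h2.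
by rewrite geq_max => /andP[hT _]; exact: h1.
Qed.

Lemma tcoef_factor (F : numClosedFieldType) S T i (x z : F) : (i %% S <= T)%N ->
  \sum_(m < T) tcoef S x i m * z ^+ m =
  z ^+ (i %% S) * \sum_(m < T - i %% S) z ^+ m * ((x *+ (i %/ S)) ^+ m / m`!%:R).
Proof.
set s := (i %% S)%N => h.
rewrite -(big_mkord xpredT (fun m => tcoef S x i m * z ^+ m)).
rewrite (@big_cat_nat _ _ _ s) //= big1_seq ?add0r; last first.
  move=> m /=; rewrite mem_index_iota /= => hm.
  by rewrite /tcoef leqNgt hm mul0r.
rewrite -{1}[s]add0n big_addn mulr_sumr big_mkord.
apply: eq_bigr => m _; rewrite /tcoef leq_addl addnK exprD; ring.
Qed.

(** * Confronting the two bounds for the minor *)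

Section Core.
Variables (S L p q k : nat) (E c0 d0 : R).
Hypotheses (S0 : (0 < S)%N) (q0 : (0 < q)%N) (hS : (4 * S <= (L - 2) * (L - 2))%N).
Hypotheses (E1 : 1 <= E) (c1 : 1 <= c0) (d00 : 0 < d0) (d01 : d0 <= 1).
Variables (x X Xt La : R).
Hypotheses (xE : x = 2 * Rtrigo1.PI * k%:R) (XE : X = Rtrigo_def.exp x).
Hypotheses (XtE : Xt = p%:R / q%:R) (LaE : La = (2 * L)%:R).
Hypothesis Xt1 : 1 < Xt.
Hypothesis near : forall n, (n <= 2 * L)%N ->
  [/\ Xt ^+ n <= c0, X ^+ n <= c0 & `|Xt ^+ n - X ^+ n| <= d0].

Let M := (3 * S)%N.

Lemma L_gt2 : (2 < L)%N.
Proof.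
by rewrite ltnNge; apply/negP => h; move: hS; rewrite (eqP h) muln0 leqn0 muln_eq0 /= -[S ==
    _]negbK -lt0n S0.
Qed.

Lemma x_ge0 : 0 <= x.
Proof. by rewrite xE mulr_ge0 // mulr_ge0 //; apply/RleP; left; exact: Rtrigo1.PI_RGT_0. Qed.

Lemma La1 : 1 <= La.
Proof. by rewrite LaE ler1n muln_gt0 /=; apply: ltn_trans L_gt2. Qed.
Lemma La0 : 0 <= La.
Proof. exact: le_trans ler01 La1. Qed.

(** [A] is the minor at [p / q], bounded below by arithmetic, and [B] its counterpart built from
    Taylor sums truncated at order [T]. The first summand bounds [|det A - det B|] by [det_perturb],
    the second bounds [|det B|] by [det_rankin]. In [2 * d0], one [d0] is the distance from
    [Xt ^+ n] to [X ^+ n], the other the truncation error; [c0 + 1] bounds the entries of both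
    matrices because [d0 <= 1]. *)
Lemma core_ineq :
  1 <= (q%:R ^+ (2 * L)) ^+ M * M`!%:R *
    (M%:R * (La ^+ S * (c0 + 1)) ^+ M * (La ^+ S * (2 * d0)) +
     (E * La) ^+ (3 * 'C(S, 2)) * Rtrigo_def.exp (E * La * x * 2) ^+ M / E ^+ 'C(M, 2)).
Proof.
have L0 : (0 < L)%N by apply: ltn_trans L_gt2.
have La00 := La0.
have XtC : (p%:R / q%:R : R[i]) = Xt%:C by rewrite XtE rmorphM fmorphV !rmorph_nat.
have Xt0 : 0 < Xt := lt_trans ltr01 Xt1.
have XtC0 : Xt%:C != 0 :> R[i] by rewrite (inj_eq (@complexI _)) gt_eqF.
have Xinj (a b : nat) : (Xt%:C : R[i]) ^+ a = Xt%:C ^+ b -> a = b.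
  by rewrite -!(rmorphXn (real_complex R)) => /complexI; apply: ieexprIn => //; rewrite gt_eqF.
have [f df] := @exists_minor R[i] S L _ S0 hS XtC0 Xinj.
have low := @minor_lower R[i] S L p q 0 f S0 q0.
rewrite XtC in low; move: {low}(low df) => low.
set A := \matrix_(i, j) _ in low.
have aj (i : 'I_M) (j : 'I_M) : (f j %/ L * (i %/ S) <= 2 * L)%N.
  rewrite mulnC leq_mul //; first by rewrite -ltnS ltn_divLR // ltn_ord.
  by rewrite ltnW // ltn_divLR // ltn_ord.
(* One truncation order must serve all entries; there are finitely many nodes and three values of
   [j]. The summand [S] in the witness compensates for the shift by [i %% S]. *)
have [T hT] : exists T, (S <= T)%N /\ forall (i j : 'I_M),
  `|\sum_(m < T - i %% S) lam R[i] L (f j) ^+ m * ((x%:C *+ (i %/ S)) ^+ m / m`!%:R)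
    - (X ^+ (f j %/ L * (i %/ S)))%:C| <= d0%:C.
  have U (c : nat) : exists T0, forall j, (j < 3)%N -> forall T, (T0 <= T)%N ->
     `|\sum_(m < T) lam R[i] L c ^+ m * ((x%:C *+ j) ^+ m / m`!%:R)
    - (X ^+ (c %/ L * j))%:C| <= d0%:C.
    by apply: uniform_threshold => j _; rewrite XE xE; exact: taylor_conv.
  have [T0 h0] := @uniform_threshold (fun c T => forall j, (j < 3)%N ->
     `|\sum_(m < T) lam R[i] L c ^+ m * ((x%:C *+ j) ^+ m / m`!%:R)
    - (X ^+ (c %/ L * j))%:C| <= d0%:C) (L * L) (fun c _ => let: ex_intro T0 h := U c in
       ex_intro _ T0 (fun T hT j hj => h j hj T hT)).
  exists (T0 + S)%N; split=> [|i j]; first exact: leq_addl.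
  apply: h0; rewrite ?ltn_divLR ?ltn_ord //.
  by rewrite -addnBA ?leq_addr // ltnW // ltn_mod.
pose w (i : 'I_M) (m : 'I_T) := tcoef S (x%:C : R[i]) i m.
pose B : 'M[R[i]]_M := \matrix_(i, j) \sum_(m < T) w i m * lam R[i] L (f j) ^+ m.
have BE (i j : 'I_M) : B i j = lam R[i] L (f j) ^+ (i %% S) *
   \sum_(m < T - i %% S) lam R[i] L (f j) ^+ m * ((x%:C *+ (i %/ S)) ^+ m / m`!%:R).
  rewrite mxE /w tcoef_factor //; apply: leq_trans hT.1.
  by rewrite ltnW // ltn_mod.
have nl (j : 'I_M) : `|lam R[i] L (f j)| <= La%:C.
  by rewrite LaE; exact: norm_lam L0 (ltn_ord (f j)).
have lamS (i j : 'I_M) : `|lam R[i] L (f j) ^+ (i %% S)| <= (La ^+ S)%:C.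
  rewrite normrX rmorphXn (@le_trans _ _ (La%:C ^+ (i %% S))) //.
    by rewrite lerXn2r ?nnegrE // -[0]/(0%:C) lecR.
  by rewrite -!(rmorphXn (real_complex R)) lecR ler_weXn2l ?La1 // ltnW // ltn_mod.
have bdX (i j : 'I_M) : X ^+ (f j %/ L * (i %/ S)) <= c0 by case: (near (aj i j)).
have X0 n : 0 <= X ^+ n by rewrite exprn_ge0 // XE; apply/RleP; left; exact: Exp_prop.exp_pos.
have LS0 : 0 <= La ^+ S by rewrite exprn_ge0.
have hA i j : `|A i j| <= (La ^+ S * (c0 + 1))%:C.
  rewrite mxE /entry normrM (rmorphM (real_complex R)); apply: ler_pM => //.
  rewrite -(rmorphXn (real_complex R)) norm_real_complex ger0_norm ?exprn_ge0 ?(ltW Xt0) // lecR.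
  by case: (near (aj i j)) => h _ _; rewrite (le_trans h) // lerDl.
have hB i j : `|B i j| <= (La ^+ S * (c0 + 1))%:C.
  rewrite BE normrM (rmorphM (real_complex R)); apply: ler_pM => //.
  have := hT.2 i j; set s := \sum_(m < _) _; set y := X ^+ _ => h.
  rewrite -(subrK (y%:C) s) (le_trans (ler_normD _ _)) // addrC [leRHS](rmorphD (real_complex R)) lerD //.
    by rewrite norm_real_complex lecR ger0_norm ?X0 // bdX.
  by rewrite (le_trans h) // lecR.
have hAB i j : `|A i j - B i j| <= (La ^+ S * (2 * d0))%:C.
  rewrite BE mxE /entry -mulrBr normrM (rmorphM (real_complex R)); apply: ler_pM => //.
  have := hT.2 i j; set s := \sum_(m < _) _; rewrite -(rmorphXn (real_complex R)); set n := (_ *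
      _)%N => h.
  have -> : (Xt ^+ n)%:C - s = (Xt ^+ n - X ^+ n)%:C - (s - (X ^+ n)%:C).
    by rewrite rmorphB /=; ring.
  rewrite (le_trans (ler_normB _ _)) // [2 * d0]mulr_natl mulr2n [leRHS](rmorphD (real_complex R))
      lerD //.
  by rewrite norm_real_complex lecR; case: (near (aj i j)).
have cc : 1 <= (La ^+ S * (c0 + 1))%:C :> R[i].
  rewrite -[1]/(1%:C) lecR mulr_ege1 //.
    by rewrite exprn_ege1 // La1.
  by rewrite lerDr (le_trans ler01).
have P1 := det_perturb cc hA hB hAB.
have E1C : 1 <= E%:C :> R[i] by rewrite -[1]/(1%:C) lecR.
have P2 := det_rankin w E1C nl.
rewrite -/B in P2.
have E0 : 0 <= E := le_trans ler01 E1.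
have EL0 : 0 <= E * La by rewrite mulr_ge0.
have P3 : \prod_i \sum_(m < T) `|w i m| * (E%:C * La%:C) ^+ m <=
   ((E * La) ^+ (3 * 'C(S, 2)) * Rtrigo_def.exp (E * La * x * 2) ^+ M)%:C.
  have -> : (E * La) ^+ (3 * 'C(S, 2)) * Rtrigo_def.exp (E * La * x * 2) ^+ M =
     \prod_(i < M) ((E * La) ^+ (i %% S) * Rtrigo_def.exp (E * La * x * 2)).
    by rewrite big_split /= prodrXr sum_mod // prodr_const card_ord.
  rewrite rmorph_prod; apply: ler_prod => i _; apply/andP; split.
    apply: sumr_ge0 => m _; rewrite mulr_ge0 // exprn_ge0 //.
    by rewrite -rmorphM -[0]/(0%:C) lecR.
  rewrite -rmorphM; apply: (le_trans (tcoef_sum S T i _ _)).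
  - by rewrite -[0]/(0%:C) lecR.
  - by rewrite -[0]/(0%:C) lecR x_ge0.
  rewrite [leRHS](rmorphM (real_complex R)) (rmorphXn (real_complex R)) ler_wpM2l ?exprn_ge0
      -?[0]/(0%:C) ?lecR //.
  have -> : \sum_(m < T) ((E * La)%:C * x%:C *+ (i %/ S)) ^+ m / m`!%:R =
    (\sum_(m < T) (E * La * x *+ (i %/ S)) ^+ m / m`!%:R)%:C :> R[i].
    rewrite rmorph_sum; apply: eq_bigr => m _ /=.
    by rewrite [RHS](rmorphM (real_complex R)) (fmorphV (real_complex R)) rmorph_nat (rmorphXn
        (real_complex R)) (rmorphMn (real_complex R)) !(rmorphM (real_complex R)).
  have ELx : 0 <= E * La * x by rewrite mulr_ge0 // x_ge0.
  rewrite lecR (le_trans (exp_partial_sum _ _)) // ?mulrn_wge0 //.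
  have : E * La * x *+ (i %/ S) <= E * La * x * 2.
    by rewrite -mulr_natr ler_wpM2l // ler_nat -ltnS ltn_divLR // ltn_ord.
  rewrite le_eqVlt => /orP[/eqP ->//|] /RltP /Rpower.exp_increasing /RltP; exact: ltW.
have Epos : 0 < E ^+ 'C(M, 2) by rewrite exprn_gt0 // (lt_le_trans ltr01).
have PB : `|\det B| <= (M`!%:R * ((E * La) ^+ (3 * 'C(S, 2)) * Rtrigo_def.exp (E * La * x * 2) ^+ M
    / E ^+ 'C(M, 2)))%:C.
  rewrite mulrA (rmorphM (real_complex R)) (fmorphV (real_complex R)).
  rewrite ler_pdivlMr; last by rewrite -[0]/(0%:C) ltcR.
  rewrite (rmorphXn (real_complex R)) (le_trans P2) //.
  by rewrite [leRHS](rmorphM (real_complex R)) rmorph_nat ler_wpM2l.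
set rhs := (X in _ <= X).
suff h : (1 : R[i]) <= rhs%:C by move: h; rewrite -[1]/(1%:C) lecR.
rewrite /rhs; apply: (le_trans low); rewrite natrX -mulrA rmorphM !rmorphXn /= rmorph_nat.
rewrite ler_wpM2l ?exprn_ge0 //.
rewrite -(subrK (\det B) (\det A)) (le_trans (ler_normD _ _)) // mulrDr [leRHS](rmorphD
    (real_complex R)) lerD //.
apply: (le_trans P1); rewrite !rmorphM !rmorph_nat !rmorphXn /=.
by rewrite (rmorphM (real_complex R)) (rmorphXn (real_complex R)).
Qed.
End Core.

Lemma eq_bin2 (n m : nat) : (2 * m = n * (n - 1))%N -> m = 'C(n, 2).
Proof. by move=> h; rewrite bin2 -[m]doubleK -mul2n h -subn1. Qed.

Lemma eq_bin2_3 (n m : nat) : (2 * m = 3 * (n * (n - 1)))%N -> m = (3 * 'C(n, 2))%N.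
Proof.
move=> h; apply: double_inj; rewrite -!mul2n h [RHS]mulnCA; congr (_ * _)%N.
by rewrite bin2 mul2n subn1 -[LHS]odd_double_half; case: n {h} => // n; rewrite oddM /= andNb.
Qed.

Local Close Scope complex_scope.
Local Close Scope ring_scope.
Import Reals.
Local Open Scope R_scope.

(** The interface to the rest of the proof: only standard real operations occur, and the binomials
    are given by their doubles, which [nia] and [lia] can produce. *)
Lemma core_ineq_R (S L p q k n3 s3 : nat) (E c0 d0 x : R) :
  (0 < S)%coq_nat -> (0 < q)%coq_nat -> (4 * S <= (L - 2) * (L - 2))%coq_nat ->
  (2 * n3 = 3 * S * (3 * S - 1))%coq_nat -> (2 * s3 = 3 * (S * (S - 1)))%coq_nat ->
  Rle 1 E -> Rle 1 c0 -> Rlt 0 d0 -> Rle d0 1 ->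
  x = 2 * PI * INR k -> Rlt 1 (INR p / INR q) ->
  (forall n, (n <= 2 * L)%coq_nat ->
     Rle ((INR p / INR q) ^ n) c0 /\ Rle (exp x ^ n) c0 /\
     Rle (Rabs ((INR p / INR q) ^ n - exp x ^ n)) d0) ->
  Rle 1 ((INR q ^ (2 * L)%coq_nat) ^ (3 * S)%coq_nat * INR (Factorial.fact (3 * S)%coq_nat) *
    (INR (3 * S)%coq_nat * (INR (2 * L)%coq_nat ^ S * (c0 + 1)) ^ (3 * S)%coq_nat * (INR (2 *
        L)%coq_nat ^ S * (2 * d0))
     + (E * INR (2 * L)%coq_nat) ^ s3 * exp (E * INR (2 * L)%coq_nat * x * 2) ^ (3 * S)%coq_nat / E
         ^ n3)).
Proof.
move=> /ssrnat.ltP S0 /ssrnat.ltP q0 /ssrnat.leP hS hn hs /RleP E1 /RleP c1 /RltP d00 /RleP d01 xE.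
move=> /RltP Xt1 near; apply/RleP.
rewrite (eq_bin2 hn) (eq_bin2_3 hs).
rewrite !RealsE.
rewrite !RealsE in xE Xt1.
apply: (@core_ineq S L p q k E c0 d0 S0 q0 hS E1 c1 d00 d01 x (exp x) _ _ xE erefl erefl erefl Xt1).
move=> n /ssrnat.leP hn'; have [h1 [h2 h3]] := near n hn'.
by move: h1 h2 h3; rewrite !RealsE => /RleP h1 /RleP h2 /RleP h3.
Qed.

End Determinant.

From Stdlib Require Import Reals Lra Lia ZArith Factorial.
From Coquelicot Require Import Coquelicot.
Require Import Defs.
Open Scope R_scope.

Lemma exp_le_exp x y : x <= y -> exp x <= exp y.
Proof. intros [H|H]; [left; now apply exp_increasing | rewrite H; lra]. Qed.

Lemma exp_pow x n : exp x ^ n = exp (INR n * x).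
Proof.
induction n as [|n IH]; [simpl; now rewrite Rmult_0_l, exp_0|].
rewrite <- tech_pow_Rmult, IH, S_INR, <- exp_plus; f_equal; ring.
Qed.

Lemma pow_exp_ln a n : 0 < a -> a ^ n = exp (INR n * ln a).
Proof. intros H; now rewrite <- exp_pow, exp_ln. Qed.

Lemma ln_le_sub1 x : 0 < x -> ln x <= x - 1.
Proof.
intros H; pose proof (exp_ineq1_le (ln x)); rewrite exp_ln in H0 by exact H; lra.
Qed.

Lemma floor_nat_spec x : 0 <= x -> INR (floor_nat x) <= x < INR (floor_nat x) + 1.
Proof.
intros Hx; unfold floor_nat; pose proof (base_Int_part x) as [H1 H2].
assert (0 <= Int_part x)%Z.
  apply Z.lt_succ_r, lt_IZR; rewrite succ_IZR; lra.
rewrite INR_IZR_INZ, Z2Nat.id by assumption; lra.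
Qed.

(** * A lower bound for [|q exp (2 PI k) - p|] *)

Lemma fact_le_pow n : (1 <= n)%nat -> INR (fact n) <= INR n ^ n.
Proof.
intros H; induction H as [|n H IH]; [simpl; lra|].
rewrite fact_simpl, mult_INR, <- tech_pow_Rmult.
apply Rmult_le_compat_l; [apply pos_INR|].
apply Rle_trans with (1 := IH); apply pow_incr; split; [apply pos_INR|].
rewrite S_INR; lra.
Qed.

Lemma pow_diff_le a b Y n : 0 <= a <= Y -> 0 <= b <= Y -> 1 <= Y ->
  Rabs (a ^ n - b ^ n) <= INR n * Y ^ n * Rabs (a - b).
Proof.
intros Ha Hb HY; induction n as [|n IH].
  simpl; rewrite Rminus_diag, Rabs_R0; lra.
replace (a ^ S n - b ^ S n) with (a * (a ^ n - b ^ n) + (a - b) * b ^ n) by (simpl; ring).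
apply Rle_trans with (1 := Rabs_triang _ _); rewrite !Rabs_mult, S_INR.
rewrite (Rabs_pos_eq a) by lra.
assert (Hbn : 0 <= b ^ n <= Y ^ S n).
  split; [apply pow_le; lra|].
  apply Rle_trans with (Y ^ n); [apply pow_incr; lra|].
  apply Rle_pow; [lra|lia].
rewrite (Rabs_pos_eq (b ^ n)) by lra.
pose proof (Rabs_pos (a - b)) as Hd; pose proof (Rabs_pos (a ^ n - b ^ n)) as Hn.
assert (a * Rabs (a ^ n - b ^ n) <= Y * (INR n * Y ^ n * Rabs (a - b))).
  apply Rmult_le_compat; lra.
assert (Rabs (a - b) * b ^ n <= Rabs (a - b) * Y ^ S n) by (apply Rmult_le_compat_l; lra).
simpl pow in *; nra.
Qed.

Lemma double_bin2 n : exists m, (2 * m = n * (n - 1))%nat.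
Proof.
induction n as [|n [m IH]]; [exists 0%nat; reflexivity|].
exists (m + n)%nat; nia.
Qed.

Section Measure.
Variables (r k q p : nat).
Let y := INR r.
Hypotheses (Hy : 100 <= ln y) (Hk : (1 <= k)%nat) (Hq : (1 <= q)%nat).
Let x := 2 * PI * INR k.
Hypotheses (Hx : x <= y) (Hlq : ln (INR q) <= y).

Lemma y_ge : 101 <= y.
Proof.
assert (0 < y).
  destruct (Rlt_le_dec 0 y) as [H|H]; [exact H|].
  unfold ln in Hy; destruct (Rlt_dec 0 y) as [H1|H1]; lra.
pose proof (ln_le_sub1 y H); lra.
Qed.

Lemma ypow_le m n : (m <= n)%nat -> 1 <= y ^ m <= y ^ n.
Proof.
pose proof y_ge; intros Hmn; split; [apply pow_R1_Rle; lra | apply Rle_pow; [lra|exact Hmn]].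
Qed.

(* Parameters of the determinant: [a, b < L = 3 r^4], derivatives of order less than
   [S = r^8] at three points, and Rankin weight [E = r^3]. *)
Lemma irrationality_measure_power : exp (- y ^ 19) <= Rabs (INR q * exp x - INR p).
Proof.
destruct (Rle_lt_dec (exp (- y ^ 19)) (Rabs (INR q * exp x - INR p))) as [H|H]; [exact H|exfalso].
pose proof y_ge as Y1.
set (X := exp x) in *; set (Xt := INR p / INR q).
assert (q1 : 1 <= INR q) by (apply (le_INR 1); exact Hq).
assert (k1 : 1 <= INR k) by (apply (le_INR 1); exact Hk).
assert (hd : Rabs (Xt - X) <= exp (- y ^ 19)).
  replace (Xt - X) with (- ((INR q * X - INR p) / INR q)) by (unfold Xt; field; lra).
  rewrite Rabs_Ropp; unfold Rdiv; rewrite Rabs_mult, Rabs_inv, (Rabs_pos_eq (INR q)) by lra.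
  assert (0 < / INR q <= 1).
    split; [apply Rinv_0_lt_compat; lra|]; rewrite <- Rinv_1; apply Rinv_le_contravar; lra.
  pose proof (Rabs_pos (INR q * X - INR p)); nra.
assert (hs : exp (- y ^ 19) <= 1).
  rewrite <- exp_0; apply exp_le_exp; pose proof (ypow_le 0 19 ltac:(lia)); lra.
assert (hx : 6 <= x) by (unfold x; pose proof PI2_3_2; unfold PI2 in *; nra).
assert (hX : 7 <= X) by (unfold X; pose proof (exp_ineq1_le x); lra).
apply Rabs_le_between in hd.
assert (Xt1 : 1 < Xt) by lra.
assert (ey : X <= exp y) by (apply exp_le_exp; exact Hx).
assert (e2y : exp y + 1 <= exp (2 * y)).
  replace (2 * y) with (y + y) by ring; rewrite exp_plus.
  pose proof (exp_ineq1_le y); nra.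
set (Yb := exp (2 * y)).
assert (Yb1 : 1 <= Yb) by (unfold Yb; pose proof (exp_ineq1_le (2 * y)); lra).
set (L := (3 * r ^ 4)%nat); set (S := (r ^ 8)%nat).
assert (IL : INR (2 * L) = 6 * y ^ 4).
  unfold L; rewrite !mult_INR, pow_INR; simpl; fold y; ring.
assert (IS : INR S = y ^ 8) by (unfold S; rewrite pow_INR; reflexivity).
assert (IM : INR (3 * S) = 3 * y ^ 8) by (rewrite mult_INR, IS; simpl; ring).
(* Both [X] and [Xt] are at most [exp (2 y)], and exponents go up to [2 L = 6 y ^ 4], whence [c0].
   For [d0], [pow_diff_le] multiplies the distance [exp (- y ^ 19)] by [c0] and by
   [n <= 6 y ^ 4 <= exp (6 y)]. *)
set (c0 := exp (12 * y ^ 5)).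
set (d0 := exp (6 * y + 12 * y ^ 5 - y ^ 19)).
assert (hYn : forall n, (n <= 2 * L)%nat -> Yb ^ n <= c0).
  intros n hn; unfold Yb, c0; rewrite exp_pow; apply exp_le_exp.
  apply le_INR in hn; rewrite IL in hn.
  apply Rle_trans with (6 * y ^ 4 * (2 * y)); [apply Rmult_le_compat_r; lra | right; ring].
assert (hln6 : INR (2 * L) <= exp (6 * y)).
  rewrite IL. 
  assert (6 <= exp (2 * y)) by (pose proof (exp_ineq1_le (2 * y)); lra).
  assert (y ^ 4 <= exp (4 * y)).
    replace (4 * y) with (INR 4 * y) by (simpl; ring); rewrite <- exp_pow.
    apply pow_incr; pose proof (exp_ineq1_le y); lra.
  replace (6 * y) with (2 * y + 4 * y) by ring; rewrite exp_plus.
  pose proof (ypow_le 0 4 ltac:(lia)); apply Rmult_le_compat; lra.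
pose proof (ypow_le 5 17 ltac:(lia)) as P5.
pose proof (ypow_le 1 17 ltac:(lia)) as P1; rewrite pow_1 in P1.
assert (P19 : 10201 * y ^ 17 <= y ^ 19).
  replace (y ^ 19) with (y * y * y ^ 17) by ring; apply Rmult_le_compat_r; nra.
assert (d01 : d0 <= 1).
  unfold d0; rewrite <- exp_0; apply exp_le_exp; lra.
assert (r0 : (2 <= r ^ 4)%nat).
  apply INR_le; rewrite pow_INR; fold y; pose proof (ypow_le 1 4 ltac:(lia)).
  rewrite pow_1 in *; simpl INR; lra.
assert (S0 : (0 < S)%nat).
  unfold S; replace (r ^ 8)%nat with (r ^ 4 * r ^ 4)%nat by (rewrite <- Nat.pow_add_r; reflexivity); nia.
assert (hS : (4 * S <= (L - 2) * (L - 2))%nat).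
  unfold S, L; replace (r ^ 8)%nat with (r ^ 4 * r ^ 4)%nat by (rewrite <- Nat.pow_add_r; reflexivity).
  revert r0; generalize (r ^ 4)%nat; intros z hz.
  assert (2 * z <= 3 * z - 2)%nat by lia; nia.
destruct (double_bin2 (3 * S)) as [n3 hn3]; destruct (double_bin2 S) as [m3 hm3].
assert (Rn3 : INR n3 = 3 * y ^ 8 * (3 * y ^ 8 - 1) / 2).
  apply (f_equal INR) in hn3; rewrite !mult_INR, minus_INR, IS, IM in hn3 by lia.
  simpl INR in hn3; lra.
assert (Rs3 : INR (3 * m3) = 3 * (y ^ 8 * (y ^ 8 - 1)) / 2).
  apply (f_equal INR) in hm3; rewrite !mult_INR, minus_INR, IS in hm3 by lia.
  rewrite mult_INR; simpl INR in *; lra.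
pose proof (ypow_le 0 3 ltac:(lia)) as P3.
assert (c01 : 1 <= c0).
  unfold c0; rewrite <- exp_0; apply exp_le_exp; lra.
assert (near : forall n, (n <= 2 * L)%nat ->
   Xt ^ n <= c0 /\ X ^ n <= c0 /\ Rabs (Xt ^ n - X ^ n) <= d0).
  intros n hn; pose proof (hYn n hn) as hY.
  assert (0 <= Xt <= Yb) by (unfold Yb; lra).
  assert (0 <= X <= Yb) by (unfold Yb; lra).
  split; [|split].
  - apply Rle_trans with (2 := hY); now apply pow_incr.
  - apply Rle_trans with (2 := hY); now apply pow_incr.
  - apply Rle_trans with (1 := pow_diff_le Xt X Yb n H0 H1 Yb1).
    unfold d0; replace (6 * y + 12 * y ^ 5 - y ^ 19) with (6 * y + 12 * y ^ 5 + - y ^ 19) by ring.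
    rewrite !exp_plus; fold c0.
    pose proof (pos_INR n); pose proof (le_INR _ _ hn).
    assert (0 <= Yb ^ n) by (apply pow_le; lra).
    apply Rmult_le_compat; [nra | apply Rabs_pos | apply Rmult_le_compat; lra | apply Rabs_le; lra].
assert (core := @Determinant.core_ineq_R S L p q k n3 (3 * m3) (y ^ 3) c0 d0 x S0 Hq hS
  ltac:(lia) ltac:(lia) ltac:(lra) c01 (exp_pos _) d01 eq_refl Xt1 near).
clear near hYn.
fold X in core; rewrite IM, IL in core.
set (P := (INR q ^ (2 * L)) ^ (3 * S) * INR (fact (3 * S))) in core.
set (T1 := 3 * y ^ 8 * _ * _) in core.
set (T2 := _ / _) in core.
assert (P0 : 0 <= P) by (unfold P; apply Rmult_le_pos; [apply pow_le, pow_le; lra | apply pos_INR]).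
assert (hP : P <= exp (45 * y ^ 13)).
  unfold P.
  assert (h1 : (INR q ^ (2 * L)) ^ (3 * S) <= exp (18 * y ^ 13)).
    rewrite (pow_exp_ln (INR q)), exp_pow, IL, IM by lra.
    apply exp_le_exp; replace (18 * y ^ 13) with (3 * y ^ 8 * (6 * y ^ 4 * y)) by ring.
    pose proof (ypow_le 0 8 ltac:(lia)); pose proof (ypow_le 0 4 ltac:(lia)).
    apply Rmult_le_compat_l; [lra|]; apply Rmult_le_compat_l; lra.
  assert (h2 : INR (fact (3 * S)) <= exp (27 * y ^ 9)).
    apply Rle_trans with (1 := fact_le_pow (3 * S) ltac:(lia)); rewrite IM at 1.
    assert (3 * y ^ 8 <= exp (9 * y)).
      assert (3 <= exp y) by (pose proof (exp_ineq1_le y); lra).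
      assert (y ^ 8 <= exp (8 * y)).
        replace (8 * y) with (INR 8 * y) by (simpl; ring); rewrite <- exp_pow.
        apply pow_incr; pose proof (exp_ineq1_le y); lra.
      replace (9 * y) with (y + 8 * y) by ring; rewrite exp_plus.
      pose proof (ypow_le 0 8 ltac:(lia)); apply Rmult_le_compat; lra.
    apply Rle_trans with (exp (9 * y) ^ (3 * S)).
      apply pow_incr; pose proof (ypow_le 0 8 ltac:(lia)); lra.
    rewrite exp_pow, IM; apply exp_le_exp; right; ring.
  apply Rle_trans with (exp (18 * y ^ 13) * exp (27 * y ^ 9)).
    apply Rmult_le_compat; [apply pow_le, pow_le; lra | apply pos_INR | exact h1 | exact h2].
  rewrite <- exp_plus; apply exp_le_exp; pose proof (ypow_le 9 13 ltac:(lia)); lra.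
assert (e3 : exp (-3) <= / 4).
  replace (-3) with (- (3)) by ring; rewrite exp_Ropp; apply Rinv_le_contravar; [lra|].
  pose proof (exp_ineq1_le 3); lra.
(* The largest loss is [(La ^ S * (c0 + 1)) ^ (3 S)], at most [exp (57 y ^ 17)]; the factor
   [exp (- y ^ 19)] in [d0] overcomes it. *)
assert (hT1 : P * T1 <= / 4).
  apply Rle_trans with (2 := e3).
  assert (h1 : (6 * y ^ 4) ^ S <= exp (6 * y ^ 9)).
    rewrite IL in hln6; pose proof (ypow_le 0 4 ltac:(lia)).
    apply Rle_trans with (exp (6 * y) ^ S); [apply pow_incr; lra|].
    rewrite exp_pow, IS; apply exp_le_exp; right; ring.
  assert (h10 : 0 <= (6 * y ^ 4) ^ S) by (apply pow_le; pose proof (ypow_le 0 4 ltac:(lia)); lra).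
  assert (h2 : c0 + 1 <= exp (13 * y ^ 5)).
    replace (13 * y ^ 5) with (12 * y ^ 5 + y ^ 5) by ring; rewrite exp_plus; fold c0.
    pose proof (exp_ineq1_le (y ^ 5)); nra.
  assert (h3 : ((6 * y ^ 4) ^ S * (c0 + 1)) ^ (3 * S) <= exp (57 * y ^ 17)).
    apply Rle_trans with ((exp (6 * y ^ 9) * exp (13 * y ^ 5)) ^ (3 * S)).
      apply pow_incr; split; [apply Rmult_le_pos; lra | apply Rmult_le_compat; lra].
    rewrite <- exp_plus, exp_pow, IM; apply exp_le_exp.
    replace (3 * y ^ 8 * (6 * y ^ 9 + 13 * y ^ 5)) with (18 * y ^ 17 + 39 * y ^ 13) by ring.
    pose proof (ypow_le 13 17 ltac:(lia)); lra.
  assert (h4 : 3 * y ^ 8 <= exp (9 * y)).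
    assert (3 <= exp y) by (pose proof (exp_ineq1_le y); lra).
    assert (y ^ 8 <= exp (8 * y)).
      replace (8 * y) with (INR 8 * y) by (simpl; ring); rewrite <- exp_pow.
      apply pow_incr; pose proof (exp_ineq1_le y); lra.
    replace (9 * y) with (y + 8 * y) by ring; rewrite exp_plus.
    pose proof (ypow_le 0 8 ltac:(lia)); apply Rmult_le_compat; lra.
  assert (h5 : 2 <= exp 1) by (pose proof (exp_ineq1_le 1); lra).
  pose proof (ypow_le 0 8 ltac:(lia)) as Y8.
  pose proof (exp_pos (6 * y + 12 * y ^ 5 - y ^ 19)) as d00; fold d0 in d00.
  apply Rle_trans with (exp (45 * y ^ 13) * (exp (9 * y) * exp (57 * y ^ 17) * (exp (6 * y ^ 9) *
      (exp 1 * d0)))).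
    apply Rmult_le_compat; [exact P0 | | exact hP |].
      unfold T1; apply Rmult_le_pos; [apply Rmult_le_pos; [lra | apply pow_le, Rmult_le_pos; lra] |
          apply Rmult_le_pos; lra].
    unfold T1; apply Rmult_le_compat.
    - apply Rmult_le_pos; [lra | apply pow_le, Rmult_le_pos; lra].
    - apply Rmult_le_pos; lra.
    - apply Rmult_le_compat; [lra | apply pow_le, Rmult_le_pos; lra | exact h4 | exact h3].
    - apply Rmult_le_compat; [exact h10 | lra | exact h1 | apply Rmult_le_compat_r; lra].
  unfold d0; rewrite <- !exp_plus; apply exp_le_exp.
  pose proof (ypow_le 13 17 ltac:(lia)); pose proof (ypow_le 9 17 ltac:(lia)); lra.
(* With [l = ln y], the power [s3 = 3 C(S, 2)] of [E La = 6 y ^ 7] costs about [(21/2) y ^ 16 l] in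
   the exponent, while [E ^ C(3 S, 2)] saves about [(27/2) y ^ 16 l]. The exponential factor costs
   [36 y ^ 16], without a logarithm, so the net saving [3 y ^ 16 l] prevails because [l >= 100]. *)
assert (hT2 : P * T2 <= / 4).
  apply Rle_trans with (2 := e3).
  set (l := ln y) in *.
  assert (E1 : T2 = exp (INR (3 * m3) * (ln 6 + 7 * l) + 3 * y ^ 8 * (12 * y ^ 7 * x) - INR n3 * (3
      * l))).
    unfold T2; rewrite (pow_exp_ln (y ^ 3)) by (apply pow_lt; lra).
    replace (y ^ 3 * (6 * y ^ 4)) with (6 * y ^ 7) by ring.
    assert (0 < y ^ 7) by (apply pow_lt; lra).
    rewrite (pow_exp_ln (6 * y ^ 7)), exp_pow, IM by lra.
    rewrite ln_mult, !ln_pow by lra; fold l.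
    unfold Rdiv; rewrite <- exp_Ropp, <- !exp_plus; f_equal; simpl INR; ring.
  assert (l6 : ln 6 <= 5) by (pose proof (ln_le_sub1 6); lra).
  pose proof (ypow_le 0 8 ltac:(lia)) as Y8.
  pose proof (ypow_le 13 16 ltac:(lia)) as Y13.
  pose proof (ypow_le 8 16 ltac:(lia)) as Y16.
  apply Rle_trans with (exp (45 * y ^ 13) * T2).
    apply Rmult_le_compat_r; [rewrite E1; left; apply exp_pos | exact hP].
  rewrite E1, <- exp_plus; apply exp_le_exp; rewrite Rs3, Rn3.
  assert (B1 : 3 * (y ^ 8 * (y ^ 8 - 1)) / 2 * (ln 6 + 7 * l) <= 3 * (y ^ 8 * (y ^ 8 - 1)) / 2 * (5
      + 7 * l)).
    apply Rmult_le_compat_l; nra.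
  assert (B2 : 3 * y ^ 8 * (12 * y ^ 7 * x) <= 36 * y ^ 16).
    replace (36 * y ^ 16) with (36 * y ^ 15 * y) by ring.
    replace (3 * y ^ 8 * (12 * y ^ 7 * x)) with (36 * y ^ 15 * x) by ring.
    apply Rmult_le_compat_l; [pose proof (ypow_le 0 15 ltac:(lia)); lra | exact Hx].
  assert (B3 : 3 * (y ^ 8 * (y ^ 8 - 1)) / 2 * (5 + 7 * l) - 3 * y ^ 8 * (3 * y ^ 8 - 1) / 2 * (3 * l)
    = y ^ 16 * (15 / 2 - 3 * l) - y ^ 8 * (15 / 2 + 6 * l)) by field.
  assert (B4 : y ^ 16 * (15 / 2 - 3 * l) <= y ^ 16 * (- 292)) by (apply Rmult_le_compat_l; lra).
  assert (B5 : 0 <= y ^ 8 * (15 / 2 + 6 * l)) by (apply Rmult_le_pos; lra).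
  lra.
rewrite Rmult_plus_distr_l in core; lra.
Qed.
End Measure.

(** Apply the previous lemma with [r] the integer part of [U ^ (1/40)]: then
    [r ^ 19 <= r ^ 20 <= sqrt U], while [2 PI k] and [ln q], being [O (ln U)], stay below [r]. *)
Lemma power_e2pi_measure : exists U0 : R, 1 <= U0 /\ forall (U : R) (k q p : nat),
  U0 <= U -> (1 <= k)%nat -> (1 <= q)%nat -> INR k <= ln U -> INR q <= U ->
  exp (- sqrt U) <= Rabs (INR q * exp (2 * PI * INR k) - INR p).
Proof.
exists (exp (40 * 2001)); split; [pose proof (exp_ineq1_le (40 * 2001)); lra|].
intros U k q p HU Hk Hq HkU HqU.
pose proof (exp_pos (40 * 2001)) as Ep.
assert (HlU : 40 * 2001 <= ln U) by (rewrite <- (ln_exp (40 * 2001)); apply ln_le; lra).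
(* The 40th root of [U], so that [z ^ 20 = sqrt U]. *)
set (z := exp (ln U / 40)).
assert (Hz : U = z ^ 20 * z ^ 20).
  unfold z; rewrite exp_pow, <- exp_plus; simpl INR.
  match goal with |- _ = exp ?t => replace t with (ln U) by field end.
  rewrite exp_ln; lra.
pose proof (exp_pos (ln U / 40)) as Hz0; fold z in Hz0.
pose proof (floor_nat_spec z ltac:(lra)) as Hr; set (r := floor_nat z) in *.
assert (Hz1 : exp 2000 + 1 <= z).
  assert (exp 2001 <= z) by (apply exp_le_exp; lra).
  replace 2001 with (1 + 2000) in H by ring; rewrite exp_plus in H.
  pose proof (exp_ineq1_le 1); pose proof (exp_ineq1_le 2000); nra.
assert (Hl : 2000 <= ln (INR r)).
  rewrite <- (ln_exp 2000); apply ln_le; [apply exp_pos | lra].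
pose proof (exp_pos 2000) as E2.
assert (Hy : 0 < INR r) by lra.
assert (HU2 : ln U <= 40 * (1 + ln (INR r))).
  assert (ln z = ln U / 40) by (unfold z; apply ln_exp).
  assert (ln z <= ln (2 * INR r)).
    apply ln_le; pose proof (exp_ineq1_le 2000); lra.
  rewrite ln_mult in H0 by lra; pose proof (ln_le_sub1 2); lra.
assert (Hbig : 320 * (1 + ln (INR r)) <= INR r).
  set (l := ln (INR r)) in *.
  assert (INR r = exp (l / 2) * exp (l / 2)).
    rewrite <- exp_plus; replace (l / 2 + l / 2) with l by field; unfold l; rewrite exp_ln; lra.
  pose proof (exp_ineq1_le (l / 2)); nra.
assert (PI <= 4) by apply PI_4.
apply Rle_trans with (exp (- INR r ^ 19)).
  apply exp_le_exp, Ropp_le_contravar.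
  rewrite Hz, sqrt_square by (apply pow_le; lra).
  apply Rle_trans with (INR r ^ 20); [apply Rle_pow; [pose proof (exp_ineq1_le 2000); lra | lia] |].
  apply pow_incr; lra.
apply irrationality_measure_power; [lra | exact Hk | exact Hq | |].
- pose proof PI_RGT_0; pose proof (pos_INR k); nra.
- apply Rle_trans with (ln U); [|lra].
  apply ln_le; [apply lt_0_INR; lia | exact HqU].
Qed.

(** * The Kusmin-Landau inequality and the approximation of zeta *)

Lemma sum_1_to_S f N : sum_1_to f (S N) = sum_1_to f N + f (S N).
Proof. reflexivity. Qed.

Lemma sum_1_to_ext f g N : (forall n, (1 <= n <= N)%nat -> f n = g n) ->
  sum_1_to f N = sum_1_to g N.
Proof.
induction N as [|N IH]; intros H; simpl; [reflexivity|].
rewrite IH, H; [reflexivity | lia | intros; apply H; lia].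
Qed.

Lemma sum_1_to_le f g N : (forall n, (1 <= n <= N)%nat -> f n <= g n) ->
  sum_1_to f N <= sum_1_to g N.
Proof.
induction N as [|N IH]; intros H; simpl; [lra|].
apply Rplus_le_compat; [apply IH; intros; apply H; lia | apply H; lia].
Qed.

Lemma sum_1_to_plus f g N :
  sum_1_to (fun n => f n + g n) N = sum_1_to f N + sum_1_to g N.
Proof. induction N as [|N IH]; simpl; [ring|rewrite IH; ring]. Qed.

Lemma sum_1_to_minus f g N :
  sum_1_to (fun n => f n - g n) N = sum_1_to f N - sum_1_to g N.
Proof. induction N as [|N IH]; simpl; [ring|rewrite IH; ring]. Qed.

Lemma sum_1_to_scal c f N : sum_1_to (fun n => c * f n) N = c * sum_1_to f N.
Proof. induction N as [|N IH]; simpl; [ring|rewrite IH; ring]. Qed.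

Lemma sum_1_to_const c N : sum_1_to (fun _ => c) N = INR N * c.
Proof. induction N as [|N IH]; simpl sum_1_to; [simpl; ring | rewrite IH, S_INR; ring]. Qed.

Lemma sum_1_to_nonneg f N : (forall n, (1 <= n <= N)%nat -> 0 <= f n) -> 0 <= sum_1_to f N.
Proof.
intros H; rewrite <- (Rmult_0_r (INR N)), <- sum_1_to_const; now apply sum_1_to_le.
Qed.

Lemma sum_1_to_abs f N : Rabs (sum_1_to f N) <= sum_1_to (fun n => Rabs (f n)) N.
Proof.
induction N as [|N IH]; simpl; [rewrite Rabs_R0; lra|].
pose proof (Rabs_triang (sum_1_to f N) (f (S N))); lra.
Qed.

Lemma sum_1_to_swap (f : nat -> nat -> R) M N :
  sum_1_to (fun m => sum_1_to (f m) N) M = sum_1_to (fun n => sum_1_to (fun m => f m n) M) N.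
Proof.
induction M as [|M IH]; simpl.
  rewrite sum_1_to_const; ring.
now rewrite IH, sum_1_to_plus.
Qed.

Lemma sum_1_to_mono f M N : (forall n, (1 <= n <= N)%nat -> 0 <= f n) -> (M <= N)%nat ->
  sum_1_to f M <= sum_1_to f N.
Proof.
intros H HMN; induction HMN as [|N HMN IH]; [lra|simpl].
assert (0 <= f (S N)) by (apply H; lia).
apply Rle_trans with (1 := IH ltac:(intros; apply H; lia)); lra.
Qed.

Lemma sum_1_to_shift_le f h N Y : (forall n, (1 <= n <= h + Y)%nat -> 0 <= f n) -> (N <= Y)%nat ->
  sum_1_to (fun n => f (h + n)%nat) N <= sum_1_to f (h + Y).
Proof.
intros H HN.
assert (E : forall M, sum_1_to f (h + M) = sum_1_to f h + sum_1_to (fun n => f (h + n)%nat) M).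
  induction M as [|M IH]; simpl; [rewrite Nat.add_0_r; ring|].
  rewrite Nat.add_succ_r; simpl; rewrite IH; ring.
apply Rle_trans with (sum_1_to f (h + N)).
  rewrite E; assert (0 <= sum_1_to f h) by (apply sum_1_to_nonneg; intros; apply H; lia); lra.
apply sum_1_to_mono; [exact H | lia].
Qed.

Fixpoint sum_from (f : nat -> R) (A n : nat) : R :=
  match n with O => 0 | S m => sum_from f A m + f (A + m)%nat end.

Lemma sum_1_to_split f A n : sum_1_to f (A + n) = sum_1_to f A + sum_from f (S A) n.
Proof.
induction n as [|n IH]; [rewrite Nat.add_0_r; simpl; ring|].
rewrite Nat.add_succ_r; simpl; rewrite IH; ring.
Qed.

Lemma sum_from_ext f g A n : (forall i, (A <= i < A + n)%nat -> f i = g i) ->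
  sum_from f A n = sum_from g A n.
Proof.
induction n as [|n IH]; intros H; simpl; [reflexivity|].
rewrite IH, H; [reflexivity | lia | intros; apply H; lia].
Qed.

Lemma sum_from_lin a b f g A n :
  sum_from (fun i => a * f i + b * g i) A n = a * sum_from f A n + b * sum_from g A n.
Proof. induction n as [|n IH]; simpl; [ring | rewrite IH; ring]. Qed.

Lemma sum_from_telescope f A n :
  sum_from (fun i => f (S i) - f i) A n = f (A + n)%nat - f A.
Proof.
induction n as [|n IH]; simpl; [rewrite Nat.add_0_r; ring|].
rewrite IH, Nat.add_succ_r; ring.
Qed.

Lemma abel_bound a x A n K :
  (forall i, (A <= i < A + n)%nat -> a (S i) <= a i) ->
  (forall i, (A <= i <= A + n)%nat -> 0 <= a i) ->
  (forall m, (m <= n)%nat -> Rabs (sum_from x A m) <= K) ->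
  Rabs (sum_from (fun i => a i * x i) A n) <= a A * K.
Proof.
intros Ha Hp Hx.
assert (H : Rabs (sum_from (fun i => a i * x i) A n - a (A + n)%nat * sum_from x A n)
   <= (a A - a (A + n)%nat) * K).
{ induction n as [|n IH].
    simpl; rewrite Nat.add_0_r, Rmult_0_r, !Rminus_diag, Rabs_R0; lra.
  assert (H1 : Rabs (sum_from (fun i => a i * x i) A n - a (A + n)%nat * sum_from x A n)
     <= (a A - a (A + n)%nat) * K).
    apply IH; intros; [apply Ha | apply Hp | apply Hx]; lia.
  assert (H2 := Hx (S n) (Nat.le_refl _)).
  assert (H3 := Ha (A + n)%nat ltac:(lia)).
  rewrite Nat.add_succ_r.
  replace (sum_from (fun i => a i * x i) A (S n) - a (S (A + n)) * sum_from x A (S n)) with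
    ((sum_from (fun i => a i * x i) A n - a (A + n)%nat * sum_from x A n) +
     (a (A + n)%nat - a (S (A + n))) * sum_from x A (S n)) by (simpl; ring).
  apply Rle_trans with (1 := Rabs_triang _ _).
  rewrite Rabs_mult, (Rabs_pos_eq (a _ - a _)) by lra.
  assert ((a (A + n)%nat - a (S (A + n))) * Rabs (sum_from x A (S n)) <=
     (a (A + n)%nat - a (S (A + n))) * K) by (apply Rmult_le_compat_l; lra).
  lra. }
assert (H2 := Hx n (Nat.le_refl _)).
assert (H3 := Hp (A + n)%nat ltac:(lia)).
replace (sum_from (fun i => a i * x i) A n) with
  ((sum_from (fun i => a i * x i) A n - a (A + n)%nat * sum_from x A n) +
    a (A + n)%nat * sum_from x A n) by ring.
apply Rle_trans with (1 := Rabs_triang _ _).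
rewrite Rabs_mult, (Rabs_pos_eq (a (A + n)%nat)) by lra.
assert (a (A + n)%nat * Rabs (sum_from x A n) <= a (A + n)%nat * K)
  by (apply Rmult_le_compat_l; lra).
lra.
Qed.

Definition cot (u : R) := cos u / sin u.

Lemma cot_decreasing u v : 0 < u -> u <= v -> v < PI -> cot v <= cot u.
Proof.
intros Hu Huv Hv; unfold cot.
assert (0 < sin u) by (apply sin_gt_0; lra).
assert (0 < sin v) by (apply sin_gt_0; lra).
assert (E : cos u / sin u - cos v / sin v = sin (v - u) / (sin u * sin v)).
  rewrite sin_minus; field; lra.
assert (0 <= sin (v - u)) by (apply sin_ge_0; lra).
assert (0 <= sin (v - u) / (sin u * sin v)).
  apply Rdiv_le_0_compat; [assumption | now apply Rmult_lt_0_compat].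
lra.
Qed.

(** The real part of [e^(i f) = (e^(i g) - e^(i f)) / (e^(i (g - f)) - 1)], with [1 / (e^(i x) - 1)
    = - 1/2 - (i/2) cot (x / 2)]. *)
Lemma cos_kusmin f g : sin ((g - f) / 2) <> 0 ->
  cos f = (- 1 / 2) * (cos g - cos f) + / 2 * (cot ((g - f) / 2) * (sin g - sin f)).
Proof.
intros H; unfold cot.
set (h := (g - f) / 2) in *; set (m := (g + f) / 2).
replace f with (m - h) by (unfold m, h; field); replace g with (m + h) by (unfold m, h; field).
rewrite cos_plus, cos_minus, sin_plus, sin_minus; field_simplify; [|exact H..].
field; exact H.
Qed.

(* Kusmin-Landau: the exponential sum telescopes against the cotangents of half the phase increments. *)
Lemma kusmin_landau (phi : nat -> R) (A n : nat) (K : R) :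
  let c i := cot ((phi (S i) - phi i) / 2) in
  (forall i, (A <= i <= A + n)%nat -> sin ((phi (S i) - phi i) / 2) <> 0) ->
  (forall i, (A <= i <= A + n)%nat -> 0 <= c i <= K) ->
  (forall i, (A <= i < A + n)%nat -> c (S i) <= c i) \/
  (forall i, (A <= i < A + n)%nat -> c i <= c (S i)) ->
  Rabs (sum_from (fun i => cos (phi i)) A n) <= 1 + 2 * K.
Proof.
intros c Hs Hc Hm.
assert (HK : 0 <= K) by (pose proof (Hc A ltac:(lia)); lra).
pose (d := fun i => sin (phi (S i)) - sin (phi i)).
assert (Hd : forall m, Rabs (sum_from d A m) <= 2).
  intros m; unfold d; rewrite (sum_from_telescope (fun i => sin (phi i))).
  pose proof (SIN_bound (phi (A + m)%nat)); pose proof (SIN_bound (phi A)).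
  apply Rabs_le; lra.
assert (E : sum_from (fun i => cos (phi i)) A n =
  (- 1 / 2) * (cos (phi (A + n)%nat) - cos (phi A)) + / 2 * sum_from (fun i => c i * d i) A n).
  rewrite <- (sum_from_telescope (fun i => cos (phi i))), <- sum_from_lin.
  apply sum_from_ext; intros i Hi; apply cos_kusmin, Hs; lia.
assert (B : Rabs (sum_from (fun i => c i * d i) A n) <= 4 * K).
  destruct Hm as [Hm|Hm].
  - apply Rle_trans with (c A * 2).
      apply abel_bound; [exact Hm | intros; apply Hc; lia | intros; apply Hd].
    pose proof (Hc A ltac:(lia)); lra.
  (* When the cotangents increase, Abel summation is applied to the decreasing weights [K - c i]. *)
  - assert (E2 : sum_from (fun i => c i * d i) A n =
       K * sum_from d A n + -1 * sum_from (fun i => (K - c i) * d i) A n).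
      rewrite <- sum_from_lin; apply sum_from_ext; intros; ring.
    assert (Rabs (sum_from (fun i => (K - c i) * d i) A n) <= (K - c A) * 2).
      apply (abel_bound (fun i => K - c i)); [intros i Hi; specialize (Hm i Hi); lra | | intros;
          apply Hd].
      intros i Hi; specialize (Hc i Hi); lra.
    pose proof (Hc A ltac:(lia)); pose proof (Hd n).
    rewrite E2; apply Rle_trans with (1 := Rabs_triang _ _); rewrite !Rabs_mult.
    rewrite (Rabs_pos_eq K) by lra; rewrite (Rabs_left (-1)) by lra.
    assert (K * Rabs (sum_from d A n) <= K * 2) by (apply Rmult_le_compat_l; lra).
    lra.
apply Rabs_le_between in B.
pose proof (COS_bound (phi (A + n)%nat)); pose proof (COS_bound (phi A)).
apply Rabs_le; rewrite E; lra.
Qed.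

(** From [sin u >= u - u ^ 3 / 6] and [u ^ 2 <= 4]. *)
Lemma sin_ge_third u : 0 <= u <= 2 -> u / 3 <= sin u.
Proof.
intros Hu; destruct (pre_sin_bound u 0 ltac:(lra) ltac:(lra)) as [H _].
unfold sin_approx, sin_term in H; simpl in H.
assert (u * (u * u) <= u * 4) by (apply Rmult_le_compat_l; nra).
lra.
Qed.

Definition lstep (n : nat) : R := ln (INR (S n)) - ln (INR n).

Lemma lstep_decr n : (1 <= n)%nat -> lstep (S n) <= lstep n.
Proof.
intros Hn; unfold lstep.
assert (1 <= INR n) by (apply (le_INR 1); exact Hn).
rewrite <- !ln_div by (apply lt_0_INR; lia).
apply ln_le; [apply Rdiv_lt_0_compat; apply lt_0_INR; lia|].
rewrite !S_INR.
apply Rmult_le_reg_r with ((INR n + 1) * INR n); [nra|]; field_simplify; [|lra..]; nra.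
Qed.

Lemma lstep_bounds n : (1 <= n)%nat -> / (INR n + 1) <= lstep n <= / INR n.
Proof.
intros Hn; assert (1 <= INR n) by (apply (le_INR 1); exact Hn).
unfold lstep; rewrite <- ln_div by (apply lt_0_INR; lia); rewrite S_INR; split.
- assert (E : ln ((INR n + 1) / INR n) = - ln (INR n / (INR n + 1))).
    rewrite <- ln_Rinv by (apply Rdiv_lt_0_compat; lra); f_equal; field; lra.
  rewrite E; pose proof (ln_le_sub1 (INR n / (INR n + 1)) ltac:(apply Rdiv_lt_0_compat; lra)).
  replace (/ (INR n + 1)) with (- (INR n / (INR n + 1) - 1)) by (field; lra); lra.
- pose proof (ln_le_sub1 ((INR n + 1) / INR n) ltac:(apply Rdiv_lt_0_compat; lra)).
  replace (/ INR n) with ((INR n + 1) / INR n - 1) by (field; lra); lra.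
Qed.

Lemma inv_sqrt_decr n : (1 <= n)%nat -> / sqrt (INR (S n)) <= / sqrt (INR n).
Proof.
intros Hn; assert (1 <= INR n) by (apply (le_INR 1); exact Hn).
apply Rinv_le_contravar; [apply sqrt_lt_R0; lra | apply sqrt_le_1_alt; rewrite S_INR; lra].
Qed.

Lemma inv_sqrt_pos n : (1 <= n)%nat -> 0 < / sqrt (INR n).
Proof.
intros Hn; assert (1 <= INR n) by (apply (le_INR 1); exact Hn).
apply Rinv_0_lt_compat, sqrt_lt_R0; lra.
Qed.

(* [b = 0] gives cosines and [b = PI / 2] gives sines. *)
Lemma dyadic_block_bound (t : nat) (b : R) (N : nat) : (1 <= t <= N)%nat ->
  Rabs (sum_from (fun n => / sqrt (INR n) * cos (INR t * ln (INR n) - b)) (S N) N)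
  <= 50 * (sqrt (INR N) / INR t).
Proof.
intros Ht.
assert (Rt : 1 <= INR t) by (apply (le_INR 1); lia).
assert (RN : INR t <= INR N) by (apply le_INR; lia).
set (phi := fun n => INR t * ln (INR n) - b).
assert (Hphi : forall i, (phi (S i) - phi i) / 2 = INR t * lstep i / 2).
  intros i; unfold phi, lstep; field.
assert (Hd : forall i, (S N <= i <= S N + N)%nat ->
   INR t / (4 * INR N) <= INR t * lstep i <= 1).
  intros i Hi; destruct (lstep_bounds i ltac:(lia)) as [H1 H2].
  assert (INR (S N) <= INR i) by (apply le_INR; lia); rewrite S_INR in H.
  assert (INR i <= INR (S N + N)) by (apply le_INR; lia); rewrite plus_INR, S_INR in H0.
  split.
  - apply Rmult_le_compat_l; [lra|]; apply Rle_trans with (2 := H1).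
    apply Rinv_le_contravar; lra.
  - apply Rle_trans with (INR t * / INR i); [apply Rmult_le_compat_l; lra|].
    apply Rmult_le_reg_r with (INR i); [lra|]; field_simplify; lra. 
assert (HN : 0 < INR t / (4 * INR N)) by (apply Rdiv_lt_0_compat; lra).
pose proof PI2_3_2 as P2; unfold PI2 in P2.
(* Half the phase increment is at least [t / (8 N)], so [sin u >= u / 3] bounds the cotangent by
   [24 N / t]; the additional 1 is absorbed since [N / t >= 1]. *)
assert (B : forall m, (m <= N)%nat -> Rabs (sum_from (fun n => cos (phi n)) (S N) m)
   <= 50 * (INR N / INR t)).
{ intros m Hm; apply Rle_trans with (1 + 2 * (24 * (INR N / INR t))).
  2: { assert (1 <= INR N / INR t) by (apply Rmult_le_reg_r with (INR t); [lra|]; field_simplify; lra).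
       lra. }
  apply kusmin_landau.
  - intros i Hi; rewrite Hphi; specialize (Hd i ltac:(lia)).
    apply Rgt_not_eq, sin_gt_0; lra.
  - intros i Hi; rewrite Hphi; specialize (Hd i ltac:(lia)).
    set (u := INR t * lstep i / 2).
    assert (u / 3 <= sin u) by (apply sin_ge_third; unfold u; lra).
    assert (0 < u) by (unfold u; lra).
    assert (0 <= cos u) by (apply cos_ge_0; unfold u; lra).
    assert (cos u <= 1) by apply COS_bound.
    unfold cot; split; [apply Rdiv_le_0_compat; lra|].
    apply Rle_trans with (1 / (INR t / (4 * INR N) / 6)).
      apply Rmult_le_compat; [lra | left; apply Rinv_0_lt_compat; lra | lra |].
      apply Rinv_le_contravar; [lra | unfold u in *; lra].
    right; field; lra.
  - right; intros i Hi; rewrite !Hphi.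
    pose proof (Hd i ltac:(lia)); pose proof (Hd (S i) ltac:(lia)).
    pose proof (lstep_decr i ltac:(lia)).
    apply cot_decreasing; try lra.
    assert (INR t * lstep (S i) <= INR t * lstep i) by (apply Rmult_le_compat_l; lra); lra. }
apply Rle_trans with (/ sqrt (INR (S N)) * (50 * (INR N / INR t))).
  apply (abel_bound (fun n => / sqrt (INR n)) (fun n => cos (phi n))); [| |exact B].
  - intros i Hi; apply inv_sqrt_decr; lia.
  - intros i Hi; left; apply inv_sqrt_pos; lia.
apply Rle_trans with (/ sqrt (INR N) * (50 * (INR N / INR t))).
  apply Rmult_le_compat_r; [|apply inv_sqrt_decr; lia].
  apply Rmult_le_pos; [lra|]; apply Rdiv_le_0_compat; lra.
right; assert (0 < sqrt (INR N)) by (apply sqrt_lt_R0; lra).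
rewrite <- (sqrt_sqrt (INR N)) at 2 by lra; field; lra.
Qed.

Lemma cos_npi_sub n u : cos (INR n * PI - u) = (-1) ^ n * cos u.
Proof.
induction n as [|n IH]; [simpl; rewrite Rmult_0_l, Rminus_0_l, cos_neg; ring|].
replace (INR (S n) * PI - u) with (INR n * PI - u + PI) by (rewrite S_INR; ring).
rewrite neg_cos, IH; simpl; ring.
Qed.

(** The sign is the phase [i PI], so half the increment is [PI / 2 - u] with [0 < u <= 1/2]. Its
    cotangent is [tan u <= 2]: there is no small denominator, and the bound has no factor depending
    on [t]. *)
Lemma alternating_tail_bound (t : nat) (b : R) (M n : nat) : (1 <= t <= M)%nat ->
  Rabs (sum_from (fun i => / sqrt (INR i) * ((-1) ^ i * cos (INR t * ln (INR i) - b))) (S M) n)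
  <= 5 * / sqrt (INR M).
Proof.
intros Ht.
assert (Rt : 1 <= INR t) by (apply (le_INR 1); lia).
set (phi := fun i => INR i * PI - (INR t * ln (INR i) - b)).
assert (Hphi : forall i, (phi (S i) - phi i) / 2 = PI / 2 - INR t * lstep i / 2).
  intros i; unfold phi, lstep; rewrite S_INR; field.
assert (Hd : forall i, (S M <= i)%nat -> 0 < INR t * lstep i <= 1).
  intros i Hi; destruct (lstep_bounds i ltac:(lia)) as [H1 H2].
  assert (INR (S M) <= INR i) by (apply le_INR; lia); rewrite S_INR in H.
  assert (INR t <= INR M) by (apply le_INR; lia).
  assert (0 < / (INR i + 1)) by (apply Rinv_0_lt_compat; lra).
  split; [apply Rmult_lt_0_compat; lra|].
  apply Rle_trans with (INR t * / INR i); [apply Rmult_le_compat_l; lra|].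
  apply Rmult_le_reg_r with (INR i); [lra|]; field_simplify; lra.
pose proof PI2_3_2 as P2; unfold PI2 in P2.
assert (B : forall m, (m <= n)%nat -> Rabs (sum_from (fun i => cos (phi i)) (S M) m) <= 1 + 2 * 2).
{ intros m Hm; apply kusmin_landau.
  - intros i Hi; rewrite Hphi; specialize (Hd i ltac:(lia)).
    apply Rgt_not_eq, sin_gt_0; lra.
  - intros i Hi; rewrite Hphi; specialize (Hd i ltac:(lia)).
    set (u := INR t * lstep i / 2) in *; unfold cot.
    rewrite cos_shift, sin_shift.
    assert (1 / 2 <= cos u).
      rewrite <- cos_PI3; apply cos_decr_1; unfold u; lra.
    assert (0 <= sin u) by (apply sin_ge_0; unfold u; lra).
    assert (sin u <= 1) by apply SIN_bound.
    split; [apply Rdiv_le_0_compat; lra|].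
    apply Rmult_le_reg_r with (cos u); [lra|]; field_simplify; lra.
  - left; intros i Hi; rewrite !Hphi.
    pose proof (Hd i ltac:(lia)); pose proof (Hd (S i) ltac:(lia)).
    pose proof (lstep_decr i ltac:(lia)).
    assert (INR t * lstep (S i) <= INR t * lstep i) by (apply Rmult_le_compat_l; lra).
    apply cot_decreasing; lra. }
rewrite (sum_from_ext _ (fun i => / sqrt (INR i) * cos (phi i))).
  2: { intros i _; unfold phi; now rewrite cos_npi_sub. }
apply Rle_trans with (/ sqrt (INR (S M)) * (1 + 2 * 2)).
  apply (abel_bound (fun n => / sqrt (INR n)) (fun n => cos (phi n))); [| |exact B].
  - intros i Hi; apply inv_sqrt_decr; lia.
  - intros i Hi; left; apply inv_sqrt_pos; lia.
pose proof (inv_sqrt_decr M ltac:(lia)); lra.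
Qed.

Lemma lim_tail_bound (u : nat -> R) (M : nat) (K : R) :
  ex_finite_lim_seq u -> (forall n, Rabs (u (M + n)%nat - u M) <= K) ->
  Rabs (real (Lim_seq u) - u M) <= K.
Proof.
intros [l Hl] HK; rewrite (is_lim_seq_unique _ _ Hl); simpl.
assert (H1 : is_lim_seq (fun n => u (n + M)%nat) l) by now apply is_lim_seq_incr_n.
assert (H2 : forall n, u M - K <= u (n + M)%nat <= u M + K).
  intros n; specialize (HK n); rewrite Nat.add_comm in HK; apply Rabs_le_between in HK; lra.
assert (Rbar_le l (u M + K)).
  apply (is_lim_seq_le _ (fun _ => u M + K) _ _ (fun n => proj2 (H2 n)) H1), is_lim_seq_const.
assert (Rbar_le (u M - K) l).
  apply (is_lim_seq_le (fun _ => u M - K) _ _ _ (fun n => proj1 (H2 n))); [apply is_lim_seq_const |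
      exact H1].
simpl in *; apply Rabs_le; lra.
Qed.

(** [eta] takes [real (Lim_seq _)], which is defined even for divergent sequences; the tail bound
    makes the partial sums Cauchy, so that the value is a true limit. *)
Lemma ex_lim_of_tail (u : nat -> R) (t : nat) (c : R) :
  (forall M n, (t <= M)%nat -> Rabs (u (M + n)%nat - u M) <= c * / sqrt (INR M)) ->
  ex_finite_lim_seq u.
Proof.
intros H; apply ex_lim_seq_cauchy_corr; intros eps.
destruct (archimed_cor1 ((eps / (2 * Rabs c + 1)) ^ 2)) as [N [HN HN0]].
  apply pow_lt, Rdiv_lt_0_compat; [apply cond_pos | pose proof (Rabs_pos c); lra].
assert (Hc := Rabs_pos c).
assert (Hsm : forall M, (N <= M)%nat -> 2 * (c * / sqrt (INR M)) < eps).
  intros M HM; assert (0 < INR N) by (apply lt_0_INR; lia).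
  assert (INR N <= INR M) by (apply le_INR; lia).
  assert (/ sqrt (INR M) < eps / (2 * Rabs c + 1)).
    rewrite <- sqrt_inv; apply Rsqr_incrst_0.
    - rewrite Rsqr_sqrt by (left; apply Rinv_0_lt_compat; lra).
      apply Rle_lt_trans with (/ INR N); [apply Rinv_le_contravar; lra|].
      unfold Rsqr; simpl in HN; rewrite Rmult_1_r in HN; exact HN.
    - apply sqrt_pos.
    - left; apply Rdiv_lt_0_compat; [apply cond_pos | lra].
  assert (0 < / sqrt (INR M)) by (apply Rinv_0_lt_compat, sqrt_lt_R0; lra).
  assert (c * / sqrt (INR M) <= Rabs c * / sqrt (INR M))
    by (apply Rmult_le_compat_r; [lra | apply Rle_abs]).
  assert (2 * (Rabs c * / sqrt (INR M)) <= 2 * (Rabs c * (eps / (2 * Rabs c + 1)))).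
    apply Rmult_le_compat_l; [lra|]; apply Rmult_le_compat_l; lra.
  assert (2 * (Rabs c * (eps / (2 * Rabs c + 1))) < eps).
    apply Rmult_lt_reg_r with (2 * Rabs c + 1); [lra|].
    replace (2 * (Rabs c * (eps / (2 * Rabs c + 1))) * (2 * Rabs c + 1)) with (2 * Rabs c * eps) by
        (field; lra).
    pose proof (cond_pos eps); nra.
  lra.
exists (Nat.max N t); intros n m Hn Hm.
assert (Hw : forall p, (Nat.max N t <= p)%nat -> Rabs (u p - u (Nat.max N t)) <= c * / sqrt (INR
    (Nat.max N t))).
  intros p Hp; replace p with (Nat.max N t + (p - Nat.max N t))%nat at 1 by lia; apply H; lia.
specialize (Hsm (Nat.max N t) ltac:(lia)).
pose proof (Hw n Hn) as A1; pose proof (Hw m Hm) as A2.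
apply Rabs_le_between in A1; apply Rabs_le_between in A2; apply Rabs_def1; lra.
Qed.

(** * From eta to zeta on the critical line *)

Definition Zcos (N : nat) (t : R) := sum_1_to (fun n => / sqrt (INR n) * cos (t * ln (INR n))) N.
Definition Zsin (N : nat) (t : R) := sum_1_to (fun n => / sqrt (INR n) * sin (t * ln (INR n))) N.

(** The sign is [(-1) ^ n], against [(-1) ^ (n - 1)] in [eta_partial], to match the phase [n PI];
    the real part of [eta_partial] is thus minus [eta_sum 0]. *)
Definition eta_sum (b t : R) (N : nat) :=
  sum_1_to (fun n => / sqrt (INR n) * ((-1) ^ n * cos (t * ln (INR n) - b))) N.

Lemma cos_sub_PI2 u : cos (u - PI / 2) = sin u.
Proof. rewrite cos_minus, cos_PI2, sin_PI2; ring. Qed.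

Lemma npow_neg_half n t : (1 <= n)%nat ->
  npow_neg n (1 / 2, t) =
  (/ sqrt (INR n) * cos (t * ln (INR n)), - (/ sqrt (INR n) * sin (t * ln (INR n)))).
Proof.
intros Hn; assert (0 < INR n) by (apply lt_0_INR; lia).
unfold npow_neg; simpl.
assert (E : exp (- (1 / 2) * ln (INR n)) = / sqrt (INR n)).
  rewrite <- Rpower_sqrt by assumption; unfold Rpower; rewrite <- exp_Ropp; f_equal; field.
rewrite E, Ropp_mult_distr_l_reverse, cos_neg, sin_neg; f_equal; ring.
Qed.

Lemma eta_partial_half N t :
  eta_partial (1 / 2, t) N = (- eta_sum 0 t N, eta_sum (PI / 2) t N).
Proof.
induction N as [|N IH]; [unfold eta_sum; simpl; now rewrite Ropp_0|].
change (eta_partial (1 / 2, t) (S N)) with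
  (Cplus (eta_partial (1 / 2, t) N) (Cmult (RtoC ((-1) ^ N)) (npow_neg (S N) (1 / 2, t)))).
rewrite IH, npow_neg_half by lia.
unfold eta_sum; rewrite !sum_1_to_S; cbv beta; unfold Cplus, Cmult, RtoC; cbn [fst snd].
rewrite Rminus_0_r, cos_sub_PI2; rewrite <- tech_pow_Rmult; f_equal; ring.
Qed.

Lemma eta_sum_tail (t : nat) b M n : (1 <= t <= M)%nat ->
  Rabs (eta_sum b (INR t) (M + n) - eta_sum b (INR t) M) <= 5 * / sqrt (INR M).
Proof.
intros Ht; unfold eta_sum; rewrite sum_1_to_split.
match goal with |- Rabs (?a + ?c - ?a) <= _ => replace (a + c - a) with c by ring end.
now apply alternating_tail_bound.
Qed.

Lemma eta_approx (t M : nat) : (1 <= t <= M)%nat ->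
  Rabs (fst (eta (1 / 2, INR t)) - fst (eta_partial (1 / 2, INR t) M)) <= 5 * / sqrt (INR M) /\
  Rabs (snd (eta (1 / 2, INR t)) - snd (eta_partial (1 / 2, INR t) M)) <= 5 * / sqrt (INR M).
Proof.
intros Ht; unfold eta; cbn [fst snd]; split.
- apply (lim_tail_bound (fun N => Re (eta_partial (1 / 2, INR t) N)) M).
    apply (ex_lim_of_tail _ t 5); intros m n Hm; rewrite !eta_partial_half; simpl.
    rewrite <- Rabs_Ropp; replace (- _) with (eta_sum 0 (INR t) (m + n) - eta_sum 0 (INR t) m) by ring.
    apply eta_sum_tail; lia.
  intros n; rewrite !eta_partial_half; simpl.
  rewrite <- Rabs_Ropp; replace (- _) with (eta_sum 0 (INR t) (M + n) - eta_sum 0 (INR t) M) by ring.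
  apply eta_sum_tail; lia.
- apply (lim_tail_bound (fun N => Im (eta_partial (1 / 2, INR t) N)) M).
    apply (ex_lim_of_tail _ t 5); intros m n Hm; rewrite !eta_partial_half; simpl.
    apply eta_sum_tail; lia.
  intros n; rewrite !eta_partial_half; simpl; apply eta_sum_tail; lia.
Qed.

(* eta_N = Z_{2N} - 2^{1-s} Z_N, separating even from odd indices *)
Lemma eta_sum_double b t N :
  eta_sum b t (2 * N) =
  sqrt 2 * (cos (t * ln 2) * sum_1_to (fun n => / sqrt (INR n) * cos (t * ln (INR n) - b)) N
     - sin (t * ln 2) * sum_1_to (fun n => / sqrt (INR n) * sin (t * ln (INR n) - b)) N)
  - sum_1_to (fun n => / sqrt (INR n) * cos (t * ln (INR n) - b)) (2 * N).
Proof.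
assert (s2 : 0 < sqrt 2) by (apply sqrt_lt_R0; lra).
assert (i2 : / sqrt 2 = sqrt 2 / 2).
  apply Rmult_eq_reg_l with (sqrt 2); [|lra]; rewrite Rinv_r by lra.
  pose proof (sqrt_sqrt 2); lra.
induction N as [|N IH]; [unfold eta_sum; simpl; ring|].
replace (2 * S N)%nat with (S (S (2 * N))) by lia.
unfold eta_sum in *; rewrite !sum_1_to_S, IH; cbv beta.
assert (E1 : (-1) ^ S (2 * N) = -1) by (apply pow_1_odd).
assert (E2 : (-1) ^ S (S (2 * N)) = 1).
  replace (S (S (2 * N))) with (2 * S N)%nat by lia; apply pow_1_even.
rewrite E1, E2.
assert (H : INR (S (S (2 * N))) = 2 * INR (S N)).
  rewrite !S_INR, mult_INR; simpl; ring.
assert (P : 0 < INR (S N)) by (apply lt_0_INR; lia).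
assert (E3 : / sqrt (INR (S (S (2 * N)))) * cos (t * ln (INR (S (S (2 * N)))) - b) =
  sqrt 2 / 2 * (/ sqrt (INR (S N)) * (cos (t * ln 2) * cos (t * ln (INR (S N)) - b)
      - sin (t * ln 2) * sin (t * ln (INR (S N)) - b)))).
  rewrite H, sqrt_mult, ln_mult by lra.
  replace (t * (ln 2 + ln (INR (S N))) - b) with (t * ln 2 + (t * ln (INR (S N)) - b)) by ring.
  rewrite cos_plus.
  assert (0 < sqrt (INR (S N))) by (apply sqrt_lt_R0; lra).
  rewrite Rinv_mult, i2; ring.
rewrite Rmult_1_l, E3; lra.
Qed.

Lemma Zcos_block (t N : nat) : (1 <= t <= N)%nat ->
  Rabs (Zcos (2 * N) (INR t) - Zcos N (INR t)) <= 50 * (sqrt (INR N) / INR t).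
Proof.
intros H; pose proof (dyadic_block_bound t 0 N H) as B.
unfold Zcos; replace (2 * N)%nat with (N + N)%nat by lia; rewrite sum_1_to_split.
match goal with |- Rabs (?a + ?c - ?a) <= _ => replace (a + c - a) with c by ring end.
erewrite sum_from_ext; [exact B|].
intros i _; simpl; now rewrite Rminus_0_r.
Qed.

Lemma Zsin_block (t N : nat) : (1 <= t <= N)%nat ->
  Rabs (Zsin (2 * N) (INR t) - Zsin N (INR t)) <= 50 * (sqrt (INR N) / INR t).
Proof.
intros H; pose proof (dyadic_block_bound t (PI / 2) N H) as B.
unfold Zsin; replace (2 * N)%nat with (N + N)%nat by lia; rewrite sum_1_to_split.
match goal with |- Rabs (?a + ?c - ?a) <= _ => replace (a + c - a) with c by ring end.
erewrite sum_from_ext; [exact B|].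
intros i _; simpl; now rewrite cos_sub_PI2.
Qed.

Lemma eta_partial_double t N :
  eta_partial (1 / 2, t) (2 * N) =
  (Zcos (2 * N) t - sqrt 2 * (cos (t * ln 2) * Zcos N t - sin (t * ln 2) * Zsin N t),
   sqrt 2 * (cos (t * ln 2) * Zsin N t + sin (t * ln 2) * Zcos N t) - Zsin (2 * N) t).
Proof.
rewrite eta_partial_half, !eta_sum_double.
assert (E1 : forall M, sum_1_to (fun n => / sqrt (INR n) * cos (t * ln (INR n) - 0)) M = Zcos M t).
  intros M; apply sum_1_to_ext; intros; now rewrite Rminus_0_r.
assert (E2 : forall M, sum_1_to (fun n => / sqrt (INR n) * sin (t * ln (INR n) - 0)) M = Zsin M t).
  intros M; apply sum_1_to_ext; intros; now rewrite Rminus_0_r.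
assert (E3 : forall M, sum_1_to (fun n => / sqrt (INR n) * cos (t * ln (INR n) - PI / 2)) M = Zsin M t).
  intros M; apply sum_1_to_ext; intros; now rewrite cos_sub_PI2.
assert (E4 : forall M, sum_1_to (fun n => / sqrt (INR n) * sin (t * ln (INR n) - PI / 2)) M = -1 *
    Zcos M t).
  intros M; unfold Zcos; rewrite <- sum_1_to_scal; apply sum_1_to_ext; intros.
  rewrite sin_minus, sin_PI2, cos_PI2; ring.
rewrite !E1, !E2, !E3, !E4; f_equal; ring.
Qed.

(** In [eta_(2N) = Z_(2N) - 2^(1-s) Z_N] the block bound replaces [Z_(2N)] by [Z_N], leaving
    [(1 - 2^(1-s)) Z_N]. Each coordinate of the error is at most [(5 + 50) e], and
    [|1 - 2^(1-s)| >= sqrt 2 - 1 >= 4/10] on the critical line. *)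
Lemma zeta_approx (t N : nat) : (1 <= t <= N)%nat ->
  Cmod (Cminus (zeta (1 / 2, INR t)) (Zcos N (INR t), - Zsin N (INR t)))
  <= 400 * (sqrt (INR N) / INR t).
Proof.
intros Ht; set (T := INR t); set (Z := (Zcos N T, - Zsin N T) : C).
set (e := sqrt (INR N) / T).
assert (Rt : 1 <= T) by (apply (le_INR 1); lia).
assert (RN : T <= INR N) by (apply le_INR; lia).
assert (sN : 0 < sqrt (INR N)) by (apply sqrt_lt_R0; lra).
assert (s2 : 14 / 10 < sqrt 2).
  apply Rsqr_incrst_0; [rewrite Rsqr_sqrt by lra; unfold Rsqr; lra | lra | apply sqrt_pos].
assert (He : / sqrt (INR (2 * N)) <= e).
  apply Rle_trans with (/ sqrt (INR N)).
    apply Rinv_le_contravar; [exact sN|]; apply sqrt_le_1_alt, le_INR; lia.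
  unfold e; rewrite <- (sqrt_sqrt (INR N)) in RN by lra.
  apply Rmult_le_reg_r with (sqrt (INR N) * T); [nra|]; field_simplify; nra.
set (w := two_pow_one_minus (1 / 2, T)).
set (c := cos (T * ln 2)); set (s := sin (T * ln 2)).
assert (Ew : w = (sqrt 2 * c, - (sqrt 2 * s))).
  unfold w, two_pow_one_minus; simpl.
  assert (E : exp ((1 - 1 / 2) * ln 2) = sqrt 2).
    rewrite <- Rpower_sqrt by lra; unfold Rpower; f_equal; field.
  rewrite E, Ropp_mult_distr_l_reverse, cos_neg, sin_neg; fold c s; f_equal; ring.
assert (Cw : Cmod w = sqrt 2).
  unfold Cmod; rewrite Ew; cbn [fst snd]; f_equal.
  pose proof (sqrt_sqrt 2 ltac:(lra)); pose proof (sin2_cos2 (T * ln 2)) as sc.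
  fold c s in sc; unfold Rsqr in sc; simpl; nra.
set (D := Cminus (RtoC 1) w).
assert (CD : 4 / 10 <= Cmod D).
  pose proof (Cmod_triangle D (RtoC (-1))) as H.
  replace (Cplus D (RtoC (-1))) with (Copp w) in H.
    rewrite Cmod_opp, Cw, Cmod_R, (Rabs_left (-1)) in H by lra; lra.
  unfold D; rewrite Ew; unfold Cminus, Cplus, Copp, RtoC; cbn [fst snd]; f_equal; ring.
assert (D0 : D <> RtoC 0) by (intros E; rewrite E, Cmod_0 in CD; lra).
set (err := Cminus (eta (1 / 2, T)) (Cmult D Z)).
assert (Ez : Cminus (zeta (1 / 2, T)) Z = Cdiv err D).
  unfold zeta, err; fold w; fold D; field; exact D0.
rewrite Ez, Cmod_div by exact D0.
destruct (eta_approx t (2 * N) ltac:(lia)) as [H1 H2]; fold T in H1, H2.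
rewrite eta_partial_double in H1, H2; cbn [fst snd] in H1, H2; fold c s in H1, H2.
pose proof (Zcos_block t N Ht) as H3; pose proof (Zsin_block t N Ht) as H4; fold T e in H3, H4.
assert (F1 : Rabs (fst err) <= 55 * e).
  apply Rabs_le_between in H1; apply Rabs_le_between in H3.
  unfold err, D, Z; rewrite Ew; unfold Cminus, Cplus, Copp, Cmult, RtoC; cbn [fst snd].
  apply Rabs_le; lra.
assert (F2 : Rabs (snd err) <= 55 * e).
  apply Rabs_le_between in H2; apply Rabs_le_between in H4.
  unfold err, D, Z; rewrite Ew; unfold Cminus, Cplus, Copp, Cmult, RtoC; cbn [fst snd].
  apply Rabs_le; lra.
assert (e0 : 0 <= e) by (apply Rdiv_le_0_compat; lra).
assert (Ce : Cmod err <= 110 * e).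
  apply Rle_trans with (1 := Cmod_2Rmax err).
  assert (sqrt 2 <= 2) by (rewrite <- (sqrt_square 2) at 2 by lra; apply sqrt_le_1_alt; lra).
  assert (Rmax (Rabs (fst err)) (Rabs (snd err)) <= 55 * e) by (apply Rmax_lub; assumption).
  assert (0 <= Rmax (Rabs (fst err)) (Rabs (snd err))).
    apply Rle_trans with (2 := Rmax_l _ _), Rabs_pos.
  replace (110 * e) with (2 * (55 * e)) by ring; apply Rmult_le_compat; lra.
apply Rmult_le_reg_r with (Cmod D); [lra|].
unfold Rdiv; rewrite Rmult_assoc, Rinv_l by lra; nra.
Qed.

(** * The averaged mean square of a Dirichlet polynomial *)

Lemma sum_1_to_prod f g M N :
  sum_1_to f M * sum_1_to g N = sum_1_to (fun m => sum_1_to (fun n => f m * g n) N) M.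
Proof.
rewrite Rmult_comm, <- sum_1_to_scal; apply sum_1_to_ext; intros.
rewrite sum_1_to_scal; ring.
Qed.

Definition Zsq (N : nat) (t : R) := Zcos N t ^ 2 + Zsin N t ^ 2.

Lemma Zsq_nonneg N t : 0 <= Zsq N t.
Proof. unfold Zsq; pose proof (pow2_ge_0 (Zcos N t)); pose proof (pow2_ge_0 (Zsin N t)); lra. Qed.

Definition wt (m n : nat) := / sqrt (INR m) * / sqrt (INR n).

Lemma Zsq_expand N t : Zsq N t =
  sum_1_to (fun m => sum_1_to (fun n => wt m n * cos (t * (ln (INR m) - ln (INR n)))) N) N.
Proof.
unfold Zsq, Zcos, Zsin; simpl pow; rewrite !Rmult_1_r, !sum_1_to_prod, <- sum_1_to_plus.
apply sum_1_to_ext; intros m _; rewrite <- sum_1_to_plus; apply sum_1_to_ext; intros n _.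
rewrite Rmult_minus_distr_l, cos_minus; unfold wt; ring.
Qed.

(** A window of length [Y] summed over [H] translates. With [s = -1] the translated windows can
    cover a given range, with [s = 1] they can be kept inside it; nonnegativity of [Zsq] then gives
    an upper and a lower bound. *)
Definition kern (s : R) (H Y : nat) (th : R) :=
  sum_1_to (fun h => sum_1_to (fun u => cos ((INR u + s * INR h) * th)) Y) H.

Lemma sum_cos_telescope c th Y :
  2 * sin (th / 2) * sum_1_to (fun u => cos (INR u * th + c)) Y =
  sin ((INR Y + 1 / 2) * th + c) - sin (th / 2 + c).
Proof.
induction Y as [|Y IH].
  replace ((INR 0 + 1 / 2) * th + c) with (th / 2 + c) by (simpl; field); simpl sum_1_to; ring.
rewrite sum_1_to_S, Rmult_plus_distr_l, IH; cbv beta.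
replace ((INR (S Y) + 1 / 2) * th + c) with ((INR (S Y) * th + c) + th / 2) by field.
replace ((INR Y + 1 / 2) * th + c) with ((INR (S Y) * th + c) - th / 2) by (rewrite S_INR; field).
set (a := INR (S Y) * th + c); rewrite (sin_plus a), (sin_minus a); ring.
Qed.

Lemma sum_sin_telescope c th Y :
  2 * sin (th / 2) * sum_1_to (fun u => sin (INR u * th + c)) Y =
  cos (th / 2 + c) - cos ((INR Y + 1 / 2) * th + c).
Proof.
induction Y as [|Y IH].
  replace ((INR 0 + 1 / 2) * th + c) with (th / 2 + c) by (simpl; field); simpl sum_1_to; ring.
rewrite sum_1_to_S, Rmult_plus_distr_l, IH; cbv beta.
replace ((INR (S Y) + 1 / 2) * th + c) with ((INR (S Y) * th + c) + th / 2) by field.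
replace ((INR Y + 1 / 2) * th + c) with ((INR (S Y) * th + c) - th / 2) by (rewrite S_INR; field).
set (a := INR (S Y) * th + c); rewrite (cos_plus a), (cos_minus a); ring.
Qed.

Lemma kern_trivial s H Y th : Rabs (kern s H Y th) <= INR H * INR Y.
Proof.
unfold kern; apply Rle_trans with (1 := sum_1_to_abs _ _).
rewrite <- sum_1_to_const; apply sum_1_to_le; intros h _.
apply Rle_trans with (1 := sum_1_to_abs _ _).
rewrite <- (Rmult_1_r (INR Y)), <- sum_1_to_const; apply sum_1_to_le; intros u _.
apply Rabs_le, COS_bound.
Qed.

(** Each of the two sums telescopes against [2 sin (th / 2)] up to sign, leaving four cosines. The
    square of the sine is the gain from averaging: a single window would give only the first
    power. *)
Lemma kern_sin2 s H Y th : (s = 1 \/ s = -1) ->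
  Rabs (kern s H Y th) * sin (th / 2) ^ 2 <= 1.
Proof.
intros Hs.
assert (E : 2 * sin (s * th / 2) * (2 * sin (th / 2) * kern s H Y th) =
  (cos (s * th / 2 + (INR Y + 1 / 2) * th) - cos ((INR H + 1 / 2) * (s * th) + (INR Y + 1 / 2) * th))
  - (cos (s * th / 2 + th / 2) - cos ((INR H + 1 / 2) * (s * th) + th / 2))).
  rewrite <- !sum_sin_telescope, <- Rmult_minus_distr_l, <- sum_1_to_minus; f_equal.
  unfold kern; rewrite <- sum_1_to_scal; apply sum_1_to_ext; intros h _.
  rewrite (sum_1_to_ext _ (fun u => cos (INR u * th + INR h * (s * th)))).
    rewrite sum_cos_telescope; f_equal; apply f_equal; ring.
  intros u _; f_equal; ring.
assert (Es : Rabs (sin (s * th / 2)) = Rabs (sin (th / 2))).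
  destruct Hs as [->| ->]; [f_equal; f_equal; field|].
  replace (-1 * th / 2) with (- (th / 2)) by field; rewrite sin_neg; apply Rabs_Ropp.
apply (f_equal Rabs) in E.
rewrite !Rabs_mult, Es, (Rabs_pos_eq 2) in E by lra.
assert (B : Rabs (sin (th / 2)) * Rabs (sin (th / 2)) = sin (th / 2) ^ 2).
  rewrite <- Rabs_mult; simpl; rewrite Rmult_1_r; apply Rabs_pos_eq; nra.
match type of E with _ = Rabs ?X => assert (Rabs X <= 4) end.
  pose proof (COS_bound (s * th / 2 + (INR Y + 1 / 2) * th)).
  pose proof (COS_bound ((INR H + 1 / 2) * (s * th) + (INR Y + 1 / 2) * th)).
  pose proof (COS_bound (s * th / 2 + th / 2)).
  pose proof (COS_bound ((INR H + 1 / 2) * (s * th) + th / 2)).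
  apply Rabs_le; lra.
rewrite <- B; nra.
Qed.

Lemma kern_even s H Y th : kern s H Y (- th) = kern s H Y th.
Proof.
unfold kern; apply sum_1_to_ext; intros h _; apply sum_1_to_ext; intros u _.
rewrite <- cos_neg; f_equal; ring.
Qed.

Lemma kern_0 s H Y : kern s H Y 0 = INR H * INR Y.
Proof.
unfold kern; rewrite <- sum_1_to_const; apply sum_1_to_ext; intros h _.
rewrite <- (Rmult_1_r (INR Y)), <- sum_1_to_const; apply sum_1_to_ext; intros u _.
now rewrite Rmult_0_r, cos_0.
Qed.

Lemma averaged_Zsq_expand s H Y N :
  sum_1_to (fun h => sum_1_to (fun u => Zsq N (INR u + s * INR h)) Y) H =
  sum_1_to (fun m => sum_1_to (fun n => wt m n * kern s H Y (ln (INR m) - ln (INR n))) N) N.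
Proof.
unfold kern.
rewrite (sum_1_to_ext _ (fun h => sum_1_to (fun m => sum_1_to (fun n =>
   wt m n * sum_1_to (fun u => cos ((INR u + s * INR h) * (ln (INR m) - ln (INR n)))) Y) N) N)).
2: { intros h _.
  rewrite (sum_1_to_ext _ (fun u => sum_1_to (fun m => sum_1_to (fun n =>
    wt m n * cos ((INR u + s * INR h) * (ln (INR m) - ln (INR n)))) N) N)).
    rewrite sum_1_to_swap; apply sum_1_to_ext; intros m _.
    rewrite sum_1_to_swap; apply sum_1_to_ext; intros n _; apply sum_1_to_scal.
  intros u _; apply Zsq_expand. }
rewrite sum_1_to_swap; apply sum_1_to_ext; intros m _.
rewrite sum_1_to_swap; apply sum_1_to_ext; intros n _; apply sum_1_to_scal.
Qed.

(* A pole-free majorant of [min 1 (c / d ^ 2)], up to a factor 2. *)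
Definition bump (c d : R) := c / (c + d ^ 2).

Lemma bump_bounds c d : 0 < c -> 0 <= bump c d <= 1.
Proof.
intros Hc; unfold bump; pose proof (pow2_ge_0 d); split.
  apply Rdiv_le_0_compat; lra.
apply Rmult_le_reg_r with (c + d ^ 2); [lra|]; field_simplify; lra.
Qed.

Lemma bump_majorant K M c d : 0 < c -> K <= M -> K * d ^ 2 <= M * c -> K <= 2 * M * bump c d.
Proof.
intros Hc H1 H2; pose proof (pow2_ge_0 d).
apply Rmult_le_reg_r with (c + d ^ 2); [lra|].
unfold bump; replace (2 * M * (c / (c + d ^ 2)) * (c + d ^ 2)) with (2 * M * c) by (field; lra).
nra.
Qed.

Lemma bump_far c d : 0 < c -> 1 / 2 <= Rabs d -> bump c d <= 5 * c * / (1 + d ^ 2).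
Proof.
intros Hc Hd; unfold bump.
assert (H : 1 / 4 <= d ^ 2).
  rewrite <- (pow2_abs d); pose proof (Rabs_pos d); simpl; nra.
apply Rmult_le_reg_r with ((c + d ^ 2) * (1 + d ^ 2)); [nra|].
field_simplify; [|nra..]. nra.
Qed.

(** Majorizing by increments of the arctangent makes the sum in [sum_inv_quadratic] telescope,
    uniformly in its real centre. *)
Lemma atan_step x : / (1 + x ^ 2) <= 3 * (atan (x + 1) - atan x).
Proof.
destruct (MVT_cor2 atan (fun z => / (1 + z ^ 2)) x (x + 1) ltac:(lra)) as [z [E Hz]].
  intros c _; exact (derivable_pt_lim_atan c).
rewrite E; replace (x + 1 - x) with 1 by ring; rewrite Rmult_1_r.
apply Rmult_le_reg_r with ((1 + x ^ 2) * (1 + z ^ 2)); [nra|].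
field_simplify; [|nra..].
assert (z ^ 2 <= 2 + 3 * x ^ 2).
  assert (Rabs z <= Rabs x + 1) by (unfold Rabs; destruct (Rcase_abs z), (Rcase_abs x); lra).
  rewrite <- (pow2_abs z), <- (pow2_abs x); pose proof (Rabs_pos z); pose proof (Rabs_pos x).
  assert (Rabs z ^ 2 <= (Rabs x + 1) ^ 2) by (apply pow_incr; lra).
  pose proof (pow2_ge_0 (Rabs x - 1)); nra.
lra.
Qed.

Lemma sum_inv_quadratic y N : sum_1_to (fun m => / (1 + (INR m - y) ^ 2)) N <= 12.
Proof.
assert (H : sum_1_to (fun m => / (1 + (INR m - y) ^ 2)) N <= 3 * (atan (INR N + 1 - y) - atan (1 - y))).
  induction N as [|N IH]; [simpl; replace (0 + 1 - y) with (1 - y) by ring; lra|].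
  rewrite sum_1_to_S; pose proof (atan_step (INR (S N) - y)).
  replace (INR (S N) - y + 1) with (INR (S N) + 1 - y) in H by ring.
  replace (INR N + 1 - y) with (INR (S N) - y) in IH by (rewrite S_INR; ring).
  lra.
pose proof (atan_bound (INR N + 1 - y)); pose proof (atan_bound (1 - y)); pose proof PI_4; lra.
Qed.

Definition nearest (y : R) := floor_nat (y + 1 / 2).

Lemma nearest_far y m : 0 <= y -> m <> nearest y -> 1 / 2 <= Rabs (INR m - y).
Proof.
intros Hy Hm; pose proof (floor_nat_spec (y + 1 / 2) ltac:(lra)) as H; fold (nearest y) in H.
destruct (Nat.lt_total m (nearest y)) as [L|[L|L]]; [|contradiction|].
- assert (INR (S m) <= INR (nearest y)) by (apply le_INR; lia); rewrite S_INR in H0.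
  rewrite Rabs_left1; lra.
- assert (INR (S (nearest y)) <= INR m) by (apply le_INR; lia); rewrite S_INR in H0.
  rewrite Rabs_pos_eq; lra.
Qed.

Lemma sum_bump_except y c N : 0 <= y -> 0 < c ->
  sum_1_to (fun m => if Nat.eq_dec m (nearest y) then 0 else bump c (INR m - y)) N <= 60 * c.
Proof.
intros Hy Hc; apply Rle_trans with (sum_1_to (fun m => 5 * c * / (1 + (INR m - y) ^ 2)) N).
  apply sum_1_to_le; intros m _; destruct (Nat.eq_dec m (nearest y)) as [E|E].
    apply Rmult_le_pos; [lra|]; left; apply Rinv_0_lt_compat; pose proof (pow2_ge_0 (INR m - y)); lra.
  apply bump_far; [exact Hc | now apply nearest_far].
rewrite sum_1_to_scal; pose proof (sum_inv_quadratic y N).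
replace (60 * c) with (5 * c * 12) by ring; apply Rmult_le_compat_l; lra.
Qed.

Lemma sum_1_to_single m0 v N : 0 <= v ->
  sum_1_to (fun m => if Nat.eq_dec m m0 then v else 0) N <= v.
Proof.
intros Hv.
assert (H : sum_1_to (fun m => if Nat.eq_dec m m0 then v else 0) N <= if le_dec m0 N then v else 0).
  induction N as [|N IH]; [simpl; destruct (le_dec m0 0); lra|].
  rewrite sum_1_to_S; destruct (Nat.eq_dec (S N) m0), (le_dec m0 N), (le_dec m0 (S N)); try lia; lra.
destruct (le_dec m0 N); lra.
Qed.

Lemma sum_bump y c N : 0 <= y -> 0 < c ->
  sum_1_to (fun m => bump c (INR m - y)) N <= bump c (INR (nearest y) - y) + 60 * c.
Proof.
intros Hy Hc; pose proof (sum_bump_except y c N Hy Hc) as H1.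
pose proof (sum_1_to_single (nearest y) _ N (proj1 (bump_bounds c (INR (nearest y) - y) Hc))) as H2.
apply Rle_trans with (2 := Rplus_le_compat _ _ _ _ H2 H1).
rewrite <- sum_1_to_plus; apply sum_1_to_le; intros m _.
destruct (Nat.eq_dec m (nearest y)) as [->|E]; lra.
Qed.

Definition harmonic (N : nat) := sum_1_to (fun n => / INR n) N.

Lemma harmonic_bounds N : (1 <= N)%nat -> ln (INR N) <= harmonic N <= 1 + ln (INR N).
Proof.
intros HN.
(* The induction step for the lower bound works with [ln (N + 1)], not with [ln N]. *)
enough (H : ln (INR (S N)) <= harmonic N <= 1 + ln (INR N)).
  assert (0 < INR N) by (apply lt_0_INR; lia).
  assert (ln (INR N) <= ln (INR (S N))) by (apply ln_le; [assumption | rewrite S_INR; lra]).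
  lra.
induction HN as [|N HN IH].
  unfold harmonic; simpl; pose proof (ln_le_sub1 (1 + 1) ltac:(lra)).
  rewrite ln_1, Rinv_1; lra.
unfold harmonic in *; rewrite sum_1_to_S.
pose proof (lstep_bounds N HN) as [H1 _]; pose proof (lstep_bounds (S N) ltac:(lia)) as [_ H2].
unfold lstep in *; rewrite <- S_INR in H1; lra.
Qed.

Lemma sum_from_ge_const f A n c : (forall i, (A <= i < A + n)%nat -> c <= f i) ->
  INR n * c <= sum_from f A n.
Proof.
induction n as [|n IH]; intros H; [simpl; lra|].
rewrite S_INR; simpl sum_from.
pose proof (H (A + n)%nat ltac:(lia)); pose proof (IH ltac:(intros; apply H; lia)); lra.
Qed.

(** Each marked [n] is preceded by [Q - 1] unmarked integers, and [1 / n] is at most the mean of the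
    [1 / i] over the [Q] integers ending at [n]. These blocks are disjoint. *)
Lemma sum_spaced (bd : nat -> bool) (Q N : nat) : (1 <= Q)%nat ->
  (forall n, bd n = true -> (Q < n)%nat) ->
  (forall n n', bd n = true -> bd n' = true -> (n < n')%nat -> (Q < n' - n)%nat) ->
  sum_1_to (fun n => if bd n then / INR n else 0) N <= harmonic N / INR Q.
Proof.
intros HQ H1 H2.
assert (Q0 : 0 < INR Q) by (apply lt_0_INR; lia).
assert (mono : forall M, harmonic M / INR Q <= harmonic (S M) / INR Q).
  intros M; apply Rmult_le_compat_r; [left; now apply Rinv_0_lt_compat|].
  unfold harmonic; rewrite sum_1_to_S.
  assert (0 < / INR (S M)) by (apply Rinv_0_lt_compat, lt_0_INR; lia); lra.
induction N as [N IH] using lt_wf_ind; destruct N as [|N].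
  unfold harmonic; simpl; unfold Rdiv; lra.
rewrite sum_1_to_S; destruct (bd (S N)) eqn:B.
2: { pose proof (IH N ltac:(lia)); pose proof (mono N); lra. }
pose proof (H1 _ B) as HB.
assert (E : S N = (S N - Q + Q)%nat) by lia; set (M := (S N - Q)%nat) in *.
assert (Z : sum_1_to (fun n => if bd n then / INR n else 0) N = sum_1_to (fun n => if bd n then /
    INR n else 0) M).
  replace N with (M + (N - M))%nat by lia; rewrite sum_1_to_split.
  rewrite (sum_from_ext _ (fun _ => 0 * 0 + 0 * 0)), (sum_from_lin 0 0 (fun _ => 0) (fun _ => 0));
      [ring|].
  intros i Hi; destruct (bd i) eqn:Bi; [|ring].
  pose proof (H2 i (S N) Bi B ltac:(lia)); lia.
rewrite Z; apply Rle_trans with (harmonic M / INR Q + / INR (S N)).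
  apply Rplus_le_compat_r, IH; lia.
assert (INR Q * / INR (S N) <= sum_from (fun n => / INR n) (S M) Q).
  apply sum_from_ge_const; intros i Hi; apply Rinv_le_contravar; [apply lt_0_INR; lia | apply
      le_INR; lia].
unfold harmonic at 2; rewrite E at 2; rewrite sum_1_to_split; fold (harmonic M).
unfold Rdiv; rewrite Rmult_plus_distr_r; apply Rplus_le_compat_l.
apply Rmult_le_reg_l with (INR Q); [exact Q0|].
replace (INR Q * (sum_from (fun n => / INR n) (S M) Q * / INR Q)) with (sum_from (fun n => / INR n)
    (S M) Q) by (field; lra).
exact H.
Qed.

Lemma count_le X N : 0 <= X -> sum_1_to (fun n => if Rle_dec (INR n) X then 1 else 0) N <= X.
Proof.
intros HX.
assert (H : sum_1_to (fun n => if Rle_dec (INR n) X then 1 else 0) N <= Rmin (INR N) X).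
  induction N as [|N IH]; [simpl; apply Rmin_glb; lra|].
  rewrite sum_1_to_S; destruct (Rle_dec (INR (S N)) X) as [L|L]; rewrite S_INR in *.
  - rewrite (Rmin_left (INR N)) in IH by lra; rewrite Rmin_left by lra; lra.
  - rewrite Rplus_0_r; apply Rle_trans with (1 := IH), Rle_min_compat_r; lra.
pose proof (Rmin_r (INR N) X); lra.
Qed.

Lemma sum_n_le X N : 0 <= X -> sum_1_to (fun n => if Rle_dec (INR n) X then INR n else 0) N <= X * X.
Proof.
intros HX; apply Rle_trans with (sum_1_to (fun n => X * if Rle_dec (INR n) X then 1 else 0) N).
  apply sum_1_to_le; intros n _; destruct (Rle_dec (INR n) X); lra.
rewrite sum_1_to_scal; apply Rmult_le_compat_l; [exact HX | now apply count_le].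
Qed.

(** The bump is small for [n] below [1 / a], so the harmonic sum effectively starts there and costs
    [ln (a X)] instead of [ln X]. Termwise, the summand is at most [2 a / (1 + a n)], which an
    increment of [2 ln (1 + a n)] dominates. *)
Lemma sum_saturation a X N : 0 < a -> 0 <= X ->
  sum_1_to (fun n => if Rle_dec (INR n) X then / INR n * bump ((a * INR n) ^ 2) 1 else 0) N
  <= 2 * ln (1 + a * X).
Proof.
intros Ha HX.
assert (H : sum_1_to (fun n => if Rle_dec (INR n) X then / INR n * bump ((a * INR n) ^ 2) 1 else 0) N
   <= 2 * ln (1 + a * Rmin (INR N) X)).
{ induction N as [|N IH].
    simpl; rewrite Rmin_left, Rmult_0_r, Rplus_0_r, ln_1 by lra; lra.
  pose proof (pos_INR N) as PN.
  rewrite sum_1_to_S; destruct (Rle_dec (INR (S N)) X) as [L|L]; rewrite S_INR in *.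
  - rewrite (Rmin_left (INR N)) in IH by lra; rewrite Rmin_left by lra.
    set (n := INR N + 1) in *.
    assert (Hn : 1 <= n) by (unfold n; lra).
    assert (an : 0 < a * n) by (apply Rmult_lt_0_compat; lra).
    assert (E1 : / n * bump ((a * n) ^ 2) 1 <= 2 * (a / (1 + a * n))).
      unfold bump; set (w := a * n) in *.
      replace (/ n * (w ^ 2 / (w ^ 2 + 1 ^ 2))) with (a * (w / (w ^ 2 + 1))) by (unfold w; field;
          split; nra).
      replace (2 * (a / (1 + w))) with (a * (2 / (1 + w))) by (field; lra).
      apply Rmult_le_compat_l; [lra|].
      apply Rmult_le_reg_r with ((w ^ 2 + 1) * (1 + w)); [nra|].
      field_simplify; [|nra..]; nra.
    assert (an1 : 0 <= a * INR N) by (apply Rmult_le_pos; lra).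
    assert (E2 : a / (1 + a * n) <= ln (1 + a * n) - ln (1 + a * INR N)).
      pose proof (ln_le_sub1 ((1 + a * INR N) / (1 + a * n)) ltac:(apply Rdiv_lt_0_compat; lra)) as Hl.
      rewrite ln_div in Hl by lra.
      replace (a / (1 + a * n)) with (- ((1 + a * INR N) / (1 + a * n) - 1)) by (unfold n; field;
          unfold n in *; lra).
      lra.
    lra.
  - rewrite Rplus_0_r; apply Rle_trans with (1 := IH); apply Rmult_le_compat_l; [lra|].
    assert (0 <= Rmin (INR N) X) by (apply Rmin_glb; lra).
    apply ln_le; [nra|]; apply Rplus_le_compat_l, Rmult_le_compat_l; [lra|].
    apply Rle_min_compat_r; lra. }
apply Rle_trans with (1 := H); apply Rmult_le_compat_l; [lra|].
pose proof (Rmin_r (INR N) X).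
assert (0 <= Rmin (INR N) X) by (apply Rmin_glb; [apply pos_INR | lra]).
apply ln_le; nra.
Qed.

(** * Pairs with ratio near [exp (2 PI k)] *)

Definition e2pi (k : nat) := exp (2 * PI * INR k).

Lemma e2pi_ge1 k : 1 <= e2pi k.
Proof.
unfold e2pi; rewrite <- exp_0; apply exp_le_exp; pose proof PI_RGT_0; pose proof (pos_INR k); nra.
Qed.

(** Chosen so that [bump_majorant] applies with [c = curv N U k * n ^ 2], [d = m - n * e2pi k] and
    [M = 2 H N]: [36] comes from [|sin (th / 2)| >= |th| / 6], [exp (2 * PI)] from
    [|exp th - 1| <= exp PI * |th|], and [sqrt U] from [N <= 2 H sqrt U]. *)
Definition curv (N : nat) (U : R) (k : nat) := 36 * exp (2 * PI) * sqrt U * e2pi k ^ 2 / INR N ^ 2.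

Lemma curv_pos N U k : (1 <= N)%nat -> 1 <= U -> 0 < curv N U k.
Proof.
intros HN HU; unfold curv; pose proof (exp_pos (2 * PI)); pose proof (e2pi_ge1 k).
assert (0 < INR N) by (apply lt_0_INR; lia).
assert (0 < sqrt U) by (apply sqrt_lt_R0; lra).
apply Rdiv_lt_0_compat; [|apply pow_lt; lra].
apply Rmult_lt_0_compat; [|apply pow_lt; lra].
apply Rmult_lt_0_compat; [lra|assumption].
Qed.

(** For [m] near [n * e2pi k] the weight [1 / sqrt (m n)] is about [exp (- PI k) / n]. The cutoff
    follows from [m <= N] and [ln (m / n) <= 2 PI k + PI] failing to be exceeded from below by more
    than [PI]; for [k = 0] the diagonal is left out. *)
Definition gterm (N : nat) (U : R) (k n m : nat) :=
  if Nat.eq_dec k 0 then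
    if Nat.eq_dec m n then 0 else
    if Rle_dec (INR n * e2pi k) (exp PI * INR N) then
      exp (- PI * INR k) * / INR n * bump (curv N U k * INR n ^ 2) (INR m - INR n * e2pi k) else 0
  else
    if Rle_dec (INR n * e2pi k) (exp PI * INR N) then
      exp (- PI * INR k) * / INR n * bump (curv N U k * INR n ^ 2) (INR m - INR n * e2pi k) else 0.

Lemma gterm_nonneg N U k n m : (1 <= N)%nat -> (1 <= n)%nat -> 1 <= U -> 0 <= gterm N U k n m.
Proof.
intros HN Hn HU; unfold gterm.
assert (0 < INR n) by (apply lt_0_INR; lia).
assert (B : 0 <= exp (- PI * INR k) * / INR n * bump (curv N U k * INR n ^ 2) (INR m - INR n * e2pi k)).
  apply Rmult_le_pos; [apply Rmult_le_pos; left; [apply exp_pos | now apply Rinv_0_lt_compat]|].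
  apply bump_bounds, Rmult_lt_0_compat; [now apply curv_pos | apply pow_lt; assumption].
destruct (Nat.eq_dec k 0), (Nat.eq_dec m n), (Rle_dec (INR n * e2pi k) (exp PI * INR N)); lra.
Qed.

Lemma sin_add_kPI u k : sin (u + INR k * PI) ^ 2 = sin u ^ 2.
Proof.
induction k as [|k IH]; [simpl INR; now rewrite Rmult_0_l, Rplus_0_r|].
rewrite S_INR; replace (u + (INR k + 1) * PI) with (u + INR k * PI + PI) by ring.
rewrite neg_sin, <- IH; ring.
Qed.

Lemma exp_sub1_bound t : Rabs t <= PI -> Rabs (exp t - 1) <= exp PI * Rabs t.
Proof.
intros Ht; apply Rabs_le_between in Ht.
assert (1 <= exp PI) by (pose proof (exp_ineq1_le PI); pose proof PI_RGT_0; lra).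
destruct (Rle_dec 0 t) as [H0|H0].
- assert (1 <= exp t) by (rewrite <- exp_0; now apply exp_le_exp).
  assert (exp t <= exp PI) by (apply exp_le_exp; lra).
  rewrite !Rabs_pos_eq by lra.
  pose proof (exp_ineq1_le (- t)) as J; rewrite exp_Ropp in J.
  assert (exp t * (1 + - t) <= 1).
    apply Rle_trans with (exp t * / exp t); [apply Rmult_le_compat_l; lra | rewrite Rinv_r; lra].
  nra.
- assert (exp t <= 1) by (rewrite <- exp_0; apply exp_le_exp; lra).
  rewrite !Rabs_left1 by lra; pose proof (exp_ineq1_le t); nra.
Qed.

(* The pair is attached to the [k] for which [ln (m / n)] is closest to [2 PI k]. *)
Lemma pair_bound N U s H Y n m : (s = 1 \/ s = -1) -> (1 <= n < m)%nat -> (m <= N)%nat -> 1 <= U ->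
  (Y <= 2 * N)%nat -> INR N <= 2 * INR H * sqrt U ->
  exists k, (k <= N)%nat /\
    wt m n * Rabs (kern s H Y (ln (INR m) - ln (INR n))) <=
      exp (PI / 2) * (4 * INR H * INR N) * gterm N U k n m.
Proof.
intros Hs Hnm HmN HU HY HH.
assert (Rn : 1 <= INR n) by (apply (le_INR 1); lia).
assert (Rm : INR n <= INR m) by (apply le_INR; lia).
assert (RN : INR m <= INR N) by (apply le_INR; lia).
pose proof PI_RGT_0 as P0; pose proof PI2_3_2 as P3; unfold PI2 in P3; pose proof PI_4 as P4.
set (x := ln (INR m) - ln (INR n)).
assert (x0 : 0 <= x) by (assert (ln (INR n) <= ln (INR m)) by (apply ln_le; lra); unfold x; lra).
assert (xN : x <= INR N).
  assert (0 <= ln (INR n)) by (rewrite <- ln_1; apply ln_le; lra).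
  pose proof (ln_le_sub1 (INR m) ltac:(lra)); unfold x; lra.
assert (xp : 0 <= x / (2 * PI)) by (apply Rdiv_le_0_compat; lra).
set (k := nearest (x / (2 * PI))); exists k.
pose proof (floor_nat_spec (x / (2 * PI) + 1 / 2) ltac:(lra)) as Hk; fold (nearest (x / (2 * PI)))
    in Hk; fold k in Hk.
set (th := x - 2 * PI * INR k).
assert (Hth : - PI <= th <= PI).
  assert (E : x = 2 * PI * (x / (2 * PI))) by (field; lra).
  unfold th; nra.
assert (kN : (k <= N)%nat).
  apply INR_le; assert (x / (2 * PI) <= x / 2).
    unfold Rdiv; apply Rmult_le_compat_l; [lra|]; apply Rinv_le_contravar; lra.
  lra.
split; [exact kN|].
set (b := e2pi k).
assert (b1 : 1 <= b) by apply e2pi_ge1.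
assert (Em : INR m = INR n * b * exp th).
  unfold b, e2pi; rewrite Rmult_assoc, <- exp_plus; unfold th, x.
  replace (2 * PI * INR k + (ln (INR m) - ln (INR n) - 2 * PI * INR k)) with (ln (INR m) - ln (INR
      n)) by ring.
  unfold Rminus; rewrite exp_plus, exp_Ropp, !exp_ln by lra; field; lra.
assert (nb : INR n * b <= exp PI * INR m).
  assert (exp (- PI) <= exp th) by (apply exp_le_exp; lra).
  pose proof (exp_pos PI).
  assert (1 <= exp PI * exp th).
    rewrite <- exp_plus, <- exp_0; apply exp_le_exp; lra.
  rewrite Em; replace (exp PI * (INR n * b * exp th)) with (INR n * b * (exp PI * exp th)) by ring.
  assert (0 < INR n * b) by nra; nra.
assert (nbN : INR n * b <= exp PI * INR N).
  apply Rle_trans with (1 := nb), Rmult_le_compat_l; [left; apply exp_pos | exact RN].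
set (K := Rabs (kern s H Y x)).
assert (K0 : 0 <= K) by apply Rabs_pos.
assert (K1 : K <= 2 * INR H * INR N).
  apply Rle_trans with (1 := kern_trivial s H Y x).
  apply le_INR in HY; rewrite mult_INR in HY; simpl INR in HY.
  pose proof (pos_INR H); nra.
assert (Hsin : (th / 6) ^ 2 <= sin (x / 2) ^ 2).
  replace (x / 2) with (th / 2 + INR k * PI) by (unfold th; field).
  rewrite sin_add_kPI.
  destruct (Rle_dec 0 th) as [T0|T0].
  - pose proof (sin_ge_third (th / 2) ltac:(lra)); apply pow_incr; lra.
  - pose proof (sin_ge_third (- (th / 2)) ltac:(lra)) as T1; rewrite sin_neg in T1.
    replace (sin (th / 2) ^ 2) with ((- sin (th / 2)) ^ 2) by ring.
    replace ((th / 6) ^ 2) with ((- (th / 6)) ^ 2) by ring.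
    apply pow_incr; lra.
set (d := INR m - INR n * b).
assert (Hd : d ^ 2 <= exp (2 * PI) * (INR n * b) ^ 2 * th ^ 2).
  assert (Ed : d = INR n * b * (exp th - 1)) by (unfold d; rewrite Em; ring).
  pose proof (exp_sub1_bound th ltac:(apply Rabs_le; lra)) as T.
  rewrite Ed, Rpow_mult_distr, <- (pow2_abs (exp th - 1)).
  apply Rle_trans with ((INR n * b) ^ 2 * (exp PI * Rabs th) ^ 2).
    apply Rmult_le_compat_l; [apply pow2_ge_0 | apply pow_incr; split; [apply Rabs_pos | exact T]].
  rewrite (Rpow_mult_distr (exp PI)), pow2_abs, exp_pow; simpl INR; right; ring_simplify.
  replace (1 + 1) with 2 by ring; ring.
set (c := curv N U k * INR n ^ 2).
assert (c0 : 0 < c) by (apply Rmult_lt_0_compat; [apply curv_pos; [lia|lra] | apply pow_lt; lra]).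
assert (sU : 0 < sqrt U) by (apply sqrt_lt_R0; lra).
assert (E2 : 0 < exp (2 * PI)) by apply exp_pos.
assert (nb0 : 0 < (INR n * b) ^ 2) by (apply pow_lt; nra).
assert (Kd : K * d ^ 2 <= 2 * INR H * INR N * c).
  pose proof (kern_sin2 s H Y x Hs) as K2; fold K in K2.
  apply Rle_trans with (36 * exp (2 * PI) * (INR n * b) ^ 2).
  - apply Rle_trans with (K * (exp (2 * PI) * (INR n * b) ^ 2 * th ^ 2)).
      apply Rmult_le_compat_l; [exact K0 | exact Hd].
    replace (K * (exp (2 * PI) * (INR n * b) ^ 2 * th ^ 2)) with
      (36 * exp (2 * PI) * (INR n * b) ^ 2 * (K * (th / 6) ^ 2)) by field.
    assert (K * (th / 6) ^ 2 <= 1).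
      apply Rle_trans with (2 := K2), Rmult_le_compat_l; assumption.
    rewrite <- (Rmult_1_r (36 * exp (2 * PI) * (INR n * b) ^ 2)) at 2.
    apply Rmult_le_compat_l; [|assumption].
    apply Rmult_le_pos; [lra | left; exact nb0].
  - unfold c, curv; fold b.
    replace (2 * INR H * INR N * (36 * exp (2 * PI) * sqrt U * b ^ 2 / INR N ^ 2 * INR n ^ 2)) with
      (36 * exp (2 * PI) * (INR n * b) ^ 2 * (2 * INR H * sqrt U / INR N)) by (field; lra).
    rewrite <- (Rmult_1_r (36 * exp (2 * PI) * (INR n * b) ^ 2)) at 1.
    apply Rmult_le_compat_l; [apply Rmult_le_pos; [lra | left; exact nb0]|].
    apply Rmult_le_reg_r with (INR N); [lra|]; field_simplify; lra.
pose proof (bump_majorant K (2 * INR H * INR N) c d c0 K1 Kd) as KB.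
(* Since [th >= - PI], one has [m >= n exp (2 PI k - PI)]; this is the origin of the factor
   [exp (PI / 2)]. *)
assert (W : wt m n <= exp (PI / 2) * (exp (- PI * INR k) * / INR n)).
{ unfold wt.
  assert (sn : 0 < sqrt (INR n)) by (apply sqrt_lt_R0; lra).
  set (v := exp (PI * INR k - PI / 2)).
  assert (v0 : 0 < v) by apply exp_pos.
  assert (Hv : v * v = b * exp (- PI)).
    unfold v, b, e2pi; rewrite <- !exp_plus; f_equal; field.
  assert (Hm : sqrt (INR n) * v <= sqrt (INR m)).
    apply Rsqr_incr_0_var; [|apply sqrt_pos].
    rewrite Rsqr_sqrt by lra; rewrite Rsqr_mult, Rsqr_sqrt by lra; unfold Rsqr; rewrite Hv.
    pose proof (exp_pos PI); rewrite exp_Ropp.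
    apply Rmult_le_reg_r with (exp PI); [assumption|].
    replace (INR n * (b * / exp PI) * exp PI) with (INR n * b) by (field; lra); lra.
  apply Rle_trans with (/ (sqrt (INR n) * v) * / sqrt (INR n)).
    apply Rmult_le_compat_r; [left; now apply Rinv_0_lt_compat|].
    apply Rinv_le_contravar; [now apply Rmult_lt_0_compat | exact Hm].
  right; rewrite <- (sqrt_sqrt (INR n)) at 3 by lra.
  assert (Ev : exp (PI / 2) * exp (- PI * INR k) = / v).
    unfold v; rewrite <- exp_Ropp, <- exp_plus; f_equal; field.
  rewrite <- Rmult_assoc, Ev; field; split; lra. }
assert (G : gterm N U k n m = exp (- PI * INR k) * / INR n * bump c d).
  unfold gterm; fold b; fold c; fold d.
  destruct (Rle_dec (INR n * b) (exp PI * INR N)) as [L|L]; [|contradiction].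
  destruct (Nat.eq_dec k 0), (Nat.eq_dec m n); try lia; reflexivity.
rewrite G; fold K.
apply Rle_trans with ((exp (PI / 2) * (exp (- PI * INR k) * / INR n)) * (2 * (2 * INR H * INR N) *
    bump c d)).
  apply Rmult_le_compat; [|exact K0|exact W|exact KB].
  unfold wt; apply Rmult_le_pos; left; apply Rinv_0_lt_compat, sqrt_lt_R0; lra.
right; ring.
Qed.

Lemma bump_antitone c d d' : 0 < c -> 0 <= d' <= d -> bump c d <= bump c d'.
Proof.
intros Hc Hd; unfold bump, Rdiv; apply Rmult_le_compat_l; [lra|].
assert (d' ^ 2 <= d ^ 2) by (apply pow_incr; lra).
pose proof (pow2_ge_0 d'); apply Rinv_le_contravar; lra.
Qed.

Definition dist_nat (y : R) := Rabs (INR (nearest y) - y).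

Definition far_from_integers (U : R) := forall k q p : nat, (1 <= k)%nat -> (1 <= q)%nat ->
  INR k <= ln U -> INR q <= U -> exp (- sqrt U) <= Rabs (INR q * e2pi k - INR p).

(** The [n] with [n * e2pi k] within [eps / 2] of an integer are sparse: two of them at distance
    [q <= U] would give an integer within [eps] of [q * e2pi k]. They contribute at most [2 sqrt U].
    For all others the distance is at least [eps / 2], and [sum_saturation] gives twice
    [22 sqrt U]. *)
Lemma near_sum_bound N U k : (1 <= N)%nat -> 3 <= U -> U = ln (INR N) ->
  far_from_integers U -> (1 <= k)%nat -> INR k <= ln U ->
  sum_1_to (fun n => if Rle_dec (INR n) (exp PI * INR N / e2pi k) then
     / INR n * bump (curv N U k * INR n ^ 2) (dist_nat (INR n * e2pi k)) else 0) N
  <= 46 * sqrt U.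
Proof.
intros HN HU EU HD Hk HkU.
pose proof (e2pi_ge1 k) as b1; set (b := e2pi k) in *.
set (X := exp PI * INR N / b); set (eps := exp (- sqrt U)).
assert (N1 : 1 <= INR N) by (apply (le_INR 1); exact HN).
assert (eps0 : 0 < eps) by apply exp_pos.
assert (sU : 1 <= sqrt U) by (rewrite <- sqrt_1; apply sqrt_le_1_alt; lra).
assert (eps1 : eps < 1) by (unfold eps; rewrite <- exp_0; apply exp_increasing; lra).
assert (X0 : 0 <= X).
  apply Rdiv_le_0_compat; [apply Rmult_le_pos; [left; apply exp_pos | lra] | lra].
pose (bd := fun n => if Nat.eq_dec n 0 then false else
   if Rlt_dec (dist_nat (INR n * b)) (eps / 2) then true else false).
assert (bdE : forall n, bd n = true -> (1 <= n)%nat /\ dist_nat (INR n * b) < eps / 2).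
  intros n; unfold bd; destruct (Nat.eq_dec n 0); [discriminate|].
  destruct (Rlt_dec _ _); [intros _; split; [lia | assumption] | discriminate].
set (Q := floor_nat U).
pose proof (floor_nat_spec U ltac:(lra)) as HQ; fold Q in HQ.
assert (Q1 : (1 <= Q)%nat) by (apply INR_le; simpl; lra).
assert (Bad : sum_1_to (fun n => if bd n then / INR n else 0) N <= 2 * sqrt U).
{ apply Rle_trans with (harmonic N / INR Q).
  - apply sum_spaced; [exact Q1| |].
    + intros n Bn; destruct (bdE n Bn) as [n1 Hn].
      destruct (Nat.lt_ge_cases Q n) as [L|L]; [exact L|exfalso].
      apply le_INR in L.
      pose proof (HD k n (nearest (INR n * b)) Hk n1 HkU ltac:(lra)) as D; fold b eps in D.
      unfold dist_nat in Hn; rewrite Rabs_minus_sym in Hn; lra.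
    + intros n n' Bn Bn' Hnn'; destruct (bdE n Bn) as [n1 Hn], (bdE n' Bn') as [n1' Hn'].
      destruct (Nat.lt_ge_cases Q (n' - n)) as [L|L]; [exact L|exfalso].
      assert (R1 : 1 <= INR (n' - n)) by (apply (le_INR 1); lia).
      apply le_INR in L; unfold dist_nat in Hn, Hn'.
      set (m := nearest (INR n * b)) in *; set (m' := nearest (INR n' * b)) in *.
      apply Rabs_def2 in Hn; apply Rabs_def2 in Hn'.
      rewrite minus_INR in L, R1 by lia.
      assert (Hm : (m <= m')%nat).
        apply INR_le.
        assert (1 * 1 <= (INR n' - INR n) * b) by (apply Rmult_le_compat; lra); lra.
      pose proof (HD k (n' - n)%nat (m' - m)%nat Hk ltac:(lia) HkU) as D; fold b eps in D.
      rewrite !minus_INR in D by lia; specialize (D ltac:(lra)).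
      assert (Rabs ((INR n' - INR n) * b - (INR m' - INR m)) < eps) by (apply Rabs_def1; lra).
      lra.
  - pose proof (harmonic_bounds N HN) as [_ H]; rewrite <- EU in H.
    apply Rmult_le_reg_r with (INR Q); [lra|].
    unfold Rdiv; rewrite Rmult_assoc, Rinv_l by lra.
    assert (2 * 1 * INR Q <= 2 * sqrt U * INR Q) by (apply Rmult_le_compat_r; lra); lra. }
(* Chosen so that [curv N U k * n ^ 2 = (a n) ^ 2 * (eps / 2) ^ 2], which rescales a bump at
   distance [eps / 2] to distance 1. In [a * X] the factors [b] and [N] cancel, leaving
   [exp (sqrt U)] times a power of [U]. *)
set (a := 12 * exp PI * sqrt (sqrt U) * b / INR N * exp (sqrt U)).
assert (ssU : 1 <= sqrt (sqrt U)) by (rewrite <- sqrt_1; apply sqrt_le_1_alt; lra).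
pose proof (exp_pos PI) as EP; pose proof (exp_pos (sqrt U)) as EsU.
assert (a0 : 0 < a).
  unfold a; apply Rmult_lt_0_compat; [|exact EsU]; apply Rdiv_lt_0_compat; [|lra].
  apply Rmult_lt_0_compat; [apply Rmult_lt_0_compat; lra | lra].
assert (Ea : forall n, curv N U k * n ^ 2 = (a * n) ^ 2 * (eps / 2) ^ 2).
  intros n; unfold curv, a, eps; fold b; rewrite exp_Ropp.
  replace (exp (2 * PI)) with (exp PI * exp PI) by (rewrite <- exp_plus; f_equal; ring).
  rewrite <- (sqrt_sqrt (sqrt U)) at 1 by lra; field; lra.
assert (Good := sum_saturation a X N a0 X0).
assert (Hln : ln (1 + a * X) <= 22 * sqrt U).
{ assert (EaX : a * X = 12 * exp PI * exp PI * sqrt (sqrt U) * exp (sqrt U)) by (unfold a, X; field; lra).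
  assert (sqrt (sqrt U) <= exp (sqrt U)).
    pose proof (exp_ineq1_le (sqrt U)).
    assert (sqrt (sqrt U) <= sqrt U).
      rewrite <- (sqrt_sqrt (sqrt U)) at 2 by lra; nra.
    lra.
  apply Rle_trans with (ln (exp (22 * sqrt U))); [|rewrite ln_exp; lra].
  assert (Rmult 12 (exp PI) * exp PI <= exp (12 + 8) - 1).
    pose proof PI_4.
    assert (exp PI * exp PI <= exp 8) by (rewrite <- exp_plus; apply exp_le_exp; lra).
    rewrite exp_plus; pose proof (exp_ineq1_le 12); pose proof (exp_ineq1_le 8); nra.
  assert (0 < a * X).
    rewrite EaX; repeat (apply Rmult_lt_0_compat; try lra).
  apply ln_le; [lra|].
  apply Rle_trans with (exp (12 + 8) * (exp (sqrt U) * exp (sqrt U))).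
    rewrite EaX; assert (1 <= exp (sqrt U)) by (pose proof (exp_ineq1_le (sqrt U)); lra).
    assert (sqrt (sqrt U) * exp (sqrt U) <= exp (sqrt U) * exp (sqrt U)) by (apply
        Rmult_le_compat_r; lra).
    assert (1 <= exp (sqrt U) * exp (sqrt U)) by nra.
    assert (12 * exp PI * exp PI * (sqrt (sqrt U) * exp (sqrt U)) <= (exp (12 + 8) - 1) * (exp
        (sqrt U) * exp (sqrt U))).
      apply Rmult_le_compat; [repeat apply Rmult_le_pos; lra | apply Rmult_le_pos; lra | assumption
          | assumption].
    lra.
  rewrite <- !exp_plus; apply exp_le_exp; lra. }
apply Rle_trans with (2 * sqrt U + 2 * ln (1 + a * X)); [|lra].
apply Rle_trans with (2 := Rplus_le_compat _ _ _ _ Bad Good).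
rewrite <- sum_1_to_plus; apply sum_1_to_le; intros n [Hn _].
assert (n0 : 0 < INR n) by (apply lt_0_INR; lia).
assert (i0 : 0 < / INR n) by now apply Rinv_0_lt_compat.
assert (c0 : 0 < curv N U k * INR n ^ 2) by (apply Rmult_lt_0_compat; [apply curv_pos; [lia|lra] |
    apply pow_lt; lra]).
assert (an0 : 0 < (a * INR n) ^ 2) by (apply pow_lt, Rmult_lt_0_compat; lra).
fold X; destruct (Rle_dec (INR n) X) as [L|L].
2: { destruct (bd n); lra. }
destruct (bd n) eqn:B.
- pose proof (bump_bounds _ (dist_nat (INR n * b)) c0); pose proof (bump_bounds _ 1 an0); nra.
- assert (eps / 2 <= dist_nat (INR n * b)).
    unfold bd in B; destruct (Nat.eq_dec n 0); [lia|].
    destruct (Rlt_dec (dist_nat (INR n * b)) (eps / 2)); [discriminate | lra].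
  rewrite Rplus_0_l; apply Rmult_le_compat_l; [lra|].
  apply Rle_trans with (1 := bump_antitone _ (dist_nat (INR n * b)) (eps / 2) c0 ltac:(lra)).
  rewrite Ea; unfold bump; right; field; split; nra.
Qed.

(** [2160 = 60 * 36], from [sum_bump] and [curv]; one [exp (2 * PI)] comes from [curv], another from
    the square of the cutoff [X]. The [46] is that of [near_sum_bound]. *)
Definition off_const := 2160 * exp (4 * PI) + 46.

(** For fixed [n], only the integer nearest to [n * e2pi k] can give a large bump, collected in
    [near]; the other [m] give at most [60 * A * n ^ 2] in all. For [k = 0] that nearest integer is
    [n] itself, which [gterm] excludes. *)
Lemma gterm_sum_bound N U k : (1 <= N)%nat -> 3 <= U -> U = ln (INR N) ->
  far_from_integers U ->
  sum_1_to (fun n => sum_1_to (fun m => gterm N U k n m) N) N <= off_const * exp (- INR k) * sqrt U.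
Proof.
intros HN HU EU HD.
pose proof (e2pi_ge1 k) as b1; set (b := e2pi k) in *.
assert (N1 : 1 <= INR N) by (apply (le_INR 1); exact HN).
assert (sU : 1 <= sqrt U) by (rewrite <- sqrt_1; apply sqrt_le_1_alt; lra).
set (X := exp PI * INR N / b); set (A := curv N U k).
assert (A0 : 0 < A) by (apply curv_pos; [exact HN | lra]).
assert (X0 : 0 <= X).
  apply Rdiv_le_0_compat; [apply Rmult_le_pos; [left; apply exp_pos | lra] | lra].
pose (near := fun n => if Nat.eq_dec k 0 then 0 else if Rle_dec (INR n) X then
     / INR n * bump (A * INR n ^ 2) (dist_nat (INR n * b)) else 0).
set (w := exp (- PI * INR k)).
assert (w0 : 0 < w) by apply exp_pos.
assert (k0 : 0 <= INR k) by apply pos_INR.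
pose proof PI2_3_2 as P3; unfold PI2 in P3.
assert (wk : w <= exp (- INR k)) by (apply exp_le_exp; nra).
assert (Hin : forall n, (1 <= n <= N)%nat -> sum_1_to (fun m => gterm N U k n m) N <=
   w * near n + w * (60 * A) * (if Rle_dec (INR n) X then INR n else 0)).
{ intros n Hn; assert (n1 : 1 <= INR n) by (apply (le_INR 1); lia).
  assert (c0 : 0 < A * INR n ^ 2) by (apply Rmult_lt_0_compat; [lra | apply pow_lt; lra]).
  assert (y0 : 0 <= INR n * b) by nra.
  assert (iff : INR n * b <= exp PI * INR N <-> INR n <= X).
    unfold X; split; intros H.
    - apply Rmult_le_reg_r with b; [lra|]; field_simplify; lra.
    - apply Rmult_le_compat_r with (r := b) in H; [|lra]; field_simplify in H; lra.
  unfold near; destruct (Rle_dec (INR n) X) as [L|L].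
  - assert (L' : INR n * b <= exp PI * INR N) by (now apply iff).
    destruct (Nat.eq_dec k 0) as [K|K].
    + assert (bE : b = 1) by (unfold b, e2pi; rewrite K; simpl INR; rewrite Rmult_0_r; apply exp_0).
      assert (nr : nearest (INR n * b) = n).
        destruct (Nat.eq_dec (nearest (INR n * b)) n) as [E|E]; [exact E|].
        pose proof (nearest_far (INR n * b) n y0 ltac:(congruence)) as F.
        rewrite bE, Rmult_1_r, Rminus_diag, Rabs_R0 in F; lra.
      apply Rle_trans with (w * / INR n * (60 * (A * INR n ^ 2))).
        apply Rle_trans with (w * / INR n * sum_1_to (fun m => if Nat.eq_dec m (nearest (INR n *
            b)) then 0 else bump (A * INR n ^ 2) (INR m - INR n * b)) N).
          rewrite <- sum_1_to_scal; apply sum_1_to_le; intros m _; rewrite nr.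
          unfold gterm; fold b; fold A; destruct (Nat.eq_dec k 0); [|contradiction].
          destruct (Nat.eq_dec m n); [lra|].
          destruct (Rle_dec (INR n * b) (exp PI * INR N)); [fold w; lra | contradiction].
        apply Rmult_le_compat_l; [left; apply Rmult_lt_0_compat; [lra | apply Rinv_0_lt_compat; lra]|].
        now apply sum_bump_except.
      right; field; lra.
    + apply Rle_trans with (w * / INR n * (bump (A * INR n ^ 2) (dist_nat (INR n * b)) + 60 * (A *
        INR n ^ 2))).
        apply Rle_trans with (w * / INR n * sum_1_to (fun m => bump (A * INR n ^ 2) (INR m - INR n
            * b)) N).
          rewrite <- sum_1_to_scal; apply sum_1_to_le; intros m _.
          unfold gterm; fold b; fold A; destruct (Nat.eq_dec k 0); [contradiction|].
          destruct (Rle_dec (INR n * b) (exp PI * INR N)); [fold w; lra | contradiction].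
        apply Rmult_le_compat_l; [left; apply Rmult_lt_0_compat; [lra | apply Rinv_0_lt_compat; lra]|].
        apply Rle_trans with (1 := sum_bump _ _ _ y0 c0); apply Rplus_le_compat_r.
        unfold dist_nat, bump; rewrite pow2_abs; lra.
      right; field; lra.
  - assert (L' : ~ INR n * b <= exp PI * INR N) by (intros H; now apply L, iff).
    rewrite (sum_1_to_ext _ (fun _ => 0)), sum_1_to_const.
      destruct (Nat.eq_dec k 0); lra.
    intros m _; unfold gterm; fold b.
    destruct (Rle_dec (INR n * b) (exp PI * INR N)); [contradiction|].
    destruct (Nat.eq_dec k 0), (Nat.eq_dec m n); reflexivity. }
apply Rle_trans with (1 := sum_1_to_le _ _ _ Hin).
rewrite sum_1_to_plus, !sum_1_to_scal.
assert (Far : w * (60 * A) * sum_1_to (fun n => if Rle_dec (INR n) X then INR n else 0) N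
   <= exp (- INR k) * (2160 * exp (4 * PI) * sqrt U)).
{ pose proof (sum_n_le X N X0) as S.
  apply Rle_trans with (w * (60 * A) * (X * X)).
    apply Rmult_le_compat_l; [apply Rmult_le_pos; lra | exact S].
  replace (w * (60 * A) * (X * X)) with (w * (2160 * exp (4 * PI) * sqrt U)).
    apply Rmult_le_compat_r; [|exact wk].
    pose proof (exp_pos (4 * PI)); apply Rmult_le_pos; lra.
  unfold A, X, curv; fold b.
  replace (exp (4 * PI)) with (exp (2 * PI) * (exp PI * exp PI)) by (rewrite <- !exp_plus; f_equal; ring).
  field; lra. }
assert (Near : w * sum_1_to near N <= exp (- INR k) * (46 * sqrt U)).
{ pose proof (exp_pos (- INR k)) as ek.
  destruct (Nat.eq_dec k 0) as [K|K].
    rewrite (sum_1_to_ext _ (fun _ => 0)), sum_1_to_const.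
      rewrite Rmult_0_r, Rmult_0_r; apply Rmult_le_pos; lra.
    intros n _; unfold near; destruct (Nat.eq_dec k 0); [reflexivity | contradiction].
  destruct (Rle_lt_dec (INR k) (ln U)) as [L|L].
  - assert (H : sum_1_to near N <= 46 * sqrt U).
      rewrite (sum_1_to_ext _ (fun n => if Rle_dec (INR n) (exp PI * INR N / e2pi k) then
     / INR n * bump (curv N U k * INR n ^ 2) (dist_nat (INR n * e2pi k)) else 0)).
        apply near_sum_bound; try assumption; lia.
      intros n _; unfold near; destruct (Nat.eq_dec k 0); [contradiction | reflexivity].
    apply Rle_trans with (w * (46 * sqrt U)); [apply Rmult_le_compat_l; lra|].
    apply Rmult_le_compat_r; lra.
  (* For [k > ln U] no distance bound is available, but the trivial bound suffices:
     [exp (- PI k) <= exp (- k) / U] pays for the factor [1 + U]. *)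
  - assert (H : sum_1_to near N <= 1 + U).
      pose proof (harmonic_bounds N HN) as [_ Hh]; rewrite <- EU in Hh.
      apply Rle_trans with (2 := Hh); apply sum_1_to_le; intros n [Hn _].
      assert (n0 : 0 < INR n) by (apply lt_0_INR; lia).
      assert (i0 : 0 < / INR n) by now apply Rinv_0_lt_compat.
      assert (c0 : 0 < A * INR n ^ 2) by (apply Rmult_lt_0_compat; [lra | apply pow_lt; lra]).
      pose proof (bump_bounds _ (dist_nat (INR n * b)) c0) as [B0 B1].
      change (near n <= / INR n).
      unfold near; destruct (Rle_dec (INR n) X); [|lra].
      rewrite <- (Rmult_1_r (/ INR n)) at 2; apply Rmult_le_compat_l; lra.
    assert (wU : w <= exp (- INR k) * / U).
      replace (/ U) with (exp (- ln U)) by (rewrite exp_Ropp, exp_ln; lra); rewrite <- exp_plus.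
      apply exp_le_exp; assert (3 * INR k <= PI * INR k) by (apply Rmult_le_compat_r; lra); lra.
    apply Rle_trans with (exp (- INR k) * / U * (1 + U)).
      apply Rle_trans with (w * (1 + U)); [apply Rmult_le_compat_l; lra | apply Rmult_le_compat_r; lra].
    rewrite Rmult_assoc; apply Rmult_le_compat_l; [lra|].
    apply Rle_trans with 2; [|lra].
    apply Rmult_le_reg_l with U; [lra|]; rewrite <- Rmult_assoc, Rinv_r by lra; lra. }
unfold off_const; lra.
Qed.

(** * The mean square of zeta *)

Lemma sum_1_to_term_le f k N : (forall n, (1 <= n <= N)%nat -> 0 <= f n) -> (1 <= k <= N)%nat ->
  f k <= sum_1_to f N.
Proof.
intros H Hk; apply Rle_trans with (sum_1_to f k).
  destruct k as [|k]; [lia|]; rewrite sum_1_to_S.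
  assert (0 <= sum_1_to f k) by (apply sum_1_to_nonneg; intros; apply H; lia); lra.
apply sum_1_to_mono; [exact H | lia].
Qed.

Lemma geometric_sum M : sum_1_to (fun j => exp (- INR (pred j))) M <= 2.
Proof.
assert (H : sum_1_to (fun j => exp (- INR (pred j))) M <= 2 - 2 * exp (- INR M)).
  induction M as [|M IH]; [simpl; rewrite Ropp_0, exp_0; lra|].
  rewrite sum_1_to_S, S_INR; cbn [pred].
  replace (- (INR M + 1)) with (- INR M + - (1)) by ring; rewrite exp_plus, (exp_Ropp 1).
  pose proof (exp_pos (- INR M)).
  assert (/ exp 1 <= / 2) by (apply Rinv_le_contravar; [lra | pose proof (exp_ineq1_le 1); lra]).
  nra.
pose proof (exp_pos (- INR M)); lra.
Qed.

Lemma off_diagonal_bound N U s H Y : (s = 1 \/ s = -1) -> (1 <= N)%nat -> 3 <= U -> U = ln (INR N) ->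
  far_from_integers U -> (Y <= 2 * N)%nat -> INR N <= 2 * INR H * sqrt U ->
  sum_1_to (fun m => sum_1_to (fun n => if Nat.eq_dec m n then 0 else
    wt m n * Rabs (kern s H Y (ln (INR m) - ln (INR n)))) N) N
  <= exp (PI / 2) * (4 * INR H * INR N) * (4 * off_const * sqrt U).
Proof.
intros Hs HN HU EU HD HY HH.
set (D := exp (PI / 2) * (4 * INR H * INR N)).
assert (D0 : 0 <= D).
  unfold D; pose proof (exp_pos (PI / 2)); pose proof (pos_INR H); pose proof (pos_INR N).
  apply Rmult_le_pos; [lra | apply Rmult_le_pos; lra].
(* The sum over all [k] from 0 to [N] replaces the unknown [k] of [pair_bound]; [pred] compensates
   for sums starting at 1. *)
set (G := fun n m => sum_1_to (fun j => gterm N U (pred j) n m) (S N)).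
assert (G0 : forall n m, (1 <= n)%nat -> 0 <= G n m).
  intros n m Hn; apply sum_1_to_nonneg; intros; apply gterm_nonneg; [exact HN | exact Hn | lra].
assert (P : forall n m, (1 <= n < m)%nat -> (m <= N)%nat ->
   wt m n * Rabs (kern s H Y (ln (INR m) - ln (INR n))) <= D * G n m).
  intros n m Hnm HmN.
  destruct (pair_bound N U s H Y n m Hs Hnm HmN ltac:(lra) HY HH) as [k [Hk B]].
  apply Rle_trans with (1 := B), Rmult_le_compat_l; [exact D0|].
  apply (sum_1_to_term_le (fun j => gterm N U (pred j) n m) (S k) (S N)); [|lia].
  intros; apply gterm_nonneg; [exact HN | lia | lra].
assert (SG : sum_1_to (fun n => sum_1_to (fun m => G n m) N) N <= 2 * off_const * sqrt U).
{ unfold G; apply Rle_trans with (off_const * sqrt U * sum_1_to (fun j => exp (- INR (pred j))) (S N)).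
  - rewrite <- sum_1_to_scal.
    rewrite (sum_1_to_ext _ (fun n => sum_1_to (fun j => sum_1_to (fun m => gterm N U (pred j) n m)
        N) (S N))).
      rewrite sum_1_to_swap; apply sum_1_to_le; intros j _.
      apply Rle_trans with (1 := gterm_sum_bound N U (pred j) HN HU EU HD); right; ring.
    intros n _; apply sum_1_to_swap.
  - pose proof (geometric_sum (S N)).
    replace (2 * off_const * sqrt U) with (off_const * sqrt U * 2) by ring.
    apply Rmult_le_compat_l; [|exact H0].
    apply Rmult_le_pos; [|apply sqrt_pos].
    unfold off_const; pose proof (exp_pos (4 * PI)); lra. }
apply Rle_trans with (sum_1_to (fun m => sum_1_to (fun n => D * G n m + D * G m n) N) N).
- apply sum_1_to_le; intros m [Hm HmN]; apply sum_1_to_le; intros n [Hn HnN].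
  assert (Q1 : 0 <= D * G n m) by (apply Rmult_le_pos; auto).
  assert (Q2 : 0 <= D * G m n) by (apply Rmult_le_pos; auto).
  destruct (Nat.eq_dec m n) as [E|E]; [lra|].
  destruct (Nat.lt_total n m) as [L|[L|L]]; [|lia|].
  + pose proof (P n m ltac:(lia) HmN); lra.
  + pose proof (P m n ltac:(lia) HnN) as B.
    replace (ln (INR n) - ln (INR m)) with (- (ln (INR m) - ln (INR n))) in B by ring.
    rewrite kern_even in B; unfold wt in *; rewrite (Rmult_comm (/ sqrt (INR n))) in B; lra.
- rewrite (sum_1_to_ext _ (fun m => D * sum_1_to (fun n => G n m) N + D * sum_1_to (fun n => G m n) N)).
    2: { intros m _; now rewrite sum_1_to_plus, !sum_1_to_scal. }
  rewrite sum_1_to_plus, !sum_1_to_scal.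
  rewrite (sum_1_to_swap (fun m n => G n m)).
  assert (D * sum_1_to (fun n => sum_1_to (fun m => G n m) N) N <= D * (2 * off_const * sqrt U))
    by (apply Rmult_le_compat_l; assumption).
  lra.
Qed.

Lemma averaged_Zsq_bound N U s H Y : (s = 1 \/ s = -1) -> (1 <= N)%nat -> 3 <= U -> U = ln (INR N) ->
  far_from_integers U -> (Y <= 2 * N)%nat -> INR N <= 2 * INR H * sqrt U ->
  Rabs (sum_1_to (fun h => sum_1_to (fun u => Zsq N (INR u + s * INR h)) Y) H
     - INR H * INR Y * harmonic N)
  <= exp (PI / 2) * (4 * INR H * INR N) * (4 * off_const * sqrt U).
Proof.
intros Hs HN HU EU HD HY HH.
rewrite averaged_Zsq_expand.
apply Rle_trans with (2 := off_diagonal_bound N U s H Y Hs HN HU EU HD HY HH).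
assert (E : INR H * INR Y * harmonic N =
  sum_1_to (fun m => sum_1_to (fun n => if Nat.eq_dec n m then INR H * INR Y * / INR m else 0) N) N).
{ unfold harmonic; rewrite <- sum_1_to_scal; apply sum_1_to_ext; intros m Hm.
  assert (X : forall v M, sum_1_to (fun n => if Nat.eq_dec n m then v else 0) M = if le_dec m M
      then v else 0).
    intros v M; induction M as [|M IH]; [simpl; destruct (le_dec m 0); [lia | reflexivity]|].
    rewrite sum_1_to_S, IH; destruct (Nat.eq_dec (S M) m), (le_dec m M), (le_dec m (S M)); try lia; lra.
  rewrite X; destruct (le_dec m N); [reflexivity | lia]. }
rewrite E, <- sum_1_to_minus.
apply Rle_trans with (1 := sum_1_to_abs _ _); apply sum_1_to_le; intros m [Hm _].
rewrite <- sum_1_to_minus.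
apply Rle_trans with (1 := sum_1_to_abs _ _); apply sum_1_to_le; intros n [Hn _].
destruct (Nat.eq_dec n m) as [->|E1].
- destruct (Nat.eq_dec m m); [|congruence].
  rewrite Rminus_diag, kern_0; unfold wt.
  assert (m0 : 0 < INR m) by (apply lt_0_INR; lia).
  rewrite <- Rinv_mult, sqrt_sqrt by lra.
  replace (_ - _) with 0 by ring; rewrite Rabs_R0; lra.
- destruct (Nat.eq_dec m n) as [E2|E2]; [congruence|].
  rewrite Rminus_0_r, Rabs_mult, (Rabs_pos_eq (wt m n)); [lra|].
  unfold wt; apply Rmult_le_pos; left; apply inv_sqrt_pos; assumption.
Qed.

(** For every [h <= H], the values [u - h] with [1 <= u <= N + H] include [1, ..., N], and [Zsq] is
    nonnegative at the others. *)
Lemma averaged_upper N H : INR H * sum_1_to (fun t => Zsq N (INR t)) N <=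
  sum_1_to (fun h => sum_1_to (fun u => Zsq N (INR u + -1 * INR h)) (N + H)) H.
Proof.
rewrite <- sum_1_to_const; apply sum_1_to_le; intros h Hh.
rewrite (sum_1_to_ext _ (fun t => (fun u => Zsq N (INR u + -1 * INR h)) (h + t)%nat)).
  replace (N + H)%nat with (h + (N + H - h))%nat by lia.
  apply (sum_1_to_shift_le (fun u => Zsq N (INR u + -1 * INR h))); [intros; apply Zsq_nonneg | lia].
intros t _; f_equal; rewrite plus_INR; ring.
Qed.

(** For every [h <= H], the values [u + h] with [1 <= u <= N - H] stay within [1, ..., N]. *)
Lemma averaged_lower N H : (H <= N)%nat ->
  sum_1_to (fun h => sum_1_to (fun u => Zsq N (INR u + 1 * INR h)) (N - H)) H <=
  INR H * sum_1_to (fun t => Zsq N (INR t)) N.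
Proof.
intros HH; rewrite <- sum_1_to_const; apply sum_1_to_le; intros h Hh.
rewrite (sum_1_to_ext _ (fun t => (fun u => Zsq N (INR u)) (h + t)%nat)).
  apply Rle_trans with (sum_1_to (fun u => Zsq N (INR u)) (h + (N - h))).
    apply (sum_1_to_shift_le (fun u => Zsq N (INR u))); [intros; apply Zsq_nonneg | lia].
  replace (h + (N - h))%nat with N by lia; lra.
intros t _; f_equal; rewrite plus_INR; ring.
Qed.

Definition ms_const := 16 * exp (PI / 2) * off_const + 3.

Lemma ms_const_ge : 3 <= ms_const.
Proof.
unfold ms_const, off_const; pose proof (exp_pos (4 * PI)); pose proof (exp_pos (PI / 2)); nra.
Qed.

Lemma Zsq_mean_square N U : (1 <= N)%nat -> 3 <= U -> U = ln (INR N) -> far_from_integers U ->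
  Rabs (sum_1_to (fun t => Zsq N (INR t)) N - INR N * U) <= ms_const * (INR N * sqrt U).
Proof.
intros HN HU EU HD.
set (Q := sum_1_to (fun t => Zsq N (INR t)) N).
assert (N0 : 0 < INR N) by (apply lt_0_INR; lia).
assert (sU : 1 <= sqrt U) by (rewrite <- sqrt_1; apply sqrt_le_1_alt; lra).
pose proof (sqrt_sqrt U ltac:(lra)) as sUU.
assert (NU : 2 * sqrt U <= INR N).
  assert (EN : INR N = exp U) by (rewrite EU, exp_ln; lra).
  pose proof (exp_ineq1_le U); pose proof (pow2_ge_0 (sqrt U - 1)); nra.
(* This balances the two errors: lengthening or shortening the window by [H] costs about [H U],
   which is of order [N sqrt U], like the off-diagonal bound, which requires [N <= 2 H sqrt U]. *)
set (H := floor_nat (INR N / sqrt U)).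
assert (q2 : 2 <= INR N / sqrt U) by (apply Rmult_le_reg_r with (sqrt U); [lra|]; field_simplify; lra).
pose proof (floor_nat_spec (INR N / sqrt U) ltac:(lra)) as [h1 h2]; fold H in h1, h2.
assert (E : INR N = INR N / sqrt U * sqrt U) by (field; lra).
assert (HH : INR N <= 2 * INR H * sqrt U).
  rewrite E at 1; apply Rmult_le_compat_r; lra.
assert (HsU : INR H * sqrt U <= INR N).
  rewrite E; apply Rmult_le_compat_r; lra.
assert (H0 : 0 < INR H) by lra.
assert (HleN : (H <= N)%nat).
  apply INR_le; apply Rle_trans with (2 := HsU); nra.
pose proof (harmonic_bounds N HN) as Hh; rewrite <- EU in Hh.
pose proof (averaged_Zsq_bound N U (-1) H (N + H) (or_intror eq_refl) HN HU EU HD ltac:(lia) HH) as B1.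
pose proof (averaged_Zsq_bound N U 1 H (N - H) (or_introl eq_refl) HN HU EU HD ltac:(lia) HH) as B2.
pose proof (averaged_upper N H) as A1; fold Q in A1.
pose proof (averaged_lower N H HleN) as A2; fold Q in A2.
apply Rabs_le_between in B1; apply Rabs_le_between in B2.
rewrite plus_INR in B1; rewrite minus_INR in B2 by exact HleN.
set (D := 16 * exp (PI / 2) * off_const).
replace (exp (PI / 2) * (4 * INR H * INR N) * (4 * off_const * sqrt U)) with
  (INR H * (D * (INR N * sqrt U))) in B1, B2 by (unfold D; ring).
set (W := D * (INR N * sqrt U)) in *.
assert (U1 : Q <= (INR N + INR H) * harmonic N + W).
  apply Rmult_le_reg_l with (INR H); [exact H0|]; lra.
assert (L1 : (INR N - INR H) * harmonic N - W <= Q).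
  apply Rmult_le_reg_l with (INR H); [exact H0|]; lra.
assert (Hhar : INR H * harmonic N <= 2 * (INR N * sqrt U)).
  apply Rle_trans with (INR H * (2 * U)); [apply Rmult_le_compat_l; lra|].
  apply Rle_trans with (2 * (INR H * sqrt U) * sqrt U); [right; rewrite <- sUU at 1; ring|].
  apply Rle_trans with (2 * INR N * sqrt U); [apply Rmult_le_compat_r; lra | lra].
assert (NH : INR N * U <= INR N * harmonic N <= INR N * U + INR N * sqrt U) by nra.
unfold ms_const; fold D; fold W.
replace ((D + 3) * (INR N * sqrt U)) with (W + 3 * (INR N * sqrt U)) by (unfold W; ring).
apply Rabs_le; lra.
Qed.

Lemma sum_inv_sqr N : sum_1_to (fun t => / INR t ^ 2) N <= 2.
Proof.
assert (H : (1 <= N)%nat -> sum_1_to (fun t => / INR t ^ 2) N <= 2 - / INR N).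
{ intros HN; induction HN as [|N HN IH]; [simpl; lra|].
  assert (1 <= INR N) by (apply (le_INR 1); exact HN).
  rewrite sum_1_to_S, S_INR.
  assert (/ (INR N + 1) ^ 2 <= / INR N - / (INR N + 1)).
    apply Rmult_le_reg_r with (INR N * (INR N + 1) ^ 2); [nra|]; field_simplify; nra.
  lra. }
destruct N as [|N]; [simpl; lra|].
specialize (H ltac:(lia)); assert (0 < / INR (S N)) by (apply Rinv_0_lt_compat, lt_0_INR; lia); lra.
Qed.

(** The weight [d] is left free to balance, after summation over [t], the part proportional to the
    mean square of [Z_N] against the part from the approximation error. *)
Lemma zeta_sq_approx (t N : nat) d : (1 <= t <= N)%nat -> 0 < d ->
  Rabs (Cmod (zeta (1 / 2, INR t)) ^ 2 - Zsq N (INR t)) <=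
  d * Zsq N (INR t) + (1 + / d) * (160000 * INR N * / INR t ^ 2).
Proof.
intros Ht Hd.
set (Z := (Zcos N (INR t), - Zsin N (INR t)) : C).
assert (t0 : 0 < INR t) by (apply lt_0_INR; lia).
assert (EZ : Zsq N (INR t) = Cmod Z ^ 2).
  unfold Cmod; rewrite pow2_sqrt.
    unfold Z, Zsq; cbn [fst snd]; ring.
  unfold Z; cbn [fst snd].
  pose proof (pow2_ge_0 (Zcos N (INR t))); pose proof (pow2_ge_0 (- Zsin N (INR t))); lra.
pose proof (zeta_approx t N Ht) as A; fold Z in A.
set (z := zeta (1 / 2, INR t)) in *.
set (e := 400 * (sqrt (INR N) / INR t)) in *.
assert (Ee : e ^ 2 = 160000 * INR N * / INR t ^ 2).
  unfold e; pose proof (sqrt_sqrt (INR N) (pos_INR N)) as S.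
  rewrite <- S at 2; field; lra.
rewrite EZ, <- Ee.
assert (H1 : Cmod z <= Cmod Z + e).
  replace z with (Cplus Z (Cminus z Z)) by ring.
  apply Rle_trans with (1 := Cmod_triangle _ _); lra.
assert (H2 : Cmod Z <= Cmod z + e).
  replace Z with (Cplus z (Copp (Cminus z Z))) by ring.
  apply Rle_trans with (1 := Cmod_triangle _ _); rewrite Cmod_opp; lra.
pose proof (Cmod_ge_0 z) as z0; pose proof (Cmod_ge_0 Z) as Z0.
assert (e0 : 0 <= e) by (pose proof (Cmod_ge_0 (Cminus z Z)); lra).
set (a := Cmod z) in *; set (b := Cmod Z) in *.
assert (H3 : Rabs (a ^ 2 - b ^ 2) <= e * (2 * b + e)).
  replace (a ^ 2 - b ^ 2) with ((a - b) * (a + b)) by ring; rewrite Rabs_mult.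
  apply Rmult_le_compat; try apply Rabs_pos; [apply Rabs_le; lra | rewrite Rabs_pos_eq; lra].
apply Rle_trans with (1 := H3).
(* AM-GM: [2 b e <= d b ^ 2 + e ^ 2 / d] *)
assert (0 <= d * (b - e / d) ^ 2) by (apply Rmult_le_pos; [lra | apply pow2_ge_0]).
replace (d * (b - e / d) ^ 2) with (d * b ^ 2 - 2 * b * e + / d * e ^ 2) in H by (field; lra).
nra.
Qed.

(** One [ms_const] comes from the mean square of [Z_N], the other together with 1 from [d * Q], and
    [640000] from [(1 + sqrt U) * 320000]. *)
Definition zeta_const := 2 * ms_const + 640001.

Lemma zeta_mean_square N U : (1 <= N)%nat -> 3 <= U -> U = ln (INR N) -> far_from_integers U ->
  Rabs (sum_1_to (fun n => Cmod (zeta (1 / 2, INR n)) ^ 2) N - INR N * U)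
  <= zeta_const * (INR N * sqrt U).
Proof.
intros HN HU EU HD.
pose proof (Zsq_mean_square N U HN HU EU HD) as M.
set (Q := sum_1_to (fun t => Zsq N (INR t)) N) in *.
set (V := sum_1_to (fun n => Cmod (zeta (1 / 2, INR n)) ^ 2) N).
assert (N0 : 0 < INR N) by (apply lt_0_INR; lia).
assert (sU : 1 <= sqrt U) by (rewrite <- sqrt_1; apply sqrt_le_1_alt; lra).
pose proof (sqrt_sqrt U ltac:(lra)) as sUU.
(* With this weight [d * Q] is about [N sqrt U] and [(1 + / d) * N] is of the same order. *)
set (d := / sqrt U).
assert (d0 : 0 < d) by (apply Rinv_0_lt_compat; lra).
assert (B : Rabs (V - Q) <= d * Q + (1 + / d) * (160000 * INR N * 2)).
{ unfold V, Q; rewrite <- sum_1_to_minus.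
  apply Rle_trans with (1 := sum_1_to_abs _ _).
  apply Rle_trans with (sum_1_to (fun t => d * Zsq N (INR t) + (1 + / d) * (160000 * INR N * / INR
      t ^ 2)) N).
    apply sum_1_to_le; intros t Ht; now apply zeta_sq_approx.
  rewrite sum_1_to_plus, !sum_1_to_scal; apply Rplus_le_compat_l.
  assert (0 < / d) by now apply Rinv_0_lt_compat.
  apply Rmult_le_compat_l; [lra|]; apply Rmult_le_compat_l; [lra | apply sum_inv_sqr]. }
unfold d in B at 2; rewrite Rinv_inv in B.
apply Rabs_le_between in M; apply Rabs_le_between in B.
pose proof ms_const_ge as mc.
assert (Qb : d * Q <= INR N * sqrt U + ms_const * INR N).
  apply Rle_trans with (d * (INR N * U + ms_const * (INR N * sqrt U))); [apply Rmult_le_compat_l; lra|].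
  right; unfold d; rewrite <- sUU at 2; field; lra.
assert (INR N <= INR N * sqrt U) by nra.
assert (ms_const * INR N <= ms_const * (INR N * sqrt U)) by (apply Rmult_le_compat_l; lra).
unfold zeta_const; apply Rabs_le; lra.
Qed.

Theorem mainTheorem1 :
  exists c : R, c > 0 /\
  exists K T0 : R, forall T : R, T >= T0 ->
    Rabs (sum_1_to (fun n => (Cmod (zeta (1/2, INR n))) ^ 2) (floor_nat T)
          - T * ln (T / (2 * PI)))
    <= K * (T * ln T * exp (- c * (ln (ln T) / ln (ln (ln T))))).
Proof.
(* [exp (- log_2 T / 2) = 1 / sqrt (ln T)], and dividing the exponent by [log_3 T >= 1] only
   enlarges the allowed error. *)
exists (1 / 2); split; [lra|].
destruct power_e2pi_measure as [U0 [U01 HD0]].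
(* [9 = 7 + 2]: [ln (2 PI) <= 7], and passing from [N ln N] to [T ln T] costs at most [2 T]. The
   final [+ 1] allows for the integer part of [T]; the 100 ensures [ln T >= exp (exp 1)], hence
   [log_3 T >= 1]. *)
exists (zeta_const + 9), (exp (U0 + 100) + 1); intros T HT.
set (N := floor_nat T).
pose proof (exp_ineq1_le (U0 + 100)) as E1.
pose proof (floor_nat_spec T ltac:(lra)) as [N1 N2]; fold N in N1, N2.
set (U := ln (INR N)).
assert (HU : U0 + 100 <= U).
  rewrite <- (ln_exp (U0 + 100)); apply ln_le; [apply exp_pos | lra].
assert (HN : (1 <= N)%nat) by (apply INR_le; simpl INR; lra).
assert (HD : far_from_integers U).
  intros k q p Hk Hq HkU HqU; apply HD0; try assumption; lra.
pose proof (zeta_mean_square N U HN ltac:(lra) eq_refl HD) as B.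
set (V := sum_1_to _ N) in *.
set (l := ln T).
assert (Ul : U <= l) by (apply ln_le; lra).
assert (l100 : 100 <= l) by lra.
assert (sl : 10 <= sqrt l).
  replace 10 with (sqrt (10 * 10)) by (apply sqrt_square; lra); apply sqrt_le_1_alt; lra.
assert (sUl : sqrt U <= sqrt l) by (apply sqrt_le_1_alt; exact Ul).
assert (zc : 0 <= zeta_const) by (unfold zeta_const; pose proof ms_const_ge; lra).
assert (B' : zeta_const * (INR N * sqrt U) <= zeta_const * (T * sqrt l)).
  apply Rmult_le_compat_l; [exact zc|]; apply Rmult_le_compat; [lra | apply sqrt_pos | lra | exact sUl].
pose proof PI_4 as P4; pose proof PI2_3_2 as P3; unfold PI2 in P3.
assert (E2 : ln (T / (2 * PI)) = l - ln (2 * PI)) by (apply ln_div; lra).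
assert (lp : 0 <= ln (2 * PI) <= 7).
  split; [rewrite <- ln_1; apply ln_le; lra|].
  pose proof (ln_le_sub1 (2 * PI) ltac:(lra)); lra.
assert (F1 : INR N * U <= T * l) by (apply Rmult_le_compat; lra).
assert (F2 : T * l <= INR N * U + 2 * T).
  assert (l - U <= T / INR N - 1).
    unfold l, U; rewrite <- ln_div by lra; apply ln_le_sub1, Rdiv_lt_0_compat; lra.
  assert (INR N * (l - U) <= T - INR N).
    replace (T - INR N) with (INR N * (T / INR N - 1)) by (field; lra).
    apply Rmult_le_compat_l; lra.
  assert (l <= T) by (unfold l; pose proof (ln_le_sub1 T ltac:(lra)); lra).
  nra.
apply Rabs_le_between in B.
apply Rle_trans with ((zeta_const + 9) * (T * sqrt l)).
  assert (T <= T * sqrt l) by nra.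
  rewrite E2; assert (0 <= T * ln (2 * PI) <= 7 * T) by nra.
  apply Rabs_le; lra.
apply Rmult_le_compat_l; [lra|].
rewrite Rmult_assoc; apply Rmult_le_compat_l; [lra|].
set (l2 := ln l).
assert (e1 : exp 1 <= l2).
  assert (exp (exp 1) <= 100).
    apply Rle_trans with (exp 3); [apply exp_le_exp, exp_le_3|].
    replace 3 with (1 + 1 + 1) by ring; rewrite !exp_plus; pose proof exp_le_3; pose proof (exp_pos
        1); nra.
  rewrite <- (ln_exp (exp 1)); apply ln_le; [apply exp_pos | lra].
assert (l3 : 1 <= ln l2) by (rewrite <- (ln_exp 1); apply ln_le; [apply exp_pos | exact e1]).
assert (l20 : 0 < l2) by (pose proof (exp_pos 1); lra).
assert (q : l2 / ln l2 <= l2).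
  apply Rmult_le_reg_r with (ln l2); [lra|]; field_simplify; [nra | lra].
apply Rle_trans with (l * exp (- (1 / 2) * l2)).
- assert (E3 : exp (- (1 / 2) * l2) = / sqrt l).
    rewrite <- Rpower_sqrt by lra; unfold Rpower, l2; rewrite <- exp_Ropp; f_equal; field.
  rewrite E3; right; rewrite <- (sqrt_sqrt l) at 2 by lra; field; lra.
- apply Rmult_le_compat_l; [lra|]; apply exp_le_exp; lra.
Qed.
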